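(* (i) The sequence $(\beta[p_n])_{n\ge 0}$ defined by $$\beta[p_n]=\frac{(\mathsf r_1)_n}{(\lambda_1)_n}\,\frac{W_\phi(n+1)}{n!},\qquad n\in\mathbb N=\{0,1,2,\dots\},$$ is a Stieltjes moment determinate sequence (i.e. it is the moment sequence of a unique probability measure on $[0,\infty)$), and the corresponding probability measure $\beta$ is absolutely continuous with support $[0,1]$ and has a continuous density that is positive on $(0,1)$. (ii) The operator $\mathbb J$, defined on the space $\mathcal P$ of polynomials, extends to an operator on $L^2(\beta)$, still denoted by $\mathbb J$, which is the infinitesimal generator, having $\mathcal P$ as a core, of an ergodic Markov semigroup $Q=(Q_t)_{t\ge 0}$ on $L^2(\beta)$ whose unique invariant measure is $\beta$.
   Context: Standing assumption: $\lambda_1,\mu\in(0,\infty)$ and $h:(1,\infty)\to[0,\infty)$ (set to $0$ outside $(1,\infty)$) satisfy $\hbar:=\int_1^\infty h(r)\,dr<\infty$; $\Pi(dr)=-(e^rh(e^r))'\,dr$ is a finite non-negative Radon measure on $(0,\infty)$; if $h\not\equiv0$ then $\lambda_1>\mathbf 1_{\{\mu<1+\hbar\}}+\mu$ and $\mu>\hbar$; if $h\equiv 0$ then $\lambda_1>\mu>0$. The non-local Jacobi operator is $$\mathbb J f(x)=x(1-x)f''(x)-(\lambda_1x-\mu)f'(x)-\int_1^\infty h(r)f'(x/r)\frac{dr}{r},\qquad x\in[0,1].$$ $\Psi(u)=u^2+(\mu-\hbar-1)u+u\int_1^\infty(1-r^{-u})h(r)\,dr$, $u\ge0$. This function vanishes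 at $0$ and has a root $\mathsf r>0$ if and only if $\mu<1+\hbar$. Put $\mathsf r_0=\mathsf r\,\mathbf 1_{\{\mu<1+\hbar\}}$, $\mathsf r_1=1-\mathsf r_0$, and $\phi(u)=\Psi(u)/(u-\mathsf r_0)$, $u\ge 0$ (extended continuously at $u=\mathsf r_0$). $W_\phi(n+1)=\prod_{k=1}^n\phi(k)$, with $W_\phi(1)=1$. $(a)_x=\Gamma(a+x)/\Gamma(a)$. $p_n(x)=x^n$ on $[0,1]$; $\mathcal P$ is the algebra of polynomials on $[0,1]$; $\beta[f]=\int_0^1f\,d\beta$. A Markov semigroup on $C[0,1]$ is a one-parameter semigroup of linear operators $Q_t$ on $C[0,1]$ such that for all $f\in C[0,1]$ and $t\ge0$: $Q_t\mathbf 1=\mathbf 1$, $Q_tf\ge0$ if $f\ge0$, $\|Q_tf\|_\infty\le\|f\|_\infty$, and $\lim_{t\to0}\|Q_tf-f\|_\infty=0$. A probability measure $\beta$ on $[0,1]$ is invariant if $\beta[Q_tf]=\beta[f]$ for all $f\in C[0,1]$, $t\ge 0$; the semigroup then extends to $L^2(\beta)$, and this extension is what is called a Markov semigroup on $L^2(\beta)$. It is ergodic if $\lim_{T\to\infty}\frac1T\int_0^TQ_tf\,dt=\beta[f]$ in $L^2(\beta)$ for every $f\in L^2(\beta)$. *)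

(* Defs.v *)
From HB Require Import structures.
From mathcomp Require Import all_boot all_order all_algebra.
From mathcomp Require Import all_classical all_reals all_analysis.

Set Implicit Arguments.
Unset Strict Implicit.
Unset Printing Implicit Defensive.

Import Order.TTheory GRing.Theory Num.Theory.
Import numFieldNormedType.Exports.

Local Open Scope classical_set_scope.
Local Open Scope ring_scope.

Section JacobiData.
Context {R : realType}.
Implicit Types (h : R -> R) (mu : R).

Let leb := @lebesgue_measure R.

(* C^1 functions with compact support in (0, +oo) *)
Definition test_fun (f : R -> R) : Prop :=
  [/\ forall x, derivable f x 1, continuous (derive1 f) &
      exists a b : R, 0 < a /\ forall x, x \notin `[a, b] -> f x = 0].

(* Pi(dr) = - (e^r h(e^r))' dr on (0, +oo), the derivative being taken in the
   sense of distributions (for a locally integrable function whose derivative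
   is a measure, C^1 and C^oo test functions are equivalent). *)
Definition minus_derivative_measure h
    (Pi : {finite_measure set (measurableTypeR R) -> \bar R}) : Prop :=
  Pi `]-oo, 0]%classic = 0%E /\
  forall f : R -> R, test_fun f ->
    \int[leb]_(r in `]0, +oo[) (expR r * h (expR r) * derive1 f r) =
    \int[Pi]_(r in `]0, +oo[) f r.

Definition hbar h : R := \int[leb]_(r in `]1, +oo[) h r.

Definition Jacobi_op (lambda1 : R) mu h (f : R -> R) (x : R) : R :=
  x * (1 - x) * derive1n 2 f x - (lambda1 * x - mu) * derive1 f x
  - \int[leb]_(r in `]1, +oo[) (h r * derive1 f (x / r) / r).

Definition Psi mu h (u : R) : R :=
  u ^+ 2 + (mu - hbar h - 1) * u
  + u * \int[leb]_(r in `]1, +oo[) ((1 - r `^ (- u)) * h r).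

Definition rroot mu h : R := xget 0 [set u : R | 0 < u /\ Psi mu h u = 0].

Definition r0 mu h : R := rroot mu h * (mu < 1 + hbar h)%R%:R.

Definition r1 mu h : R := 1 - r0 mu h.

(* The value at r0 is the continuous extension; a right limit is taken since
   Psi is only considered on [0, +oo) and r0 may be 0. *)
Definition phi mu h (u : R) : R :=
  let q v := Psi mu h v / (v - r0 mu h) in
  if u == r0 mu h then lim (q v @[v --> (r0 mu h)^'+]) else q u.

Definition W_phi mu h (m : nat) : R := \prod_(1 <= k < m) phi mu h k%:R.

Definition Gamma (a : R) : R :=
  \int[leb]_(t in `]0, +oo[) (t `^ (a - 1) * expR (- t)).

Definition pochhammer (a x : R) : R := Gamma (a + x) / Gamma a.

Definition beta_moment (lambda1 : R) mu h (n : nat) : R :=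
  pochhammer (r1 mu h) n%:R / pochhammer lambda1 n%:R
  * (W_phi mu h n.+1 / n`!%:R).

End JacobiData.

Section Measures.
Context {R : realType}.
Implicit Types nu : probability (measurableTypeR R) R.

Definition Stieltjes_moments (m : nat -> R) nu : Prop :=
  nu `[0, +oo[%classic = 1%E /\
  forall n, (\int[nu]_(x in `[0%R, +oo[) (x ^+ n)%:E)%E = (m n)%:E.

Definition msupport nu : set R :=
  [set x | forall U : set R, open U -> U x -> (0 < nu U)%E].

Definition is_density nu (f : R -> R) : Prop :=
  forall A : set (measurableTypeR R), measurable A ->
    nu A = (\int[@lebesgue_measure R]_(x in A) (f x)%:E)%E.

End Measures.

(* Elements of C[0,1] are represented by functions R -> R, identified when
   they agree on [0,1]. *)
Section MarkovC01.
Context {R : realType}.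
Implicit Types (f g : R -> R) (Q : R -> (R -> R) -> R -> R).

Definition C01 f : Prop := {within `[0, 1], continuous f}.

Definition sup_norm01 f : R := sup [set `|f x| | x in `[0, 1]].

Record Markov_semigroup_C01 Q : Prop := {
  MC_C01 : forall t f, 0 <= t -> C01 f -> C01 (Q t f);
  MC_compat : forall t f g, 0 <= t -> C01 f -> C01 g ->
    {in `[0, 1], f =1 g} -> {in `[0, 1], Q t f =1 Q t g};
  MC_linear : forall t (a : R) f g, 0 <= t -> C01 f -> C01 g ->
    {in `[0, 1], Q t (a *: f + g) =1 a *: Q t f + Q t g};
  MC_0 : forall f, C01 f -> {in `[0, 1], Q 0 f =1 f};
  MC_add : forall s t f, 0 <= s -> 0 <= t -> C01 f ->
    {in `[0, 1], Q (s + t) f =1 Q s (Q t f)};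
  MC_one : forall t, 0 <= t -> {in `[0, 1], Q t (cst 1) =1 cst 1};
  MC_pos : forall t f, 0 <= t -> C01 f ->
    {in `[0, 1], forall x, 0 <= f x} -> {in `[0, 1], forall x, 0 <= Q t f x};
  MC_contraction : forall t f, 0 <= t -> C01 f ->
    sup_norm01 (Q t f) <= sup_norm01 f;
  MC_continuous : forall f, C01 f ->
    sup_norm01 (Q t f - f) @[t --> 0^'+] --> 0 }.

Definition invariant_measure Q (nu : probability (measurableTypeR R) R) : Prop :=
  nu `[0, 1]%classic = 1%E /\
  forall t f, 0 <= t -> C01 f ->
    \int[nu]_(x in `[0, 1]) Q t f x = \int[nu]_(x in `[0, 1]) f x.

End MarkovC01.

(* Elements of L^2(beta) are represented by square integrable functions,
   identified when they are beta-a.e. equal; operators on L^2(beta) are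
   functions on representatives that respect this identification. *)
Section L2.
Context {R : realType} (beta : probability (measurableTypeR R) R).
Implicit Types (f g : R -> R) (Q : R -> (R -> R) -> R -> R).

Definition L2 f : Prop := f \in Lfun beta 2%:E.

Definition l2norm f : \bar R := ('N[beta]_2%:E[EFin \o f])%E.

(* a function on [0,1], as an element of L^2(beta) when beta([0,1]) = 1 *)
Definition on01 f : R -> R := f \_ `[0, 1].

(* Q is the extension to L^2(beta), by contractions, of the semigroup QC on
   C[0,1]. *)
Record L2_extension (QC Q : R -> (R -> R) -> R -> R) : Prop := {
  L2E_L2 : forall t f, 0 <= t -> L2 f -> L2 (Q t f);
  L2E_compat : forall t f g, 0 <= t -> L2 f -> L2 g ->
    f = g %[ae beta] -> Q t f = Q t g %[ae beta];
  L2E_linear : forall t (a : R) f g, 0 <= t -> L2 f -> L2 g ->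
    Q t (a *: f + g) = a *: Q t f + Q t g %[ae beta];
  L2E_contraction : forall t f, 0 <= t -> L2 f ->
    (l2norm (Q t f) <= l2norm f)%E;
  L2E_0 : forall f, L2 f -> Q 0 f = f %[ae beta];
  L2E_add : forall s t f, 0 <= s -> 0 <= t -> L2 f ->
    Q (s + t) f = Q s (Q t f) %[ae beta];
  L2E_continuous : forall f, L2 f ->
    l2norm (Q t f - f) @[t --> 0^'+] --> 0%E;
  L2E_extends : forall t f, 0 <= t -> C01 f ->
    Q t (on01 f) = on01 (QC t f) %[ae beta] }.

Definition generator_limit Q f g : Prop :=
  l2norm (t^-1 *: (Q t f - f) - g) @[t --> 0^'+] --> 0%E.

(* A with domain D is the infinitesimal generator of Q *)
Definition is_generator Q (D : set (R -> R)) (A : (R -> R) -> R -> R) : Prop :=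
  (forall f, D f <-> L2 f /\ exists g, L2 g /\ generator_limit Q f g) /\
  (forall f, D f -> L2 (A f) /\ generator_limit Q f (A f)).

(* density of S in the domain D of A for the graph norm *)
Definition is_core (D : set (R -> R)) (A : (R -> R) -> R -> R)
    (S : set (R -> R)) : Prop :=
  S `<=` D /\
  forall f (e : R), D f -> 0 < e -> exists g, S g /\
    (l2norm (f - g)%R < e%:E)%E /\ (l2norm (A f - A g)%R < e%:E)%E.

(* I is the L^2(beta)-valued Riemann integral of F over [0, T], i.e. the limit
   of tagged Riemann sums as the mesh tends to 0. *)
Definition L2_Riemann_integral (F : R -> R -> R) (T : R) (I : R -> R) : Prop :=
  L2 I /\
  forall e : R, 0 < e -> exists2 d : R, 0 < d &
    forall (n : nat) (s tau : nat -> R), s 0%N = 0 -> s n = T ->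
      (forall i, (i < n)%N -> s i <= tau i <= s i.+1 /\ s i.+1 - s i < d) ->
      (l2norm (\sum_(i < n) (s i.+1 - s i) *: F (tau i) - I)%R < e%:E)%E.

Definition ergodic Q : Prop :=
  forall f, L2 f -> exists I : R -> R -> R,
    (forall T, 0 < T -> L2_Riemann_integral (fun t => Q t f) T (I T)) /\
    l2norm (T^-1 *: I T - cst (\int[beta]_x f x)) @[T --> +oo] --> 0%E.

End L2.

(* Main.v *)
Require Import Defs.
From HB Require Import structures.
From mathcomp Require Import all_boot all_order all_algebra.
From mathcomp Require Import all_classical all_reals all_analysis.
From mathcomp Require Import measurable_realfun.
From mathcomp Require Import ring lra.

Set Implicit Arguments.
Unset Strict Implicit.
Unset Printing Implicit Defensive.

Import Order.TTheory GRing.Theory Num.Theory.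
Import numFieldNormedType.Exports.

Local Open Scope classical_set_scope.
Local Open Scope ring_scope.

(** The operator acts on monomials by J x^n = a_n x^(n-1) - th_n x^n, with
    a_n = Psi(n) and th_n = n (n - 1 + lambda1). Since the th_n are distinct, J is
    diagonalizable on polynomials, and any function of J (resolvents, exp (t J),
    time averages) is the operator [eig_mult F] that multiplies the k-th
    eigenpolynomial by F k. An invariant law must have moments m_n with
    a_n m_(n-1) = th_n m_n, that is m_n = prod_(k <= n) a_k / th_k; the equations
    Gamma (x + 1) = x Gamma x and Psi k = (k - r0) phi k identify this product with
    the stated moments ([beta_momentE]). The coordinate of a polynomial along the
    constant eigenpolynomial is its integral against this law.

    The law. In the variable x = e^-t the recurrence for the moments becomes the
    balance equation (p + mu) L(p) = (p + lambda1) L(p + 1) + L(p) K(p), at p = n,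
    between the Laplace transforms L of the unknown density and K of the jump tail.
    Without jumps it is solved by v t = e^(- mu t) (1 - e^-t)^(lambda1 - mu - 1). In
    general one writes the density as v G; variation of constants gives a Volterra
    equation for G, which is solved by monotone iteration from G = 1
    ([volterra_density]). The iteration stays finite because finiteness of Pi forces
    e^s h(e^s) to be almost everywhere bounded ([ae_log_weight_le]), and the solution
    has finite mass because hbar < mu. Continuity and positivity of the density are
    those of v and G. The moments are at most 1, which confines any measure having
    them to [0,1], where polynomials determine it.

    The semigroup on C[0,1]. J satisfies the positive minimum principle on
    polynomials ([jacobi_minimum_principle]): the local part by elementary calculus,
    the jump part because Pi >= 0 says that e^s h(e^s) is nonincreasing in the weak
    sense. Hence the resolvents (1 - s J)^-1, which preserve polynomials, are positive,
    and so is exp (t J) as the limit of their powers. A positive operator fixing 1 is a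
    contraction for the uniform norm, so it extends to C[0,1] by the Weierstrass
    theorem ([semigroup01_markov]). As t grows, exp (t J) p tends uniformly to the
    constant coordinate of p, whence uniqueness of the invariant law.

    The semigroup on L2. Jensen's inequality and invariance make exp (t J) an L2
    contraction on polynomials, which are dense. Polynomials are a core because 1 - J
    maps them onto themselves and the generator is dissipative ([L2_core]). The time
    average over [0, T] is the multiplier (1 - e^(- th T)) / (th T), which tends to the
    projection on constants; this is ergodicity ([semigroup2_ergodic]). *)

(** * Lebesgue integrals: densities, changes of variable, convolution *)

Section DensityMeasure.
Context d (T : measurableType d) {R : realType}.
Variables (mu : {measure set T -> \bar R}) (w : T -> R).
Hypothesis mw : measurable_fun [set: T] w.
Hypothesis w0 : (forall x, 0 <= w x).

(** The proofs are arguments, so that the measure structure attached to the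
   density can be inferred. *)
Definition density_measure (mw : measurable_fun [set: T] w)
  (w0 : (forall x, 0 <= w x)) (A : set T) : \bar R := (\int[mu]_(x in A) (w x)%:E)%E.

Let dens := density_measure mw w0.

Let dens0 : dens set0 = 0%E.
Proof. by rewrite /dens /density_measure integral_set0. Qed.

Let dens_ge0 A : (0 <= dens A)%E.
Proof. by apply: integral_ge0 => x _; rewrite lee_fin. Qed.

Let dens_semi_sigma_additive : semi_sigma_additive dens.
Proof.
move=> /= F mF tF mUF; rewrite /dens /density_measure; apply: cvg_toP.
  apply: ereal_nondecreasing_is_cvgn => m n mn.
  by apply: lee_sum_nneg_natr => // k _ _; exact: dens_ge0.
rewrite ge0_integral_bigcup//=.
- exact/measurable_funTS/measurable_EFinP.
- by move=> x _; rewrite lee_fin.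
Qed.

HB.instance Definition _ := isMeasure.Build _ _ _ (density_measure mw w0)
  dens0 dens_ge0 dens_semi_sigma_additive.

Import HBNNSimple.

(** Linearity for simple functions, then monotone convergence on both sides. *)
Lemma ge0_integral_density (f : T -> \bar R) :
  measurable_fun [set: T] f -> (forall x, 0 <= f x)%E ->
  (\int[density_measure mw w0]_x f x = \int[mu]_x (f x * (w x)%:E))%E.
Proof.
move=> mf f0.
pose f_ := nnsfun_approx measurableT mf.
have cvgf x : (f_ n x)%:E @[n --> \oo] --> f x by exact: cvg_nnsfun_approx.
transitivity (limn (fun n => \int[density_measure mw w0]_x (f_ n x)%:E))%E.
  rewrite -monotone_convergence//.
  - by apply: eq_integral => y _; apply/esym/cvg_lim.
  - by move=> n; exact/measurable_EFinP/measurable_funP.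
  - by move=> n y _; rewrite lee_fin.
  - by move=> y _ m n mn; rewrite lee_fin; exact/lefP/nd_nnsfun_approx.
have -> : (fun n => \int[density_measure mw w0]_x (f_ n x)%:E)%E =
    (fun n => \int[mu]_x ((f_ n x)%:E * (w x)%:E))%E.
  apply/funext => n.
  transitivity (\sum_(k \in range (f_ n))
      \int[density_measure mw w0]_x (k * \1_(f_ n @^-1` [set k]) x)%:E)%E.
    under eq_integral do rewrite fimfunE -fsumEFin//.
    rewrite ge0_integral_fsum//.
    - by move=> y; exact/measurable_EFinP/measurable_funM.
    - by move=> y x _; rewrite nnfun_muleindic_ge0.
  transitivity (\sum_(k \in range (f_ n))
      \int[mu]_x ((k * \1_(f_ n @^-1` [set k]) x)%:E * (w x)%:E))%E.
    apply: eq_fsbigr => r _; rewrite integralZl_indic_nnsfun// integral_indic//= setIT.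
    under [in RHS]eq_integral do rewrite EFinM -muleA muleC.
    have [r0|r0] := ltP r 0.
      rewrite preimage_nnfun0// measure0 mule0.
      by rewrite integral0_eq// => x _; rewrite indic0 mul0e mul0e.
    rewrite ge0_integralZr//.
    - rewrite muleC /density_measure; congr (_ * _)%E.
      rewrite [in LHS]integral_mkcond; apply: eq_integral => x _.
      by rewrite epatch_indic muleC.
    - by apply: emeasurable_funM; exact/measurable_EFinP.
    - by move=> x _; rewrite mule_ge0// lee_fin.
  rewrite -ge0_integral_fsum//.
  - apply: eq_integral => x _.
    rewrite -ge0_mule_fsuml; last by move=> r; rewrite nnfun_muleindic_ge0.
    by rewrite fsumEFin// -fimfunE.
  - move=> r; apply: emeasurable_funM; last exact/measurable_EFinP.
    exact/measurable_EFinP/measurable_funM.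
  - by move=> r x _; rewrite mule_ge0 ?lee_fin// -lee_fin EFinM nnfun_muleindic_ge0.
rewrite -monotone_convergence//.
- apply: eq_integral => x _; apply/cvg_lim => //.
  have [->|wx0] := eqVneq (w x) 0.
    under eq_fun do rewrite mule0.
    by rewrite mule0; exact: cvg_cst.
  apply: cvgeM; [|exact: cvgf|exact: cvg_cst].
  by rewrite mule_defE/= eqe (negbTE wx0) !andbF.
- by move=> n; apply: emeasurable_funM; exact/measurable_EFinP.
- by move=> n x _; rewrite mule_ge0// lee_fin.
- move=> x _ m n mn; rewrite lee_wpmul2r ?lee_fin//.
  exact/lefP/nd_nnsfun_approx.
Qed.

End DensityMeasure.

Section IntegrationTools.
Context {R : realType}.
Local Notation leb := (@lebesgue_measure R).

Lemma ge0_integral_shift (c : R) (f : R -> \bar R) :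
  measurable_fun [set: R] f -> (forall x, 0 <= f x)%E ->
  (\int[leb]_x f (x + c)%R = \int[leb]_x f x)%E.
Proof.
move=> mf f0.
have mphi : measurable_fun [set: measurableTypeR R]
    (fun x : R => x + c : measurableTypeR R).
  exact: measurable_funD.
pose phi : {mfun measurableTypeR R >-> measurableTypeR R} :=
  HB.pack (fun x : R => x + c) (isMeasurableFun.Build _ _ _ _ _ mphi).
have shiftE A : measurable A -> leb A = pushforward leb phi A.
  apply: lebesgue_measure_unique => // X /ocitvP[->|[[a b] /= ab ->]].
    by rewrite !measure0.
  rewrite /pushforward/= (_ : _ @^-1` _ = `]a - c, b - c]%classic); last first.
    by apply/seteqP; split => x /=; rewrite !in_itv/= ltrBlDr lerBrDr.
  rewrite !lebesgue_measure_itv/= !lte_fin ltrD2r ab -!EFinB.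
  by congr (_%:E); ring.
rewrite -[RHS](@eq_measure_integral _ _ _ setT leb (pushforward leb phi) f)//; last first.
  by move=> A mA _; exact/esym/shiftE.
by rewrite ge0_integral_pushforward.
Qed.

Lemma ge0_integral_opp (f : R -> \bar R) :
  measurable_fun [set: R] f -> (forall x, 0 <= f x)%E ->
  (\int[leb]_x f (- x)%R = \int[leb]_x f x)%E.
Proof.
move=> mf f0.
rewrite -[RHS](@eq_measure_integral _ _ _ setT leb
  (pushforward leb (-%R : _ -> measurableTypeR R)) f)//; last first.
  by move=> A mA _; exact: lebesgue_measureN.
by rewrite ge0_integral_pushforward.
Qed.

Lemma integral_expRN (c : R) :
  (\int[leb]_(t in `[c, +oo[) (expR (- t))%:E = (expR (- c))%:E)%E.
Proof.
have dF (x : R) : is_derive x (1:R) (fun t : R => - expR (- t)) (expR (- x)).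
  by apply: is_derive_eq; rewrite mulrN1 opprK.
rewrite (@ge0_continuous_FTC2y _ _ (fun t => - expR (- t)) _ 0)//=.
- by rewrite -EFinB sub0r opprK.
- apply: continuous_subspaceT => x; apply: continuous_comp; first exact: opp_continuous.
  exact: continuous_expR.
- rewrite -oppr0; apply: cvgN; exact: cvgr_expR.
- apply: cvg_at_right_filter; apply: cvgN; apply: continuous_comp; first exact: opp_continuous.
  exact: continuous_expR.
- by move=> x _; rewrite derive1E derive_val.
Qed.

Let measurable_expRN : measurable_fun [set: measurableTypeR R] (fun t : R => expR (- t) : measurableTypeR R).
Proof. by apply: measurableT_comp => //; exact: measurable_expR. Qed.

Let expRN_ge0 (t : R) : 0 <= expR (- t).
Proof. exact: expR_ge0. Qed.

Let expRN : {mfun measurableTypeR R >-> measurableTypeR R} :=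
  HB.pack (fun t : R => expR (- t)) (isMeasurableFun.Build _ _ _ _ _ measurable_expRN).

(** The image of exp (- t) dt under t |-> exp (- t). *)
Let expmeas (A : set (measurableTypeR R)) : \bar R :=
  (\int[leb]_(s in [set s | A (expR (- s))]) (expR (- s))%:E)%E.

Let measurable_preexp (A : set (measurableTypeR R)) : measurable A ->
  measurable [set s : R | A (expR (- s))].
Proof. by move=> mA; rewrite -[X in measurable X]setTI; exact: measurable_expRN. Qed.

Let expmeas0 : expmeas set0 = 0%E.
Proof. by rewrite /expmeas integral_set0. Qed.

Let expmeas_ge0 A : (0 <= expmeas A)%E.
Proof. by apply: integral_ge0 => s _; rewrite lee_fin expR_ge0. Qed.

Let expmeas_semi_sigma_additive : semi_sigma_additive expmeas.
Proof.
move=> /= F mF tF mUF; rewrite /expmeas.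
rewrite (_ : [set s | (\bigcup_n F n) (expR (- s))] =
  \bigcup_n [set s | F n (expR (- s))]); last by apply/seteqP; split.
apply: cvg_toP.
  apply: ereal_nondecreasing_is_cvgn => m n mn.
  apply: lee_sum_nneg_natr => // k _ _; apply: integral_ge0 => /= x Fkx.
  by rewrite lee_fin expR_ge0.
rewrite ge0_integral_bigcup//=.
- by move=> k; exact: measurable_preexp.
- by apply/measurable_funTS/measurableT_comp.
- move=> i j _ _ [x [/= Fi Fj]]; apply: (tF i j) => //.
  by exists (expR (- x)).
Qed.

HB.instance Definition _ := isMeasure.Build _ _ _ expmeas
  expmeas0 expmeas_ge0 expmeas_semi_sigma_additive.

Let nonpos : set (measurableTypeR R) := `]-oo, 0]%classic.
Let mnonpos : measurable nonpos. Proof. by rewrite /nonpos. Qed.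

(** Adding the part of Lebesgue measure on the nonpositive half-line yields a measure
    on the whole line, to which the uniqueness of Lebesgue measure applies. *)
Let expmeasE A : measurable A -> leb A = (expmeas A + leb (A `&` nonpos))%E.
Proof.
pose m : {measure set (measurableTypeR R) -> \bar R} :=
  measure_add expmeas (mrestr leb mnonpos).
suff H B : measurable B -> leb B = m B.
  by move=> mA; rewrite H//; exact: measure_addE.
apply: (@lebesgue_measure_unique R m) => // X /ocitvP[->|[[a b] /= ab ->]].
  by rewrite !measure0.
transitivity (expmeas `]a, b]%classic + leb (`]a, b]%classic `&` nonpos))%E;
  last by apply/esym; exact: measure_addE.
rewrite lebesgue_measure_itv/= lte_fin ab.
have ler_expN (c s : R) : 0 < c -> (expR (- s) <= c) = (- ln c <= s).
  by move=> c0; rewrite -{1}(@lnK _ c)// ler_expR lerNl.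
have ltr_expN (c s : R) : 0 < c -> (c < expR (- s)) = (s < - ln c).
  by move=> c0; rewrite -{1}(@lnK _ c)// ltr_expR ltrNr.
have [b0|b0] := leP b 0.
  rewrite /expmeas (_ : [set s | _] = set0); last first.
    apply/seteqP; split => s //=; rewrite in_itv/= => /andP[_].
    by rewrite leNgt (le_lt_trans b0) ?expR_gt0.
  rewrite integral_set0 add0e /nonpos (_ : _ `&` _ = `]a, b]%classic).
    by rewrite lebesgue_measure_itv/= lte_fin ab.
  apply/seteqP; split => s /=; rewrite !in_itv/=; first by case.
  by move=> /andP[-> sb]; rewrite sb (le_trans sb).
have [a0|a0] := leP a 0.
  rewrite /expmeas (_ : [set s | _] = `[- ln b, +oo[%classic); last first.
    apply/seteqP; split => s /=; rewrite !in_itv/= andbT ler_expN//.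
      by case/andP.
    by move=> ->; rewrite (le_lt_trans a0) ?expR_gt0.
  rewrite integral_expRN opprK lnK// /nonpos.
  rewrite (_ : _ `&` _ = `]a, 0]%classic).
    rewrite lebesgue_measure_itv/= lte_fin; case: ltP => a0'.
      by rewrite -!EFinB -EFinD; congr (_%:E); ring.
    have -> : a = 0 by apply/eqP; rewrite eq_le a0.
    by rewrite oppr0 !adde0.
  apply/seteqP; split => s /=; rewrite !in_itv/=.
    by move=> [/andP[-> _]].
  by move=> /andP[-> s0]; rewrite s0 (le_trans s0)// ltW.
rewrite (_ : `]a, b]%classic `&` nonpos = set0); last first.
  apply/seteqP; split => s //=; rewrite !in_itv/= => -[/andP[as_ _] s0].
  by move: s0; rewrite /nonpos/= in_itv/= leNgt (lt_trans a0 as_).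
rewrite measure0 adde0 /expmeas (_ : [set s | _] = `[- ln b, - ln a[%classic); last first.
  by apply/seteqP; split => s /=; rewrite !in_itv/= ler_expN// ltr_expN// andbC.
have lnab : - ln b < - ln a by rewrite ltrN2 ltr_ln.
have := integral_expRN (- ln b).
rewrite (_ : `[- ln b, +oo[%classic =
  `[- ln b, - ln a[%classic `|` `[- ln a, +oo[%classic); last first.
  by rewrite -itv_bndbnd_setU// bnd_simp ltW.
rewrite ge0_integral_setU//=; last 2 first.
- by apply/measurable_funTS/measurableT_comp.
- rewrite disj_set2E; apply/eqP/seteqP; split => s //=; rewrite !in_itv/=.
  by rewrite andbT => -[/andP[_]]; rewrite ltNge => /negP.
rewrite integral_expRN !opprK !lnK// => /eqP.
rewrite -EFinB eq_sym -sube_eq//; last first.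
  by rewrite fin_num_adde_defl.
by move=> /eqP <-.
Qed.

(** Change of variable x = exp (- t). Lebesgue measure and the image of
    exp (- t) dt agree on the half-open intervals contained in (0, oo). *)
Lemma ge0_integral_expRN (f : R -> \bar R) :
  measurable_fun [set: R] f -> (forall x, 0 <= f x)%E ->
  (\int[leb]_(x in `]0%R, +oo[) f x =
   \int[leb]_t ((expR (- t))%:E * f (expR (- t))))%E.
Proof.
move=> mf f0.
pose P : set (measurableTypeR R) := `]0, +oo[%classic.
have mP : measurable P by rewrite /P.
have legE A : measurable A -> A `<=` P -> leb A = expmeas A.
  move=> mA AP; rewrite expmeasE//.
  rewrite (_ : A `&` nonpos = set0) ?measure0 ?adde0//.
  apply/seteqP; split => x //= -[/AP]; rewrite /P /nonpos/= !in_itv/= andbT.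
  by rewrite ltNge => /negP.
rewrite (@eq_measure_integral _ _ _ P
  (pushforward (density_measure leb measurable_expRN expRN_ge0) expRN) leb f)//.
rewrite ge0_integral_pushforward//; last first.
- exact: measurable_funS mf.
rewrite (_ : _ @^-1` P = setT); last first.
  by apply/seteqP; split => t //= _; rewrite /P/= in_itv/= expR_gt0.
rewrite ge0_integral_density//.
- by apply: eq_integral => t _; rewrite muleC.
- exact: measurableT_comp.
- by move=> t /=; exact: f0.
Qed.

End IntegrationTools.

Section Convolution.
Context {R : realType}.
Local Notation leb := (@lebesgue_measure R).

(** Tonelli, and translation invariance in the inner variable. *)
Lemma ge0_integral_conv (a g u : R -> \bar R) :
  measurable_fun [set: R] a -> (forall x, 0 <= a x)%E ->
  measurable_fun [set: R] g -> (forall x, 0 <= g x)%E ->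
  measurable_fun [set: R] u -> (forall x, 0 <= u x)%E ->
  (\int[leb]_t (a t * \int[leb]_s (g (t - s)%R * u s)) =
   \int[leb]_s (u s * \int[leb]_t (a (t + s)%R * g t)))%E.
Proof.
move=> ma a0 mg g0 mu u0.
pose F (z : R * R) := (a z.1 * (g (z.1 - z.2)%R * u z.2))%E.
have mF : measurable_fun [set: measurableTypeR R * measurableTypeR R] F.
  apply: emeasurable_funM; first exact: measurableT_comp.
  apply: emeasurable_funM; last exact: measurableT_comp.
  apply: (measurableT_comp mg); exact: measurable_funB.
transitivity (\int[leb]_t \int[leb]_s F (t, s))%E.
  apply: eq_integral => t _; rewrite -ge0_integralZl//.
  - apply: emeasurable_funM => //; apply: (measurableT_comp mg).
    exact: measurable_funB.
  - by move=> s _; rewrite mule_ge0.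
rewrite (@fubini_tonelli _ _ (measurableTypeR R) (measurableTypeR R) R leb leb F mF); last first.
  by move=> z; rewrite !mule_ge0.
apply: eq_integral => s _; rewrite -ge0_integralZl//.
- rewrite -(ge0_integral_shift s); last 2 first.
  + exact: (measurableT_comp mF (pair2_measurable s)).
  + by move=> x; rewrite !mule_ge0.
  by apply: eq_integral => t _; rewrite /F/= addrK [RHS]muleC muleA.
- apply: emeasurable_funM => //; apply: (measurableT_comp ma).
  exact: measurable_funD.
- by move=> t _; rewrite mule_ge0.
Qed.

End Convolution.

(** * A Volterra equation and the Laplace transform of its solution *)

Section ConvolutionOperator.
Context {R : realType}.
Local Notation leb := (@lebesgue_measure R).
Local Open Scope ereal_scope.
Implicit Types g u f a : R -> \bar R.

Definition conv g u (t : R) : \bar R := \int[leb]_s (g (t - s)%R * u s).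

Lemma conv_ge0 g u t : (forall x, 0 <= g x) -> (forall x, 0 <= u x) -> 0 <= conv g u t.
Proof. by move=> g0 u0; apply: integral_ge0 => s _; rewrite mule_ge0. Qed.

Lemma measurable_conv g u :
  measurable_fun [set: R] g -> (forall x, 0 <= g x) ->
  measurable_fun [set: R] u -> (forall x, 0 <= u x) ->
  measurable_fun [set: R] (conv g u).
Proof.
move=> mg g0 mu u0.
pose F (z : R * R) := g (z.1 - z.2)%R * u z.2.
have mF : measurable_fun [set: measurableTypeR R * measurableTypeR R] F.
  apply: emeasurable_funM; last exact: measurableT_comp.
  apply: (measurableT_comp mg); exact: measurable_funB.
apply: (@measurable_fun_fubini_tonelli_F _ _ (measurableTypeR R)
  (measurableTypeR R) R leb F mF) => z.
by rewrite mule_ge0.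
Qed.

Lemma integrandconv_measurable g u t :
  measurable_fun [set: R] g -> measurable_fun [set: R] u ->
  measurable_fun [set: R] (fun s => g (t - s)%R * u s).
Proof.
move=> mg mu; apply: emeasurable_funM => //; apply: (measurableT_comp mg).
exact: measurable_funB.
Qed.

Lemma le_conv g u1 u2 t :
  measurable_fun [set: R] g -> (forall x, 0 <= g x) ->
  measurable_fun [set: R] u1 -> (forall x, 0 <= u1 x) ->
  measurable_fun [set: R] u2 -> (forall x, u1 x <= u2 x) ->
  conv g u1 t <= conv g u2 t.
Proof.
move=> mg g0 mu1 u10 mu2 u12; apply: ge0_le_integral => //.
- by move=> x _; rewrite mule_ge0.
- exact: integrandconv_measurable.
- exact: integrandconv_measurable.
- by move=> x _; rewrite lee_wpmul2l.
Qed.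

Lemma cvg_conv g (u : nat -> R -> \bar R) t :
  measurable_fun [set: R] g -> (forall x, 0 <= g x) -> (forall x, g x < +oo) ->
  (forall n, measurable_fun [set: R] (u n)) -> (forall n x, 0 <= u n x) ->
  (forall x, {homo u^~ x : n m / (n <= m)%N >-> n <= m}) ->
  conv g (u n) t @[n --> \oo] --> conv g (fun x => limn (u^~ x)) t.
Proof.
move=> mg g0 gfin mu u0 ndu.
rewrite /conv.
have -> : \int[leb]_s (g (t - s)%R * limn (u^~ s)) =
    \int[leb]_s (limn (fun n => g (t - s)%R * u n s)).
  apply: eq_integral => s _; apply/esym/cvg_lim => //.
  have gfi : g (t - s)%R \is a fin_num by rewrite ge0_fin_numE.
  apply: cvgeZl => //; apply: ereal_nondecreasing_is_cvgn => n m nm.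
  exact: ndu.
apply: cvg_monotone_convergence => //.
- by move=> n; exact: integrandconv_measurable.
- by move=> n s _; rewrite mule_ge0.
- by move=> s _ n m nm; rewrite lee_wpmul2l// ndu.
Qed.

Definition heaviside (s : R) : \bar R := (\1_(`[0%R, +oo[) s)%:E.

Lemma measurable_heaviside : measurable_fun [set: R] heaviside.
Proof. exact/measurable_EFinP/measurable_indic. Qed.

Lemma heaviside_ge0 s : 0 <= heaviside s.
Proof. by rewrite lee_fin. Qed.

Lemma heavisideE s : heaviside s = if (0 <= s)%R then 1 else 0.
Proof.
rewrite /heaviside indicE; case: ifPn => s0.
  by rewrite mem_set//= in_itv/= s0.
by rewrite memNset//= in_itv/= andbT; exact/negP.
Qed.

Lemma conv_heaviside u t : conv heaviside u t = \int[leb]_(s in `]-oo, t]) u s.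
Proof.
rewrite [RHS]integral_mkcond; apply: eq_integral => s _.
rewrite heavisideE patchE subr_ge0 mem_setE in_itv/=.
by case: ifP; rewrite (mul1e, mul0e).
Qed.

Lemma ge0_integral_conv_heaviside a u :
  measurable_fun [set: R] a -> (forall x, 0 <= a x) ->
  measurable_fun [set: R] u -> (forall x, 0 <= u x) ->
  \int[leb]_t (a t * conv heaviside u t) =
  \int[leb]_s (u s * \int[leb]_(t in `[s, +oo[) a t).
Proof.
move=> ma a0 mu u0.
rewrite (ge0_integral_conv ma a0 measurable_heaviside heaviside_ge0 mu u0).
apply: eq_integral => s _; congr (_ * _).
rewrite [RHS]integral_mkcond -[RHS](@ge0_integral_shift _ s) /=.
- apply: eq_integral => t _; rewrite patchE heavisideE mem_setE in_itv/= andbT.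
  by rewrite lerDr; case: ifP; rewrite (mule1, mule0).
- by apply/(measurable_restrictT _ _).1 => //; exact: measurable_funTS.
- by move=> x; rewrite patchE; case: ifP.
Qed.

Lemma ge0_cvg_integral_bndy (a : R) u : measurable_fun [set: R] u -> (forall x, 0 <= u x) ->
  \int[leb]_(t in `[a, (a + n%:R)%R]) u t @[n --> \oo] --> \int[leb]_(t in `[a, +oo[) u t.
Proof.
move=> mu u0; rewrite itv_bndy_bigcup_BRight.
apply: ge0_nondecreasing_set_cvg_integral => //.
- move=> n m nm; rewrite subsetEset; apply: subset_itvl.
  by rewrite bnd_simp lerD2l ler_nat.
- by move=> n; exact: measurable_funTS.
Qed.

Lemma ge0_cvg_integral_0bnd u : measurable_fun [set: R] u -> (forall x, 0 <= u x) ->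
  \int[leb]_(t in `[(n.+1%:R^-1)%R, +oo[) u t @[n --> \oo] --> \int[leb]_(t in `]0%R, +oo[) u t.
Proof.
move=> mu u0.
have -> : `]0%R, +oo[%classic = \bigcup_n `[(n.+1%:R^-1)%R, +oo[%classic :> set R.
  apply/seteqP; split => [x|x [n _]] /=; rewrite !in_itv/= !andbT; last first.
    by apply: lt_le_trans; rewrite invr_gt0.
  move=> x0; exists (Num.truncn (x^-1)%R) => //=; rewrite in_itv/= andbT.
  rewrite invf_ple ?posrE//; exact/ltW/truncnS_gt.
apply: ge0_nondecreasing_set_cvg_integral => //.
- move=> n m nm; rewrite subsetEset; apply: subset_itvr.
  by rewrite bnd_simp lef_pV2 ?posrE// ler_nat ltnS.
- by move=> n; exact: measurable_funTS.
Qed.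

End ConvolutionOperator.

Section ConvolutionIdentities.
Context {R : realType}.
Local Notation leb := (@lebesgue_measure R).

(** Integrates against k an identity between the tails of [a0] and [a1]. As
    G = 1 + int k, Tonelli writes the integral of a0 G as the integral of a0 plus
    that of k against the tails of a0; the limit of the identity at 0 accounts for
    the term 1 of G. *)
Lemma conv_heaviside_balance (G k : R -> \bar R) (al be c0 : R) (a0 a1 c c' : R -> \bar R) :
  measurable_fun [set: R] k -> (forall t, 0 <= k t)%E -> (forall t : R, t <= 0 -> k t = 0%E) ->
  (forall t, G t = 1 + conv heaviside k t)%E ->
  0 <= al -> 0 <= be ->
  measurable_fun [set: R] a0 -> (forall t, 0 <= a0 t)%E -> (forall t : R, t <= 0 -> a0 t = 0%E) ->
  measurable_fun [set: R] a1 -> (forall t, 0 <= a1 t)%E -> (forall t : R, t <= 0 -> a1 t = 0%E) ->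
  measurable_fun [set: R] c -> (forall t, 0 <= c t)%E ->
  measurable_fun [set: R] c' -> (forall t, 0 <= c' t)%E ->
  (forall s : R, (0 < s)%R -> al%:E * \int[leb]_(t in `[s, +oo[) a0 t + c' s =
    be%:E * \int[leb]_(t in `[s, +oo[) a1 t + c s)%E ->
  c n.+1%:R^-1 @[n --> \oo] --> 0%E -> c' n.+1%:R^-1 @[n --> \oo] --> c0%:E ->
  (al%:E * \int[leb]_t (a0 t * G t) + c0%:E + \int[leb]_t (k t * c' t) =
   be%:E * \int[leb]_t (a1 t * G t) + \int[leb]_t (k t * c t))%E.
Proof.
move=> mk kp k_neg GE al0 be0 ma0 a00 a0N ma1 a10 a1N mc cp mc' cp' E cl cl'.
have E0 : (al%:E * \int[leb]_t a0 t + c0%:E = be%:E * \int[leb]_t a1 t)%E.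
  have full (a : R -> \bar R) : (forall t : R, t <= 0 -> a t = 0%E) ->
      (\int[leb]_t a t = \int[leb]_(t in `]0%R, +oo[) a t)%E.
    move=> aN; rewrite [RHS]integral_mkcond; apply: eq_integral => t _.
    by rewrite patchE mem_setE in_itv/= andbT; case: ltP => // t0; rewrite aN.
  rewrite !full//.
  have L1 := cvgeZl (isT : al%:E \is a fin_num) (ge0_cvg_integral_0bnd ma0 a00).
  have L2 := cvgeZl (isT : be%:E \is a fin_num) (ge0_cvg_integral_0bnd ma1 a10).
  have L3 := cvgeD (fin_num_adde_defl _ (isT : c0%:E \is a fin_num)) L1 cl'.
  have L4 := cvgeD (fin_num_adde_defl _ (isT : 0%:E \is a fin_num)) L2 cl.
  rewrite adde0 in L4.
  apply: (cvg_unique _ (L3 _)) => //.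
  apply: cvg_trans (L4 _); apply: near_eq_cvg; near=> n.
  by rewrite -E.
have tail (a : R -> \bar R) : measurable_fun [set: R] a -> (forall t, 0 <= a t)%E ->
    (\int[leb]_t (a t * G t) =
     \int[leb]_t a t + \int[leb]_s (k s * \int[leb]_(t in `[s, +oo[) a t))%E.
  move=> ma ap; rewrite -ge0_integral_conv_heaviside//.
  have mc1 : measurable_fun [set: R] (fun t => a t * conv heaviside k t)%E.
    apply: emeasurable_funM => //; apply: measurable_conv => //.
      exact: measurable_heaviside.
    exact: heaviside_ge0.
  rewrite -ge0_integralD//; last first.
    by move=> t _; rewrite mule_ge0//; apply: conv_ge0 => //; exact: heaviside_ge0.
  apply: eq_integral => t _; rewrite GE ge0_muleDr ?mule1//.
  by apply: conv_ge0 => //; exact: heaviside_ge0.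
have mtail (a : R -> \bar R) : measurable_fun [set: R] a -> (forall t, 0 <= a t)%E ->
    measurable_fun [set: R] (fun s => \int[leb]_(t in `[s, +oo[) a t)%E.
  move=> ma ap.
  have -> : (fun s => \int[leb]_(t in `[s, +oo[) a t)%E =
      (fun s => conv heaviside (a \o -%R) (- s))%E.
    apply/funext => s; rewrite /conv -ge0_integral_opp /=; last 2 first.
    - apply: emeasurable_funM; last first.
        by apply: (measurableT_comp ma).
      by apply: (measurableT_comp measurable_heaviside); exact: measurable_funB.
    - by move=> t; rewrite mule_ge0// heaviside_ge0.
    rewrite [LHS]integral_mkcond; apply: eq_integral => t _.
    rewrite patchE heavisideE mem_setE in_itv/= andbT !opprK addrC subr_ge0.
    by case: ifP; rewrite (mul1e, mul0e).
  apply: (@measurableT_comp _ _ _ _ _ _ (conv heaviside (a \o -%R))) => //.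
  apply: measurable_conv => //.
  - exact: measurable_heaviside.
  - exact: heaviside_ge0.
  - exact: (measurableT_comp ma).
  - by move=> x; exact: ap.
have tail_ge0 (a : R -> \bar R) : (forall t, 0 <= a t)%E ->
    forall s, (0 <= \int[leb]_(t in `[s, +oo[) a t)%E.
  by move=> ap s; exact: integral_ge0.
have ktail_ge0 (a : R -> \bar R) : (forall t, 0 <= a t)%E ->
    (0 <= \int[leb]_s (k s * \int[leb]_(t in `[s, +oo[) a t))%E.
  by move=> ap; apply: integral_ge0 => s _; rewrite mule_ge0 ?tail_ge0.
have kE (r : R) (a : R -> \bar R) : 0 <= r -> measurable_fun [set: R] a ->
    (forall t, 0 <= a t)%E ->
    (r%:E * \int[leb]_s (k s * \int[leb]_(t in `[s, +oo[) a t) =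
     \int[leb]_s (k s * (r%:E * \int[leb]_(t in `[s, +oo[) a t)))%E.
  move=> r0 ma ap; rewrite -ge0_integralZl//.
  - by apply: eq_integral => s _; rewrite muleCA.
  - by apply: emeasurable_funM => //; exact: mtail.
  - by move=> s _; rewrite mule_ge0 ?tail_ge0.
rewrite !tail//.
have P0 : (0 <= \int[leb]_t a0 t)%E by exact: integral_ge0.
have P1 : (0 <= \int[leb]_t a1 t)%E by exact: integral_ge0.
rewrite (ge0_muleDr _ P0 (ktail_ge0 _ a00)) (ge0_muleDr _ P1 (ktail_ge0 _ a10)).
rewrite !kE//.
have EK : (\int[leb]_s (k s * (al%:E * \int[leb]_(t in `[s, +oo[) a0 t)) + \int[leb]_t (k t * c' t) =
    \int[leb]_s (k s * (be%:E * \int[leb]_(t in `[s, +oo[) a1 t)) + \int[leb]_t (k t * c t))%E.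
  have mM r (a : R -> \bar R) : measurable_fun [set: R] a -> (forall t, 0 <= a t)%E ->
      measurable_fun [set: R] (fun s => k s * (r%:E * \int[leb]_(t in `[s, +oo[) a t))%E.
    by move=> ma ap; apply: emeasurable_funM => //; apply: emeasurable_funM => //; exact: mtail.
  rewrite -ge0_integralD//; last 4 first.
  - by move=> s _; rewrite !mule_ge0 ?tail_ge0 ?lee_fin//.
  - exact: mM.
  - by move=> s _; rewrite mule_ge0.
  - exact: emeasurable_funM.
  rewrite -ge0_integralD//; last 4 first.
  - by move=> s _; rewrite !mule_ge0 ?tail_ge0 ?lee_fin//.
  - exact: mM.
  - by move=> s _; rewrite mule_ge0.
  - exact: emeasurable_funM.
  apply: eq_integral => s _; have [s0|s0] := leP s 0.
    by rewrite k_neg// !mul0e.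
  by rewrite -!ge0_muleDr ?mule_ge0 ?tail_ge0 ?lee_fin// E.
have shuffle (x y z w : \bar R) : (x + y + z + w = x + z + (y + w))%E.
  by rewrite (addeAC x y z) -(addeA (x + z)%E y w).
by rewrite shuffle E0 EK; exact: addeA.
Unshelve. all: by end_near. Qed.

Lemma measurable_expRM (p : R) : measurable_fun [set: R] (fun t : R => expR (- (p * t))).
Proof.
apply: measurableT_comp; first exact: measurable_expR.
by apply: measurableT_comp => //; exact: measurable_funM.
Qed.

Lemma laplace_conv (p : R) (g u : R -> R) :
  measurable_fun [set: R] g -> (forall x, 0 <= g x) ->
  measurable_fun [set: R] u -> (forall x, 0 <= u x) ->
  (\int[leb]_t ((expR (- (p * t)))%:E * conv (EFin \o g) (EFin \o u) t) =
   \int[leb]_t (expR (- (p * t)) * u t)%:E * \int[leb]_t (expR (- (p * t)) * g t)%:E)%E.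
Proof.
move=> mg g0 mu u0.
have mexp := measurable_expRM p.
have meg : measurable_fun [set: R] (EFin \o (fun t => expR (- (p * t)) * g t)).
  by apply/measurable_EFinP; exact: measurable_funM.
have meu : measurable_fun [set: R] (EFin \o (fun t => expR (- (p * t)) * u t)).
  by apply/measurable_EFinP; exact: measurable_funM.
have eg0 t : (0 <= (expR (- (p * t)) * g t)%:E)%E by rewrite lee_fin mulr_ge0// expR_ge0.
have eu0 t : (0 <= (expR (- (p * t)) * u t)%:E)%E by rewrite lee_fin mulr_ge0// expR_ge0.
transitivity (\int[leb]_s ((u s)%:E * \int[leb]_t ((expR (- (p * (t + s))))%:E * (g t)%:E)))%E.
  apply: ge0_integral_conv => //; try exact/measurable_EFinP.
transitivity (\int[leb]_s ((expR (- (p * s)) * u s)%:E * \int[leb]_t (expR (- (p * t)) * g t)%:E))%E;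
  last first.
  by apply: ge0_integralZr => //; exact: integral_ge0.
apply: eq_integral => s _; rewrite EFinM [in RHS]muleAC [in RHS]muleC; congr (_ * _)%E.
transitivity (\int[leb]_t ((expR (- (p * s)))%:E * (expR (- (p * t)) * g t)%:E))%E; last first.
  by apply: ge0_integralZl => //; rewrite lee_fin expR_ge0.
apply: eq_integral => t _; rewrite -!EFinM mulrA -expRD.
by congr (expR _ * _)%:E; ring.
Qed.

(** Since g lives on (0, oo), only the mass of u before T contributes to the mass of
    the convolution before T. *)
Lemma integral_conv_le (T : R) (g u : R -> \bar R) :
  measurable_fun [set: R] g -> (forall x, 0 <= g x)%E -> (forall x : R, x <= 0 -> g x = 0%E) ->
  measurable_fun [set: R] u -> (forall x, 0 <= u x)%E ->
  (\int[leb]_(t in `]-oo, T]) conv g u t <= \int[leb]_t g t * \int[leb]_(t in `]-oo, T]) u t)%E.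
Proof.
move=> mg g0 gN mu u0.
pose I : R -> \bar R := (cst 1%E) \_ `]-oo, T].
have IE t : I t = if t <= T then 1%E else 0%E by rewrite /I patchE mem_setE in_itv.
have I0 t : (0 <= I t)%E by rewrite IE; case: ifP.
have mI : measurable_fun [set: R] I by apply/(measurable_restrictT _ _).1.
have -> : (\int[leb]_(t in `]-oo, T]) conv g u t = \int[leb]_t (I t * conv g u t))%E.
  rewrite [LHS]integral_mkcond; apply: eq_integral => t _.
  by rewrite patchE IE mem_setE in_itv/=; case: ifP; rewrite (mul1e, mul0e).
have -> : (\int[leb]_(t in `]-oo, T]) u t = \int[leb]_t (I t * u t))%E.
  rewrite [LHS]integral_mkcond; apply: eq_integral => t _.
  by rewrite patchE IE mem_setE in_itv/=; case: ifP; rewrite (mul1e, mul0e).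
rewrite (ge0_integral_conv mI I0 mg g0 mu u0) muleC.
have mIu : measurable_fun [set: R] (fun t => I t * u t)%E by exact: emeasurable_funM.
have Iu0 t : (0 <= I t * u t)%E by rewrite mule_ge0.
have ig0 : (0 <= \int[leb]_t g t)%E by exact: integral_ge0.
rewrite (_ : _ * _ = \int[leb]_s ((I s * u s) * \int[leb]_t g t))%E; last first.
  by apply/esym; exact: ge0_integralZr.
have mIg s : measurable_fun [set: R] (fun t => I (t + s)%R * g t)%E.
  by apply: emeasurable_funM => //; apply: (measurableT_comp mI); exact: measurable_funD.
have Igi0 s : (0 <= \int[leb]_t (I (t + s)%R * g t))%E.
  by apply: integral_ge0 => t _; rewrite mule_ge0.
apply: ge0_le_integral => //.
- by move=> s _; rewrite mule_ge0.
- apply: emeasurable_funM => //.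
  pose F (z : R * R) := (I (z.2 + z.1)%R * g z.2)%E.
  have mF : measurable_fun [set: measurableTypeR R * measurableTypeR R] F.
    apply: emeasurable_funM; last exact: measurableT_comp.
    by apply: (measurableT_comp mI); exact: measurable_funD.
  apply: (@measurable_fun_fubini_tonelli_F _ _ (measurableTypeR R)
    (measurableTypeR R) R leb F mF) => z.
  by rewrite mule_ge0.
- by apply: emeasurable_funM.
- move=> s _; rewrite IE; case: ifPn => sT.
    rewrite mul1e lee_wpmul2l//; apply: ge0_le_integral => //.
    + by move=> t _; rewrite mule_ge0.
    + exact: mIg.
    + by move=> t _; rewrite IE; case: ifP; rewrite (mul1e, mul0e).
  rewrite !mul0e (_ : (\int[leb]_t _)%E = 0%E) ?mule0//.
  rewrite integral0_eq// => t _; rewrite IE.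
  have [t0|t0] := leP t 0; first by rewrite gN// mule0.
  rewrite ifF ?mul0e//; apply/negbTE; rewrite -ltNge.
  by apply: (lt_trans (_ : T < s)); rewrite ?ltNge// -ltNge ltrDr.
Qed.

End ConvolutionIdentities.

Section Volterra.
Context {R : realType}.
Local Notation leb := (@lebesgue_measure R).
Variables (l1 mu C : R) (gam : R -> R).
Hypothesis mu_gt0 : 0 < mu.
Hypothesis mu_l1 : mu < l1.
Hypothesis mgam : measurable_fun [set: R] gam.
Hypothesis gam_ge0 : forall s, 0 <= gam s.
Hypothesis gam_neg : forall s : R, s <= 0 -> gam s = 0.
Hypothesis gam_le : forall s, gam s <= C * expR (- s).

Let dl := l1 - mu.
Let dl_gt0 : 0 < dl. Proof. by rewrite subr_gt0. Qed.

Let C_ge0 : 0 <= C.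
Proof. by have := le_trans (gam_ge0 0) (gam_le 0); rewrite oppr0 expR0 mulr1. Qed.

Let pos (t : R) : R := \1_(`]0, +oo[) t.

Let posE (t : R) : 0 < t -> pos t = 1.
Proof. by move=> t0; rewrite /pos indicE mem_set//= in_itv/= t0. Qed.

Let posN (t : R) : t <= 0 -> pos t = 0.
Proof.
by move=> t0; rewrite /pos indicE memNset//= in_itv/= andbT; apply/negP; rewrite -leNgt.
Qed.

(** The Beta(mu, l1 - mu) law, up to normalization, in the variable t = - ln x: the
    solution of the balance equation for gam = 0. *)
Definition volt_v (t : R) : R := pos t * (expR (- (mu * t)) * (1 - expR (- t)) `^ (dl - 1)).
(** The factor of the variation of constants: its product with the boundary term [B p]
    of the balance equation of [v] is exp (- p t). *)
Definition volt_W (t : R) : R := pos t * (expR (mu * t) * (1 - expR (- t)) `^ (- dl)).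
Let v := volt_v.
Let W := volt_W.

(** The primitive that links the transforms of [v] at p and p + 1. *)
Let B (p t : R) := expR (- ((p + mu) * t)) * (1 - expR (- t)) `^ dl.

Let omexp_gt0 (t : R) : 0 < t -> 0 < 1 - expR (- t).
Proof. by move=> t0; rewrite subr_gt0 expR_lt1 oppr_lt0. Qed.

Let v_ge0 (t : R) : 0 <= v t.
Proof. by rewrite /v /volt_v !mulr_ge0// ?expR_ge0 ?powR_ge0. Qed.

Let v_gt0 (t : R) : 0 < t -> 0 < v t.
Proof. by move=> t0; rewrite /v /volt_v posE// mul1r mulr_gt0 ?expR_gt0 ?powR_gt0 ?omexp_gt0. Qed.

Let W_ge0 (t : R) : 0 <= W t.
Proof. by rewrite /W /volt_W !mulr_ge0// ?expR_ge0 ?powR_ge0. Qed.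

Let v_neg (t : R) : t <= 0 -> v t = 0.
Proof. by move=> t0; rewrite /v /volt_v posN// mul0r. Qed.

Let W_neg (t : R) : t <= 0 -> W t = 0.
Proof. by move=> t0; rewrite /W /volt_W posN// mul0r. Qed.

Let measurable_omexp : measurable_fun [set: R] (fun t : R => 1 - expR (- t)).
Proof.
apply: measurable_funB => //; apply: measurableT_comp => //; exact: measurable_expR.
Qed.

Let measurable_v : measurable_fun [set: R] v.
Proof.
apply: measurable_funM; first exact: measurable_indic.
apply: measurable_funM.
  apply: measurableT_comp; first exact: measurable_expR.
  by apply: measurableT_comp => //; exact: measurable_funM.
exact: (measurableT_comp (@measurable_powR R _)).
Qed.

Let measurable_W : measurable_fun [set: R] W.
Proof.
apply: measurable_funM; first exact: measurable_indic.
apply: measurable_funM.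
  by apply: measurableT_comp; [exact: measurable_expR|exact: measurable_funM].
exact: (measurableT_comp (@measurable_powR R _)).
Qed.

Let BW (p t : R) : 0 < t -> W t * B p t = expR (- (p * t)).
Proof.
move=> t0; rewrite /W /volt_W /B posE// mul1r mulrACA -expRD powRN.
rewrite mulVf ?mulr1; last by rewrite gt_eqF// powR_gt0// omexp_gt0.
by congr expR; ring.
Qed.

Let B_ge0 (p t : R) : 0 <= B p t.
Proof. by rewrite /B mulr_ge0 ?expR_ge0 ?powR_ge0. Qed.

Let is_derive_B (p t : R) : 0 < t ->
  is_derive t (1:R) (B p)
   ((p + l1) * (expR (- ((p + 1) * t)) * v t) - (p + mu) * (expR (- (p * t)) * v t)).
Proof.
move=> t0.
have E0 := omexp_gt0 t0.
have d1 : is_derive t (1:R) (fun t => 1 - expR (- t)) (expR (- t)).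
  have dE : is_derive t (1:R) (fun t : R => expR (- t)) (- expR (- t)).
    by apply: is_derive_eq; rewrite mulrN1.
  have := is_deriveB (is_derive_cst (1:R) t (1:R)) dE.
  by rewrite sub0r opprK.
have d2 : is_derive (1 - expR (- t)) (1:R) (fun x => x `^ dl) (dl * (1 - expR (- t)) `^ (dl - 1)).
  exact: is_derive1_powR.
have d3 := @is_derive1_comp R (fun x => x `^ dl) (fun t => 1 - expR (- t)) t _ _ d2 d1.
have d4 : is_derive t (1:R) (fun t => expR (- ((p + mu) * t))) (- (p + mu) * expR (- ((p + mu) * t))).
  by apply: is_derive_eq; rewrite scaler1 mulrN mulrC mulNr.
have d5 := is_deriveM d4 d3.
refine (eq_ind _ (fun z => is_derive t (1:R) (B p) z) d5 _ _).
rewrite /v /volt_v posE// mul1r.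
rewrite /GRing.scale/= -(@mulr_powRB1 _ (1 - expR (- t)) dl) ?ltW//.
have -> : expR (- ((p + mu) * t)) = expR (- (p * t)) * expR (- (mu * t)).
  by rewrite -expRD; congr expR; ring.
have -> : expR (- ((p + 1) * t)) = expR (- (p * t)) * expR (- t).
  by rewrite -expRD; congr expR; ring.
rewrite /dl; ring.
Qed.

Let continuous_expRM (c : R) : continuous (fun t : R => expR (c * t)).
Proof.
move=> t; apply: continuous_comp; last exact: continuous_expR.
exact: mulrl_continuous.
Qed.

Let continuous_v (t : R) : 0 < t -> {for t, continuous v}.
Proof.
move=> t0.
have cf : {for t, continuous (fun t => expR (- mu * t) * (1 - expR (- t)) `^ (dl - 1))}.
  apply: continuousM; first exact: continuous_expRM.
  have dE : is_derive t (1:R) (fun t : R => expR (- t)) (- expR (- t)).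
    by apply: is_derive_eq; rewrite mulrN1.
  have d1 := is_deriveB (is_derive_cst (1:R) t (1:R)) dE.
  have d2 := is_derive1_powR (dl - 1) (omexp_gt0 t0).
  have d3 := @is_derive1_comp R (fun x => x `^ (dl - 1)) (fun t => 1 - expR (- t)) t _ _ d2 d1.
  by apply/differentiable_continuous/derivable1_diffP; case: d3.
suff : v x @[x --> t] --> v t by [].
rewrite {2}/v /volt_v posE// mul1r -mulNr.
apply: cvg_trans cf; apply: near_eq_cvg.
near=> s; rewrite /v /volt_v posE ?mul1r ?mulNr//.
near: s; exact: lt_nbhsr.
Unshelve. all: by end_near. Qed.

Let vp (p t : R) := expR (- (p * t)) * v t.

Let vp_ge0 (p t : R) : 0 <= vp p t.
Proof. by rewrite /vp mulr_ge0// expR_ge0. Qed.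

Let measurable_vp (p : R) : measurable_fun [set: R] (vp p).
Proof.
apply: measurable_funM => //; apply: measurableT_comp; first exact: measurable_expR.
by apply: measurableT_comp => //; exact: measurable_funM.
Qed.

Let continuous_vp (p t : R) : 0 < t -> {for t, continuous (vp p)}.
Proof.
move=> t0; apply: continuousM; last exact: continuous_v.
have := @continuous_expRM (- p) t.
rewrite (_ : (fun t : R => expR (- p * t)) = (fun x => expR (- (p * x))))//.
by apply/funext => x; rewrite mulNr.
Qed.

Let vp_integrable (p a b : R) : 0 < a -> leb.-integrable `[a, b] (EFin \o vp p).
Proof.
move=> a0; apply: continuous_compact_integrable; first exact: segment_compact.
apply/continuous_in_subspaceT => x /set_mem/=; rewrite in_itv/= => /andP[ax _].
by apply: continuous_vp; exact: lt_le_trans ax.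
Qed.

Let volt_FTC (p a b : R) : 0 < a -> a < b ->
  ((p + mu)%:E * \int[leb]_(t in `[a, b]) (vp p t)%:E + (B p b)%:E =
   (p + l1)%:E * \int[leb]_(t in `[a, b]) (vp (p + 1) t)%:E + (B p a)%:E)%E.
Proof.
move=> a0 ab.
have I1 := vp_integrable (p + 1) b a0.
have I2 := vp_integrable p b a0.
have mI : measurable (`[a, b] : set (measurableTypeR R)) by [].
have [i1 E1] : exists r, (\int[leb]_(x in `[a, b]) (vp (p + 1) x)%:E = r%:E)%E.
  by exists (fine (\int[leb]_(x in `[a, b]) (vp (p + 1) x)%:E)%E); rewrite fineK// (integrable_fin_num mI I1).
have [i2 E2] : exists r, (\int[leb]_(x in `[a, b]) (vp p x)%:E = r%:E)%E.
  by exists (fine (\int[leb]_(x in `[a, b]) (vp p x)%:E)%E); rewrite fineK// (integrable_fin_num mI I2).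
have contI x : 0 < x -> {for x, continuous (fun t => (p + l1) * vp (p + 1) t - (p + mu) * vp p t)}.
  move=> x0; apply: continuousB.
    by apply: continuousM; [exact: cst_continuous|exact: continuous_vp].
  by apply: continuousM; [exact: cst_continuous|exact: continuous_vp].
have := @continuous_FTC2 R (fun t => (p + l1) * vp (p + 1) t - (p + mu) * vp p t) (B p) a b ab.
have pos_itv x : x \in `[a, b] -> 0 < x.
  by rewrite in_itv/= => /andP[/(lt_le_trans a0)].
have der x : 0 < x -> derivable (B p) x 1.
  by move=> x0; case: (is_derive_B p x0).
have contB x : 0 < x -> {for x, continuous (B p)}.
  by move=> x0; apply/differentiable_continuous/derivable1_diffP; exact: der.
have -> : (\int[leb]_(x in `[a, b]) ((p + l1) * vp (p + 1) x - (p + mu) * vp p x)%:E =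
   (p + l1)%:E * \int[leb]_(x in `[a, b]) (vp (p + 1) x)%:E -
   (p + mu)%:E * \int[leb]_(x in `[a, b]) (vp p x)%:E)%E.
  have J1 : leb.-integrable `[a, b] (EFin \o (fun x => (p + l1) * vp (p + 1) x)).
    exact: (integrableZl mI (p + l1) I1).
  have J2 : leb.-integrable `[a, b] (EFin \o (fun x => (p + mu) * vp p x)).
    exact: (integrableZl mI (p + mu) I2).
  rewrite -(integralZl mI I1 (p + l1)) -(integralZl mI I2 (p + mu)).
  exact: (integralB_EFin mI J1 J2).
rewrite E1 E2 -!EFinM -!EFinB -!EFinD => H.
suff H' : (p + l1) * i1 - (p + mu) * i2 = B p b - B p a.
  have -> : B p b = (p + l1) * i1 - (p + mu) * i2 + B p a by rewrite H' subrK.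
  by rewrite addrA addrCA subrr addr0.
apply/EFin_inj; apply: H.
- apply/continuous_in_subspaceT => x /set_mem/= /pos_itv x0.
  exact: contI.
- split.
  + by move=> x; rewrite in_itv/= => /andP[/(lt_trans a0) x0 _]; exact: der.
  + by apply: cvg_at_right_filter; exact: contB.
  + by apply: cvg_at_left_filter; apply: contB; exact: lt_trans ab.
- move=> x; rewrite in_itv/= => /andP[/(lt_trans a0) x0 _].
  by rewrite derive1E; have [_ ->] := is_derive_B p x0; rewrite /vp.
Qed.

Let B_le (p t : R) : 0 < t -> B p t <= expR (- ((p + mu) * t)).
Proof.
move=> t0; rewrite /B -[leRHS]mulr1 ler_wpM2l ?expR_ge0//.
rewrite -[leRHS](congr1 (fun f => f dl) (@powR1 R)) ge0_ler_powR ?nnegrE ?ler01//.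
- exact: ltW.
- exact/ltW/omexp_gt0.
Qed.

Let cvg_B_infty (p tau : R) : 0 < tau -> 0 <= p -> B p (tau + n%:R) @[n --> \oo] --> 0.
Proof.
move=> t0 p0; apply: (@squeeze_cvgr _ _ _ _ (cst 0) (fun n => expR (- mu) ^+ n)).
- near=> n; rewrite B_ge0/=; apply: (le_trans (B_le _ _)).
    by rewrite ltr_wpDr.
  rewrite -expRM_natr ler_expR mulNr lerN2 mulrDl mulrDr.
  rewrite [mu * (_ + _)]mulrDr addrA ler_wpDl// !addr_ge0// mulr_ge0// ltW//.
- exact: cvg_cst.
- apply: cvg_expr; rewrite ger0_norm ?expR_ge0// expR_lt1 oppr_lt0//.
Unshelve. all: by end_near. Qed.

Let cvg_B_0 (p : R) : - mu <= p -> B p (n.+1%:R^-1) @[n --> \oo] --> 0.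
Proof.
move=> p0; apply: (@squeeze_cvgr _ _ _ _ (cst 0) (fun n => (n.+1%:R^-1) `^ dl)).
- near=> n; rewrite B_ge0/= /B -[leRHS]mul1r ler_pM ?expR_ge0 ?powR_ge0//.
    by rewrite expR_le1 oppr_le0 mulr_ge0// -lerBlDr sub0r.
  rewrite ge0_ler_powR ?ltW// ?nnegrE ?invr_ge0//.
  rewrite ltrBlDr -ltrBlDl; apply: expR_gt1Dx.
  by rewrite oppr_eq0 invr_eq0.
- exact: cvg_cst.
- apply: ((cvg_at_rightP _ _ _).1 (powR_cvg0 dl_gt0)); split.
    by move=> n; rewrite invr_gt0.
  exact: cvg_harmonic.
Unshelve. all: by end_near. Qed.

Let measurable_vpE (p : R) : measurable_fun [set: R] (EFin \o vp p).
Proof. exact/measurable_EFinP. Qed.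

Let vpE_ge0 (p t : R) : (0 <= (EFin \o vp p) t)%E.
Proof. by rewrite lee_fin. Qed.

Let volt_V (p tau : R) : 0 < tau -> 0 <= p ->
  ((p + mu)%:E * \int[leb]_(t in `[tau, +oo[) (vp p t)%:E =
   (p + l1)%:E * \int[leb]_(t in `[tau, +oo[) (vp (p + 1) t)%:E + (B p tau)%:E)%E.
Proof.
move=> t0 p0.
have L1 := ge0_cvg_integral_bndy (a := tau) (measurable_vpE p) (vpE_ge0 p).
have L2 := ge0_cvg_integral_bndy (a := tau) (measurable_vpE (p + 1)) (vpE_ge0 (p + 1)).
have L3 : ((p + mu)%:E * \int[leb]_(t in `[tau, (tau + n%:R)%R]) (vp p t)%:E + (B p (tau + n%:R)%R)%:E)%E
  @[n --> \oo] --> ((p + mu)%:E * \int[leb]_(t in `[tau, +oo[) (vp p t)%:E + 0%:E)%E.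
  apply: cvgeD.
  - exact: fin_num_adde_defl.
  - exact: cvgeZl.
  - by apply: cvg_EFin; [exact: nearW|exact: cvg_B_infty].
have L4 : ((p + l1)%:E * \int[leb]_(t in `[tau, (tau + n%:R)%R]) (vp (p + 1) t)%:E + (B p tau)%:E)%E
  @[n --> \oo] --> ((p + l1)%:E * \int[leb]_(t in `[tau, +oo[) (vp (p + 1) t)%:E + (B p tau)%:E)%E.
  apply: cvgeD.
  - exact: fin_num_adde_defl.
  - exact: cvgeZl.
  - exact: cvg_cst.
rewrite adde0 in L3.
have L5 : (fun n : nat => (p + mu)%:E * \int[leb]_(t in `[tau, (tau + n%:R)%R]) (vp p t)%:E + (B p (tau + n%:R)%R)%:E)%E
   @ \oo --> ((p + l1)%:E * \int[leb]_(t in `[tau, +oo[) (vp (p + 1) t)%:E + (B p tau)%:E)%E.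
  apply: cvg_trans L4; apply: near_eq_cvg; near=> n.
  rewrite volt_FTC// ltrDl.
  by near: n; exact: nbhs_infty_gtr.
exact: cvg_unique L3 L5.
Unshelve. all: by end_near. Qed.

Let measurable_vpT (p t : R) : measurable_fun [set: R] ((EFin \o vp p) \_ `]-oo, t]).
Proof. by apply/(measurable_restrictT _ _).1 => //; exact: measurable_funTS. Qed.

(** At p = - mu one of the two integrals of [volt_FTC] has coefficient 0, which leaves
    the incomplete transform of [v] at 1 - mu. *)
Let bint (t : R) : 0 < t ->
  (\int[leb]_(s in `]-oo, t]) (vp (1 - mu) s)%:E <= ((1 - expR (- t)) `^ dl / dl)%:E)%E.
Proof.
move=> t0.
have m1 : measurable_fun [set: R] ((EFin \o vp (1 - mu)) \_ `]-oo, t]).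
  by apply/(measurable_restrictT _ _).1 => //; exact: measurable_funTS.
have p1 (x : R) : (0 <= ((EFin \o vp (1 - mu)) \_ `]-oo, t]) x)%E.
  by rewrite patchE; case: ifP.
have L1 := ge0_cvg_integral_0bnd m1 p1.
have -> : (\int[leb]_(s in `]-oo, t]) (vp (1 - mu) s)%:E =
  \int[leb]_(s in `]0%R, +oo[) ((EFin \o vp (1 - mu)) \_ `]-oo, t]) s)%E.
  rewrite [RHS]integral_mkcond [LHS]integral_mkcond; apply: eq_integral => x _.
  rewrite [RHS]patchE; case: ifPn => //; rewrite mem_setE in_itv/= andbT -leNgt => x0.
  by rewrite patchE; case: ifP => // _; rewrite /= /vp v_neg// mulr0.
rewrite -(cvg_lim _ L1)//; apply: lime_le; first by apply/cvg_ex; exists (\int[leb]_(s in `]0%R, +oo[) ((EFin \o vp (1 - mu)) \_ `]-oo, t]) s)%E.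
near=> n.
have n0 : 0 < n.+1%:R^-1 :> R by rewrite invr_gt0.
have nt : n.+1%:R^-1 < t.
  near: n.
  have := @cvg_harmonic R => /cvgrPdist_lt /(_ _ t0); apply: filterS => n.
  by rewrite sub0r normrN gtr0_norm// /harmonic invr_gt0.
rewrite -integral_mkcondr (_ : _ `&` _ = `[n.+1%:R^-1, t]%classic); last first.
  by apply/seteqP; split => x /=; rewrite !in_itv/= andbT; [move=> [-> ->]|move=> /andP[-> ->]].
have := volt_FTC (- mu) n0 nt; rewrite addNr mul0e add0e.
rewrite [- mu + l1]addrC [- mu + 1]addrC -/dl => H.
rewrite EFinM lee_pdivlMr// muleC.
rewrite (_ : (1 - expR (- t)) `^ dl = B (- mu) t); last first.
  by rewrite /B addNr mul0r oppr0 expR0 mul1r.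
by rewrite H leeDl// lee_fin.
Unshelve. all: by end_near. Qed.

(** With the unknown density written as v G, variation of constants turns the balance
    equation into G = volt_T G, where volt_k G = W (gam * (v G)) is the derivative
    of G. *)
Definition volt_kap (G : R -> \bar R) := conv (EFin \o gam) (fun s => (v s)%:E * G s)%E.
Definition volt_k (G : R -> \bar R) t := ((W t)%:E * volt_kap G t)%E.
Definition volt_T (G : R -> \bar R) t := (1 + conv heaviside (volt_k G) t)%E.
Let kap := volt_kap.
Let k := volt_k.
Let T := volt_T.

Section Step.
Variable G : R -> \bar R.
Hypothesis mG : measurable_fun [set: R] G.
Hypothesis G0 : forall t, (0 <= G t)%E.

Let mvG : measurable_fun [set: R] (fun s => (v s)%:E * G s)%E.
Proof. by apply: emeasurable_funM => //; exact/measurable_EFinP. Qed.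

Let vG_ge0 (s : R) : (0 <= (v s)%:E * G s)%E.
Proof. by rewrite mule_ge0// lee_fin. Qed.

Let mgamE : measurable_fun [set: R] (EFin \o gam).
Proof. exact/measurable_EFinP. Qed.

Let gamE_ge0 (s : R) : (0 <= (EFin \o gam) s)%E.
Proof. by rewrite lee_fin. Qed.

Lemma volt_kap_ge0 (t : R) : (0 <= kap G t)%E.
Proof. exact: conv_ge0. Qed.

Lemma measurable_volt_kap : measurable_fun [set: R] (kap G).
Proof. exact: measurable_conv. Qed.

Lemma volt_kap_neg (t : R) : t <= 0 -> kap G t = 0%E.
Proof.
move=> t0; rewrite /kap /volt_kap /conv integral0_eq// => s _.
have [s0|s0] := leP s 0; first by rewrite v_neg// mul0e mule0.
by rewrite /= gam_neg ?mul0e// subr_le0 (le_trans t0)// ltW.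
Qed.

Lemma volt_k_ge0 (t : R) : (0 <= k G t)%E.
Proof. by rewrite /k /volt_k mule_ge0 ?lee_fin// volt_kap_ge0. Qed.

Lemma measurable_volt_k : measurable_fun [set: R] (k G).
Proof. by apply: emeasurable_funM; [exact/measurable_EFinP|exact: measurable_volt_kap]. Qed.

Lemma volt_T_ge1 (t : R) : (1 <= T G t)%E.
Proof. rewrite leeDl//; apply: conv_ge0; [exact: heaviside_ge0|exact: volt_k_ge0]. Qed.

Lemma measurable_volt_T : measurable_fun [set: R] (T G).
Proof.
apply: emeasurable_funD => //.
apply: measurable_conv; [exact: measurable_heaviside|exact: heaviside_ge0|..].
  exact: measurable_volt_k.
exact: volt_k_ge0.
Qed.

(** The singularities of W and v at 0 cancel: the mass of v before t is of the order of
    (1 - e^-t)^dl by [bint], and W is of the order of its inverse. *)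
Lemma volt_k_le (S : R -> R) (t : R) : 0 < t ->
  (forall x y : R, x <= y -> S x <= S y) ->
  (forall x, 0 <= S x) ->
  (forall x, (G x <= (S x)%:E)%E) ->
  (k G t <= (C / dl * expR ((1 + mu) * t) * S t)%:E)%E.
Proof.
move=> t0 ndS S0 GS.
have kle : (kap G t <= (C * expR t * S t)%:E * \int[leb]_(s in `]-oo, t]) (vp (1 - mu) s)%:E)%E.
  rewrite /kap /volt_kap /conv [X in (_ <= _ * X)%E]integral_mkcond -ge0_integralZl//; last 3 first.
  - exact: measurable_vpT.
  - by move=> x _; rewrite patchE; case: ifP => _; rewrite lee_fin.
  - by rewrite lee_fin !mulr_ge0// expR_ge0.
  apply: ge0_le_integral => //.
  - by move=> s _; rewrite mule_ge0.
  - exact: integrandconv_measurable.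
  - by apply: emeasurable_funM => //; exact: measurable_vpT.
  move=> s _; rewrite patchE mem_setE in_itv/=.
  have [st|st] := leP s t; last first.
    by rewrite /= gam_neg ?mul0e ?mule0// subr_le0 ltW.
  have [s0|s0] := leP s 0.
    rewrite v_neg// mul0e mule0; apply: mule_ge0; rewrite lee_fin//.
    by rewrite !mulr_ge0// expR_ge0.
  apply: (@le_trans _ _ ((C * expR (- (t - s)))%:E * ((v s)%:E * (S t)%:E))%E).
    apply: lee_pmul => //; rewrite ?lee_fin//.
    rewrite lee_pmul2l//; last by rewrite lte_fin v_gt0.
    by rewrite (le_trans (GS s))// lee_fin ndS.
  rewrite -!EFinM lee_fin /vp.
  rewrite [leRHS](_ : _ = C * (expR t * expR (- ((1 - mu) * s))) * (v s * S t)); last by ring.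
  apply: ler_wpM2r; first by rewrite mulr_ge0.
  apply: ler_wpM2l; first exact: C_ge0.
  rewrite -expRD ler_expR.
  rewrite -subr_ge0 (_ : _ - _ = (t - s) + (t - s) + mu * s); last by ring.
  by apply: addr_ge0; [rewrite addr_ge0// subr_ge0|rewrite mulr_ge0// ltW].
rewrite /k /volt_k.
apply: (@le_trans _ _ ((W t)%:E * ((C * expR t * S t)%:E * ((1 - expR (- t)) `^ dl / dl)%:E))%E).
  rewrite lee_wpmul2l ?lee_fin// (le_trans kle)// lee_wpmul2l// ?bint//.
  by rewrite lee_fin !mulr_ge0// expR_ge0.
rewrite -!EFinM lee_fin /W /volt_W posE// mul1r powRN.
have E0 : (1 - expR (- t)) `^ dl != 0 by rewrite gt_eqF// powR_gt0// omexp_gt0.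
rewrite mulrDl mul1r expRD le_eqVlt; apply/orP; left; apply/eqP; field.
by rewrite E0 gt_eqF.
Qed.

End Step.

(** A supersolution: its derivative is the bound of [volt_k_le] on the kernel, so that
    [volt_T] maps functions below it to functions below it. *)
Let S (t : R) := expR (C / dl / (1 + mu) * expR ((1 + mu) * t)).

Let mu1_gt0 : 0 < 1 + mu. Proof. by rewrite addr_gt0. Qed.

Let a_ge0 : 0 <= C / dl / (1 + mu).
Proof. by rewrite !mulr_ge0// invr_ge0 ltW. Qed.

Let S_nd (x y : R) : x <= y -> S x <= S y.
Proof. by move=> xy; rewrite ler_expR ler_wpM2l// ler_expR ler_wpM2l// ltW. Qed.

Let S_ge1 (x : R) : 1 <= S x.
Proof. by rewrite -[leLHS]expR0 ler_expR mulr_ge0// expR_ge0. Qed.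

Let S_ge0 (x : R) : 0 <= S x.
Proof. exact: expR_ge0. Qed.

Let dS (t : R) : is_derive t (1:R) S (C / dl * expR ((1 + mu) * t) * S t).
Proof.
have d1 : is_derive t (1:R) (fun t => expR ((1 + mu) * t)) ((1 + mu) * expR ((1 + mu) * t)).
  by apply: is_derive_eq; rewrite scaler1 mulrC.
have d2 : is_derive t (1:R) (fun t => C / dl / (1 + mu) * expR ((1 + mu) * t)) (C / dl * expR ((1 + mu) * t)).
  have := is_deriveZ (C / dl / (1 + mu)) d1.
  by rewrite /GRing.scale/= mulrA divfK// gt_eqF.
have d3 := @is_derive1_comp R expR (fun t => C / dl / (1 + mu) * expR ((1 + mu) * t)) t _ _
  (is_derive_expR _) d2.
by rewrite mulrC.
Qed.

Let continuous_S : continuous S.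
Proof.
by move=> t; apply/differentiable_continuous/derivable1_diffP; case: (dS t).
Qed.

Let continuous_dS : continuous (fun s : R => C / dl * expR ((1 + mu) * s) * S s).
Proof.
move=> s; apply: (@continuousM _ _ (fun s : R => C / dl * expR ((1 + mu) * s)) S);
  last exact: continuous_S.
by apply: (@continuousM _ _ (fun=> C / dl) (fun s : R => expR ((1 + mu) * s)));
  [exact: cst_continuous|exact: continuous_expRM].
Qed.

Let int_dS (t : R) : 0 < t ->
  (\int[leb]_(s in `[0%R, t]) (C / dl * expR ((1 + mu) * s) * S s)%:E = (S t)%:E - (S 0)%:E)%E.
Proof.
move=> t0; apply: continuous_FTC2 => //.
- apply: continuous_subspaceT; exact: continuous_dS.
- split.
  + by move=> x _; case: (dS x).
  + by apply: cvg_at_right_filter; exact: continuous_S.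
  + by apply: cvg_at_left_filter; exact: continuous_S.
- by move=> x _; rewrite derive1E; case: (dS x).
Qed.

Let k_neg (G : R -> \bar R) (t : R) : t <= 0 -> k G t = 0%E.
Proof. by move=> t0; rewrite /k /volt_k W_neg// mul0e. Qed.

Lemma volt_T_le (G : R -> \bar R) : measurable_fun [set: R] G ->
  (forall t, 0 <= G t)%E -> (forall t, G t <= (S t)%:E)%E -> forall t, (T G t <= (S t)%:E)%E.
Proof.
move=> mG G0 GS t; rewrite /T /volt_T conv_heaviside.
have [t0|t0] := leP t 0.
  rewrite integral0_eq ?adde0 ?lee_fin// => s/=; rewrite in_itv/= => st.
  by rewrite -[volt_k G s]/(k G s) k_neg// (le_trans st).
apply: (@le_trans _ _ (1 + ((S t)%:E - (S 0)%:E))%E); last first.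
  by rewrite -EFinB -EFinD lee_fin -[leRHS](subrK (S 0)) addrC lerD2l S_ge1.
rewrite leeD2l// -int_dS//.
rewrite [leLHS]integral_mkcond [leRHS]integral_mkcond.
apply: ge0_le_integral => //.
- by move=> s _; rewrite patchE; case: ifP => // _; exact: volt_k_ge0.
- by apply/(measurable_restrictT _ _).1 => //; apply: measurable_funTS; exact: measurable_volt_k.
- apply/(measurable_restrictT _ _).1 => //; apply/measurable_EFinP; apply: measurable_funTS.
  apply: continuous_measurable_fun; exact: continuous_dS.
- move=> s _; rewrite !patchE !mem_setE !in_itv/=.
  have [s0|s0] := ltP s 0; last first.
    case: ifP => // st; have [->|sn0] := eqVneq s 0.
      rewrite -[volt_k G 0]/(k G 0) k_neg// lee_fin !mulr_ge0// ?expR_ge0//.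
      by rewrite invr_ge0 ltW.
    by apply: volt_k_le => //; rewrite lt_neqAle eq_sym sn0.
  by rewrite -[volt_k G s]/(k G s) (k_neg _ (ltW s0)) /=; case: (s <= t).
Qed.

Lemma le_volt_T (G1 G2 : R -> \bar R) : measurable_fun [set: R] G1 ->
  (forall t, 0 <= G1 t)%E -> measurable_fun [set: R] G2 -> (forall t, G1 t <= G2 t)%E ->
  forall t, (T G1 t <= T G2 t)%E.
Proof.
move=> m1 p1 m2 G12 t.
have p2 s : (0 <= G2 s)%E by exact: le_trans (G12 s).
rewrite leeD2l//; apply: le_conv.
- exact: measurable_heaviside.
- exact: heaviside_ge0.
- exact: measurable_volt_k.
- exact: volt_k_ge0.
- exact: measurable_volt_k.
- move=> s; rewrite /volt_k lee_wpmul2l ?lee_fin//; apply: le_conv => //=.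
  + exact/measurable_EFinP.
  + by apply: emeasurable_funM => //; exact/measurable_EFinP.
  + by move=> x; rewrite mule_ge0// lee_fin.
  + by apply: emeasurable_funM => //; exact/measurable_EFinP.
  + by move=> x; rewrite lee_wpmul2l ?lee_fin.
Qed.

Let Gs n : R -> \bar R := iter n T (fun=> 1%E).

Let Gs_prop n : [/\ measurable_fun [set: R] (Gs n), (forall t, 1 <= Gs n t)%E &
  (forall t, Gs n t <= (S t)%:E)%E].
Proof.
elim: n => [|n [mG G1 GS]] /=.
  by split => // t; rewrite lee_fin.
have G0 t : (0 <= Gs n t)%E by exact: le_trans (G1 t).
split.
- exact: measurable_volt_T.
- exact: volt_T_ge1.
- exact: volt_T_le.
Qed.

Let mGs n : measurable_fun [set: R] (Gs n). Proof. by have [] := Gs_prop n. Qed.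
Let Gs_ge1 n (t : R) : (1 <= Gs n t)%E. Proof. by have [_ ] := Gs_prop n. Qed.
Let Gs_ge0 n (t : R) : (0 <= Gs n t)%E. Proof. exact: le_trans (Gs_ge1 n t). Qed.
Let Gs_le n (t : R) : (Gs n t <= (S t)%:E)%E. Proof. by have [_ _] := Gs_prop n. Qed.

Let GsS n (t : R) : (Gs n t <= Gs n.+1 t)%E.
Proof.
elim: n t => [|n ih] t; first by rewrite /=; exact: volt_T_ge1.
exact: (@le_volt_T (Gs n) (Gs n.+1) (mGs n) (Gs_ge0 n) (mGs n.+1) ih).
Qed.

Let Gs_nd (t : R) : {homo Gs^~ t : n m / (n <= m)%N >-> (n <= m)%E}.
Proof. by apply/nondecreasing_seqP => n; exact: GsS. Qed.

Let cvg_Gs (t : R) : cvgn (Gs^~ t).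
Proof. by apply: ereal_nondecreasing_is_cvgn => n m; exact: Gs_nd. Qed.

Definition volt_G (t : R) : \bar R := limn (Gs^~ t).
Let G := volt_G.

Let mG : measurable_fun [set: R] G.
Proof. by apply: (emeasurable_fun_cvg Gs) => // t _; exact: cvg_Gs. Qed.

Let G_ge1 (t : R) : (1 <= G t)%E.
Proof. by apply: lime_ge; [exact: cvg_Gs|exact: nearW]. Qed.

Let G_ge0 (t : R) : (0 <= G t)%E.
Proof. exact: le_trans (G_ge1 t). Qed.

Let G_le (t : R) : (G t <= (S t)%:E)%E.
Proof. by apply: lime_le; [exact: cvg_Gs|exact: nearW]. Qed.

(** Monotone convergence along the increasing iterates. *)
Lemma volt_GE (t : R) : G t = (1 + conv heaviside (k G) t)%E.
Proof.
have kGs_nd x : {homo (fun n => k (Gs n)) ^~ x : n m / (n <= m)%N >-> (n <= m)%E}.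
  move=> n m nm; rewrite /k /volt_k lee_wpmul2l ?lee_fin//; apply: le_conv.
  - exact/measurable_EFinP.
  - by move=> s; rewrite lee_fin.
  - by apply: emeasurable_funM => //; exact/measurable_EFinP.
  - by move=> s; rewrite mule_ge0// lee_fin.
  - by apply: emeasurable_funM => //; exact/measurable_EFinP.
  - by move=> s; rewrite lee_wpmul2l ?lee_fin//; exact: Gs_nd.
have limk x : limn (fun n => k (Gs n) x) = k G x.
  apply/cvg_lim => //; apply: cvgeZl => //.
  have -> : volt_kap G x = conv (EFin \o gam) (fun s => limn (fun n => (v s)%:E * Gs n s))%E x.
    apply: eq_integral => s _; congr (_ * _)%E; apply/esym/cvg_lim => //.
    exact: cvgeZl.
  apply: cvg_conv.
  - exact/measurable_EFinP.
  - by move=> s; rewrite lee_fin.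
  - by move=> s; rewrite ltry.
  - by move=> n; apply: emeasurable_funM => //; exact/measurable_EFinP.
  - by move=> n s; rewrite mule_ge0// lee_fin.
  - by move=> s n m nm; rewrite lee_wpmul2l ?lee_fin//; exact: Gs_nd.
have H : conv heaviside (k (Gs n)) t @[n --> \oo] --> conv heaviside (k G) t.
  have -> : k G = (fun x => limn (fun n => k (Gs n) x)) by apply/funext => x; rewrite limk.
  apply: cvg_conv.
  - exact: measurable_heaviside.
  - exact: heaviside_ge0.
  - by move=> s; rewrite /heaviside ltry.
  - by move=> n; exact: measurable_volt_k.
  - by move=> n s; exact: volt_k_ge0.
  - exact: kGs_nd.
apply/cvg_lim => //; rewrite -cvg_shiftS/=.
apply: cvgeD; last exact: H.
- exact: fin_num_adde_defr.
- exact: cvg_cst.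
Qed.

Let G_fin (t : R) : G t \is a fin_num.
Proof. by rewrite ge0_fin_numE// (le_lt_trans (G_le t))// ltry. Qed.

Let g t := fine (G t).

Let gE t : G t = (g t)%:E. Proof. by rewrite fineK. Qed.

(** G is the integral of a locally integrable function. *)
Let continuous_g (t : R) : 0 < t -> {for t, continuous g}.
Proof.
move=> t0.
have kfin s : k G s \is a fin_num.
  rewrite ge0_fin_numE; last exact: volt_k_ge0.
  have [s0|s0] := leP s 0; first by rewrite k_neg// ltry.
  by apply: (le_lt_trans (volt_k_le mG G_ge0 s0 S_nd S_ge0 G_le)); exact: ltry.
pose kr s := fine (k G s).
have krE s : k G s = (kr s)%:E by rewrite fineK.
have kint0 x : 0 <= x ->
    (\int[leb]_(s in `]-oo, x]) k G s = \int[leb]_(s in `[0%R, x]) (kr s)%:E)%E.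
  move=> x0; rewrite [LHS]integral_mkcond [RHS]integral_mkcond; apply: eq_integral => s _.
  rewrite !patchE !mem_setE !in_itv/=; have [s0|s0] := ltP s 0; last by rewrite krE.
  by rewrite (k_neg _ (ltW s0)) /=; case: (s <= x).
have gT (x : R) : 0 <= x -> (\int[leb]_(s in `[0%R, x]) (kr s)%:E < +oo)%E.
  move=> x0; apply: (@le_lt_trans _ _ (S x)%:E); last exact: ltry.
  by apply: le_trans (G_le x); rewrite volt_GE conv_heaviside kint0// leeDr.
have kr_ge0 s : (0 <= (kr s)%:E)%E by rewrite -krE; exact: volt_k_ge0.
have gP (x : R) : 0 <= x -> g x = 1 + parameterized_integral leb 0 x kr.
  move=> x0; apply: EFin_inj; rewrite -gE volt_GE conv_heaviside kint0//.
  rewrite EFinD /parameterized_integral /Rintegral fineK//.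
  by rewrite ge0_fin_numE ?gT//; exact: integral_ge0.
have mkr : measurable_fun [set: R] (EFin \o kr).
  by rewrite (_ : _ \o _ = k G); [exact: measurable_volt_k|apply/funext => s; rewrite krE].
have t1 : 0 <= t + 1 by rewrite addr_ge0// ltW.
have krint : leb.-integrable `[0, t + 1] (EFin \o kr).
  apply/integrableP; split; first exact: measurable_funTS.
  under eq_integral => s _ do rewrite (gee0_abs (kr_ge0 s)).
  exact: gT.
have := parameterized_integral_continuous t1 krint.
have t1' : 0 < t + 1 by rewrite addr_gt0.
move=> /(continuous_within_itvP _ t1')[H _ _].
have {}H := H t; rewrite in_itv/= t0 ltrDl ltr01 in H.
have {}H := H isT.
suff : g x @[x --> t] --> g t by [].
rewrite gP ?ltW//.
have : 1 + parameterized_integral leb 0 x kr @[x --> t] --> 1 + parameterized_integral leb 0 t kr.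
  by apply: cvgD; [exact: cvg_cst|exact: H].
apply: cvg_trans; apply: near_eq_cvg; near=> x; rewrite gP// ltW//.
near: x; exact: lt_nbhsr.
Unshelve. all: by end_near. Qed.

Let u t := v t * g t.

Let g_ge1 (t : R) : 1 <= g t.
Proof. by rewrite -lee_fin -gE. Qed.

Let mg : measurable_fun [set: R] g.
Proof.
apply/measurable_EFinP; rewrite (_ : EFin \o g = G)//.
by apply/funext => t /=; rewrite gE.
Qed.

Let u_ge0 (t : R) : 0 <= u t.
Proof. by rewrite mulr_ge0// (le_trans _ (g_ge1 t)). Qed.

Let measurable_u : measurable_fun [set: R] u.
Proof. exact: measurable_funM. Qed.

Let measurable_B (p : R) : measurable_fun [set: R] (EFin \o B p).
Proof.
apply/measurable_EFinP; apply: measurable_funM.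
  apply: measurableT_comp; first exact: measurable_expR.
  by apply: measurableT_comp => //; exact: measurable_funM.
exact: (measurableT_comp (@measurable_powR R _)).
Qed.

Let vG_E : (fun s => (v s)%:E * G s)%E = EFin \o u.
Proof. by apply/funext => s; rewrite gE -EFinM. Qed.

Let kB (p t : R) : (k G t * (B p t)%:E = (expR (- (p * t)))%:E * conv (EFin \o gam) (EFin \o u) t)%E.
Proof.
rewrite -vG_E; have [t0|t0] := leP t 0.
  by rewrite k_neg// mul0e -[conv _ _ _]/(kap G t) volt_kap_neg// mule0.
by rewrite /k /volt_k muleAC -EFinM BW.
Qed.

Let laplace_u (p : R) := (\int[leb]_t (expR (- (p * t)) * u t)%:E)%E.

(** The balance equation for u = v G, from that of v on half-lines ([volt_V]). *)
Let u_main (p : R) : 0 <= p ->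
  ((p + mu)%:E * laplace_u p = (p + l1)%:E * laplace_u (p + 1) +
    laplace_u p * \int[leb]_t (expR (- (p * t)) * gam t)%:E)%E.
Proof.
move=> p0.
have lap q : (\int[leb]_t ((vp q t)%:E * G t) = laplace_u q)%E.
  by apply: eq_integral => t _; rewrite gE -EFinM /vp -mulrA.
have H := @conv_heaviside_balance R G (k G) (p + mu) (p + l1) 0 (EFin \o vp p) (EFin \o vp (p + 1)) (EFin \o B p) (cst 0%E).
rewrite /= lap lap adde0 in H.
have -> : ((p + mu)%:E * laplace_u p)%E = ((p + mu)%:E * laplace_u p + \int[leb]_t (k G t * 0))%E.
  by rewrite integral0_eq ?adde0// => t _; rewrite mule0.
have mk : measurable_fun [set: R] (k G) by exact: measurable_volt_k.
have kp t : (0 <= k G t)%E by exact: volt_k_ge0.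
rewrite H//.
- congr (_ + _)%E; under eq_integral do rewrite kB.
  by rewrite laplace_conv.
- exact: k_neg.
- exact: volt_GE.
- by rewrite addr_ge0// ltW.
- by rewrite addr_ge0// ltW// (lt_trans mu_gt0).
- by move=> t; rewrite lee_fin.
- by move=> t t0; rewrite /vp v_neg// mulr0.
- by move=> t; rewrite lee_fin.
- by move=> t t0; rewrite /vp v_neg// mulr0.
- by move=> t; rewrite lee_fin.
- by move=> s s0; rewrite adde0 volt_V.
- apply: cvg_EFin; [exact: nearW|apply: cvg_B_0].
  by rewrite (le_trans _ p0)// oppr_le0 ltW.
- exact: cvg_cst.
Qed.

Let A (tau : R) := (\int[leb]_(t in `]-oo, tau]) (u t)%:E)%E.

(** G is bounded by S on bounded intervals, and v is integrable at 0. *)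
Let A_fin (tau : R) : 0 < tau -> (A tau < +oo)%E.
Proof.
move=> tau0; have S0 := S_ge0 tau.
have le1 : (A tau <= (S tau * expR tau)%:E * \int[leb]_(s in `]-oo, tau]) (vp (1 - mu) s)%:E)%E.
  rewrite -ge0_integralZl//; last 3 first.
  - by apply: measurable_funTS; exact: measurable_vpE.
  - by move=> x _; rewrite lee_fin.
  - by rewrite lee_fin mulr_ge0// expR_ge0.
  apply: ge0_le_integral => //.
  - by move=> t _; rewrite lee_fin.
  - by apply: measurable_funTS; exact/measurable_EFinP.
  - apply: emeasurable_funM => //; apply: measurable_funTS; exact: measurable_vpE.
  - move=> t; rewrite /= in_itv/= => tT; rewrite -EFinM lee_fin.
    have [t0|t0] := leP t 0; first by rewrite /u /vp v_neg// mul0r !mulr0.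
    rewrite /u mulrC /vp -mulrA; apply: ler_pM => //.
    + by rewrite (le_trans _ (g_ge1 t)).
    + by rewrite -lee_fin -gE (le_trans (G_le t))// lee_fin S_nd.
    + rewrite mulrA -[leLHS]mul1r; apply: ler_wpM2r; first exact: v_ge0.
      rewrite -expRD -[leLHS]expR0 ler_expR.
      rewrite (_ : _ + _ = (tau - t) + mu * t); last by ring.
      by apply: addr_ge0; [rewrite subr_ge0|rewrite mulr_ge0// ltW].
apply: (le_lt_trans le1); apply: lte_mul_pinfty => //.
  by rewrite lee_fin mulr_ge0// expR_ge0.
by apply: (le_lt_trans (bint tau0)); exact: ltry.
Qed.

(** The balance equation at p = 0 with all integrals stopped at tau. The cut adds the
    boundary term B 0 tau on the left, which only helps. *)
Let u_trunc (tau : R) : 0 < tau ->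
  (mu%:E * A tau <= l1%:E * \int[leb]_(t in `]-oo, tau]) (expR (- t) * u t)%:E +
    (\int[leb]_t (gam t)%:E) * A tau)%E.
Proof.
move=> tau0.
have mr (f : R -> \bar R) : measurable_fun [set: R] f -> measurable_fun [set: R] (f \_ `]-oo, tau]).
  by move=> mf; apply/(measurable_restrictT _ _).1 => //; exact: measurable_funTS.
have rE (f : R -> \bar R) (t : R) : (f \_ `]-oo, tau]) t = if t <= tau then f t else 0%E.
  by rewrite patchE mem_setE in_itv.
have r0 (f : R -> \bar R) (t : R) : (forall t, 0 <= f t)%E -> (0 <= (f \_ `]-oo, tau]) t)%E.
  by move=> f0; rewrite rE; case: ifP.
pose a p := (EFin \o vp p) \_ `]-oo, tau].
pose c := (EFin \o B 0) \_ `]-oo, tau].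
pose c' := (cst (B 0 tau)%:E) \_ `]-oo, tau].
have lim1 : \forall n \near \oo, n.+1%:R^-1 <= tau :> R.
  have := @cvg_harmonic R => /cvgrPdist_lt /(_ _ tau0); apply: filterS => n.
  by rewrite sub0r normrN gtr0_norm /harmonic ?invr_gt0// => /ltW.
have H := @conv_heaviside_balance R G (k G) mu l1 (B 0 tau) (a 0) (a 1) c c'.
have resG p : (\int[leb]_t (a p t * G t) = \int[leb]_(t in `]-oo, tau]) (expR (- (p * t)) * u t)%:E)%E.
  rewrite [RHS]integral_mkcond; apply: eq_integral => t _.
  rewrite /a rE patchE mem_setE in_itv/=; case: ifP => _; last by rewrite mul0e.
  by rewrite gE -EFinM /= /vp -mulrA.
rewrite !resG in H.
have A0 : A tau = (\int[leb]_(t in `]-oo, tau]) (expR (- (0 * t)) * u t)%:E)%E.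
  by apply: eq_integral => t _; rewrite mul0r oppr0 expR0 mul1r.
under eq_integral do rewrite -[X in expR (- X)]mul1r.
rewrite -A0 in H.
have kc : (\int[leb]_t (k G t * c t) <= \int[leb]_t (gam t)%:E * A tau)%E.
  apply: le_trans (integral_conv_le _ _ _ _ _ _) => //; try exact/measurable_EFinP.
    rewrite [leRHS]integral_mkcond le_eqVlt; apply/orP; left; apply/eqP.
    apply: eq_integral => t _; rewrite /c !rE; case: ifP; rewrite ?mule0// => _.
    by rewrite /= kB mul0r oppr0 expR0 mul1e.
  by move=> t t0; rewrite /= gam_neg.
have ma p : measurable_fun [set: R] (a p) by apply: mr; exact: measurable_vpE.
have ap_ge0 p t : (0 <= a p t)%E by apply: r0 => x; rewrite lee_fin.
have aN p (t : R) : t <= 0 -> a p t = 0%E.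
  by move=> t0; rewrite /a rE; case: ifP => // _; rewrite /= /vp v_neg// mulr0.
have cvg0 : c n.+1%:R^-1 @[n --> \oo] --> 0%E.
  have : (B 0 n.+1%:R^-1)%:E @[n --> \oo] --> 0%E.
    by apply: cvg_EFin; [exact: nearW|apply: cvg_B_0; rewrite oppr_le0 ltW].
  apply: cvg_trans; apply: near_eq_cvg; apply: filterS lim1 => n nT.
  by rewrite /c rE nT.
have cvg1 : c' n.+1%:R^-1 @[n --> \oo] --> (B 0 tau)%:E.
  have : (B 0 tau)%:E @[n --> \oo] --> (B 0 tau)%:E by exact: cvg_cst.
  apply: cvg_trans; apply: near_eq_cvg; apply: filterS lim1 => n nT.
  by rewrite /c' rE nT.
have EE (s : R) : 0 < s -> (mu%:E * \int[leb]_(t in `[s, +oo[) a 0%R t + c' s =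
    l1%:E * \int[leb]_(t in `[s, +oo[) a 1%R t + c s)%E.
  move=> s0; rewrite /a -!integral_mkcondr /c' /c !rE /=.
  have [sT|sT|sT] := ltgtP s tau.
  - rewrite (_ : _ `&` _ = `[s, tau]%classic); last first.
      by apply/seteqP; split => x /=; rewrite !in_itv/= andbT; [move=> [-> ->]|move=> /andP[-> ->]].
    by have := volt_FTC 0 s0 sT; rewrite !add0r.
  - rewrite (_ : _ `&` _ = set0); last first.
      apply/seteqP; split => x //=; rewrite !in_itv/= andbT => -[sx xT].
      by move: sT; rewrite ltNge (le_trans sx xT).
    by rewrite !integral_set0 !mule0.
  - rewrite (_ : _ `&` _ = [set s]); last first.
      apply/seteqP; split => x /=; rewrite !in_itv/= andbT.
        by move=> [sx xT]; apply/eqP; rewrite eq_le sx sT xT.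
      by move=> ->; rewrite sT.
    by rewrite !integral_set1 !mule0 sT.
have HH : (mu%:E * A tau + (B 0 tau)%:E + \int[leb]_t (k G t * c' t) =
    l1%:E * \int[leb]_(t in `]-oo, tau]) (expR (- (1 * t)) * u t)%:E + \int[leb]_t (k G t * c t))%E.
  apply: H => //.
  - exact: measurable_volt_k.
  - by move=> t; exact: volt_k_ge0.
  - exact: k_neg.
  - exact: volt_GE.
  - exact: ltW.
  - by rewrite ltW// (lt_trans mu_gt0).
  - exact: aN.
  - exact: aN.
  - by apply: mr; exact: measurable_B.
  - by move=> t; apply: r0 => x; rewrite lee_fin.
  - exact: mr.
  - by move=> t; apply: r0 => x; rewrite lee_fin.
have q0 : (0 <= (B 0 tau)%:E + \int[leb]_t (k G t * c' t))%E.
  rewrite adde_ge0 ?lee_fin//; apply: integral_ge0 => t _; rewrite mule_ge0//.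
    exact: volt_k_ge0.
  by apply: r0 => x; rewrite lee_fin.
apply: (@le_trans _ _ (mu%:E * A tau + ((B 0 tau)%:E + \int[leb]_t (k G t * c' t)))%E).
  by rewrite leeDl.
by rewrite addeA HH leeD2l.
Qed.

Hypothesis gam_lt : (\int[leb]_t (gam t)%:E < mu%:E)%E.

(** As int gam < mu, the jump term of [u_trunc] is absorbed on the left; beyond t1 the
    factor e^-t makes the remaining term small as well, so A tau is bounded by a
    multiple of A t1. *)
Let u_fin : (\int[leb]_t (u t)%:E < +oo)%E.
Proof.
have gfin : (\int[leb]_t (gam t)%:E)%E \is a fin_num.
  rewrite ge0_fin_numE; last by apply: integral_ge0 => t _; rewrite lee_fin.
  by rewrite (lt_trans gam_lt)// ltry.
have [gh ghE] : exists gh : R, (\int[leb]_t (gam t)%:E = gh%:E)%E.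
  by exists (fine (\int[leb]_t (gam t)%:E)); rewrite fineK.
have eta0 : 0 < mu - gh by rewrite subr_gt0 -lte_fin -ghE.
have l10 : 0 < l1 by rewrite (lt_trans mu_gt0).
(* beyond tau0, l1 * e^-t is at most (mu - gh) / 2 *)
pose tau0 := ln (2 * l1 / (mu - gh)).
pose t1 := Num.max 1 tau0.
have t1_gt0 : 0 < t1 by rewrite lt_max ltr01.
have A_ge0 (tau : R) : (0 <= A tau)%E by apply: integral_ge0 => t _; rewrite lee_fin.
have Afin (tau : R) : 0 < tau -> A tau = (fine (A tau))%:E.
  by move=> tp; rewrite fineK// ge0_fin_numE// A_fin.
have bound (tau : R) : 0 < tau -> fine (A tau) <= 2 * l1 / (mu - gh) * fine (A t1).
  move=> tp; have := u_trunc tp; rewrite ghE.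
  have split : (l1%:E * \int[leb]_(t in `]-oo, tau]) (expR (- t) * u t)%:E <=
      l1%:E * A t1 + ((mu - gh) / 2)%:E * A tau)%E.
    have mexpu : measurable_fun [set: R] (EFin \o (fun t : R => expR (- t) * u t)).
      apply/measurable_EFinP; apply: measurable_funM => //.
      by apply: measurableT_comp => //; exact: measurable_expR.
    have mu1 : measurable_fun [set: R] (EFin \o u) by exact/measurable_EFinP.
    have u10 t : (0 <= (u t)%:E)%E by rewrite lee_fin.
    pose w : R -> \bar R := (EFin \o u) \_ `]-oo, t1].
    have mw : measurable_fun [set: R] w.
      by apply/(measurable_restrictT _ _).1 => //; exact: measurable_funTS.
    have wE t : w t = if t <= t1 then (u t)%:E else 0%E by rewrite /w patchE mem_setE in_itv.
    have w0 t : (0 <= w t)%E by rewrite wE; case: ifP.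
    have e1 : (l1%:E * \int[leb]_(t in `]-oo, tau]) (expR (- t) * u t)%:E =
        \int[leb]_(t in `]-oo, tau]) (l1%:E * (expR (- t) * u t)%:E))%E.
      apply/esym; apply: ge0_integralZl => //; last by rewrite lee_fin ltW.
        exact: measurable_funTS.
      by move=> t _; rewrite lee_fin mulr_ge0// expR_ge0.
    have e2 : (((mu - gh) / 2)%:E * A tau =
        \int[leb]_(t in `]-oo, tau]) (((mu - gh) / 2)%:E * (u t)%:E))%E.
      apply/esym; apply: ge0_integralZl => //; last by rewrite lee_fin divr_ge0// ltW.
      exact: measurable_funTS.
    have e3 : (\int[leb]_(t in `]-oo, tau]) (l1%:E * w t) <= l1%:E * A t1)%E.
      rewrite ge0_integralZl//; last 2 first.
        exact: measurable_funTS.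
        by rewrite lee_fin ltW.
      rewrite lee_wpmul2l ?lee_fin ?(ltW l10)// /A [leRHS]integral_mkcond.
      exact: ge0_subset_integral.
    rewrite e1 e2; apply: (@le_trans _ _ (\int[leb]_(t in `]-oo, tau])
       (l1%:E * w t + ((mu - gh) / 2)%:E * (u t)%:E))%E).
      apply: ge0_le_integral => //.
      - by move=> t _; rewrite -EFinM lee_fin mulr_ge0 ?(ltW l10)// mulr_ge0// expR_ge0.
      - by apply: emeasurable_funM => //; exact: measurable_funTS.
      - apply: emeasurable_funD; apply: emeasurable_funM => //; exact: measurable_funTS.
      - move=> t _; rewrite wE; case: ifPn => [tt|].
          rewrite -[leLHS]adde0; apply: leeD; last by rewrite mule_ge0// lee_fin divr_ge0// ltW.
          rewrite -!EFinM lee_fin ler_wpM2l ?(ltW l10)//.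
          have [t0|t0] := leP t 0; first by rewrite /u v_neg// mul0r mulr0.
          by rewrite -[leRHS]mul1r ler_wpM2r// expR_le1 oppr_le0 ltW.
        rewrite -ltNge /t1 gt_max => /andP[_ tt].
        rewrite mule0 add0e -!EFinM lee_fin mulrA ler_wpM2r//.
        rewrite -ler_pdivlMl// -[leRHS](@lnK _ (l1^-1 * ((mu - gh) / 2))); last first.
          by rewrite posrE mulr_gt0 ?invr_gt0// divr_gt0.
        rewrite ler_expR lerNl (le_trans _ (ltW tt))// /tau0.
        rewrite -lnV ?posrE ?mulr_gt0 ?invr_gt0 ?divr_gt0//.
        rewrite le_eqVlt; apply/orP; left; apply/eqP; congr ln; field.
        by rewrite !gt_eqF.
    rewrite ge0_integralD//; last 4 first.
    - by move=> t _; rewrite mule_ge0// lee_fin ltW.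
    - by apply: emeasurable_funM => //; exact: measurable_funTS.
    - by move=> t _; rewrite mule_ge0// lee_fin divr_ge0// ltW.
    - by apply: emeasurable_funM => //; exact: measurable_funTS.
    exact: leeD2r.
  rewrite (Afin _ tp) => H.
  have := le_trans H (leeD2r _ split); rewrite (Afin _ tp) (Afin _ t1_gt0).
  rewrite -!EFinM -!EFinD lee_fin => {}H.
  rewrite mulrAC ler_pdivlMr//.
  move: H; rewrite /=; move: (fine (A tau)) (fine (A t1)) => x y H.
  rewrite -subr_ge0 (_ : _ - _ = 2 * (l1 * y + (mu - gh) / 2 * x + gh * x - mu * x)); last by field.
  by rewrite mulr_ge0// subr_ge0.
have L : (\int[leb]_(t in `]-oo, n.+1%:R]) (u t)%:E @[n --> \oo] --> \int[leb]_t (u t)%:E)%E.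
  have -> : (\int[leb]_t (u t)%:E = \int[leb]_(t in \bigcup_n `]-oo, n.+1%:R]%classic) (u t)%:E)%E.
    congr (integral _ _ _); apply/seteqP; split => // x _.
    exists (Num.truncn x) => //=; rewrite in_itv/=; exact/ltW/truncnS_gt.
  apply: ge0_nondecreasing_set_cvg_integral => //.
  - move=> n m nm; rewrite subsetEset; apply: subset_itvl.
    by rewrite bnd_simp ler_nat.
  - by move=> n; apply: measurable_funTS; exact/measurable_EFinP.
  - by move=> n x _; rewrite lee_fin.
rewrite -(cvg_lim _ L)//; apply: (@le_lt_trans _ _ (2 * l1 / (mu - gh) * fine (A t1))%:E); last exact: ltry.
apply: lime_le; first by apply/cvg_ex; exists (\int[leb]_t (u t)%:E)%E.
by apply: nearW => n; rewrite -/(A _) Afin// lee_fin bound.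
Qed.

Theorem volterra_density : exists w : R -> R,
  [/\ measurable_fun [set: R] w, (forall t : R, t <= 0 -> w t = 0),
      (forall t : R, 0 < t -> 0 < w t), (forall t : R, 0 < t -> {for t, continuous w}) &
      (\int[leb]_t (w t)%:E < +oo)%E /\
      forall p : R, 0 <= p ->
        ((p + mu)%:E * \int[leb]_t (expR (- (p * t)) * w t)%:E =
         (p + l1)%:E * \int[leb]_t (expR (- ((p + 1) * t)) * w t)%:E +
         \int[leb]_t (expR (- (p * t)) * w t)%:E *
           \int[leb]_t (expR (- (p * t)) * gam t)%:E)%E].
Proof.
exists u; split.
- exact: measurable_u.
- by move=> t t0; rewrite /u v_neg// mul0r.
- by move=> t t0; rewrite /u mulr_gt0 ?v_gt0// (lt_le_trans ltr01).
- move=> t t0; suff : {for t, continuous (fun s => v s * g s)} by [].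
  by apply: continuousM; [exact: continuous_v|exact: continuous_g].
- split; first exact u_fin.
  exact u_main.
Qed.

End Volterra.

(** * Functional calculus of an operator that is triangular on monomials *)

Section EigenCalculus.
Variables (R : fieldType) (a th : nat -> R).
Hypothesis th_inj : injective th.

(** The operator with 'X^n |-> a n *: 'X^n.-1 - th n *: 'X^n. *)
Definition shift_op (p : {poly R}) : {poly R} :=
  \poly_(i < size p) (a i.+1 * p`_i.+1 - th i * p`_i).

Lemma coef_shift_op p i : (shift_op p)`_i = a i.+1 * p`_i.+1 - th i * p`_i.
Proof.
rewrite coef_poly; case: ltnP => // pi.
by rewrite !nth_default ?mulr0 ?subr0// (leq_trans pi).
Qed.

Lemma shift_op_is_linear : linear shift_op.
Proof.
move=> c p q; apply/polyP => i.
by rewrite !(coef_shift_op, coefD, coefZ); ring.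
Qed.

HB.instance Definition _ := GRing.isLinear.Build R {poly R} {poly R} _ shift_op shift_op_is_linear.

(** The k-th coordinate of 'X^n in the basis of eigenpolynomials of [shift_op]. *)
Definition eig_dual n k : R := \prod_(k <= i < n) (a i.+1 / (th i.+1 - th k)).

Definition eig_coord (k : nat) (p : {poly R}) : R := \sum_(k <= n < size p) p`_n * eig_dual n k.

Lemma eig_coordE k (p : {poly R}) N : (size p <= N)%N ->
  eig_coord k p = \sum_(k <= n < N) p`_n * eig_dual n k.
Proof.
move=> pN; have [kp|pk] := leqP k (size p).
  rewrite (big_cat_nat kp pN)/= [X in _ + X]big1_seq ?addr0//.
  by move=> i /=; rewrite mem_index_iota => /andP[pi _]; rewrite nth_default ?mul0r.
rewrite /eig_coord big_geq; last exact: ltnW.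
rewrite big1_seq// => i /=; rewrite mem_index_iota => /andP[ki _].
by rewrite nth_default ?mul0r// (leq_trans (ltnW pk)).
Qed.

Lemma eig_coord_is_linear k : linear_for *%R (eig_coord k).
Proof.
move=> c p q; set N := maxn (size p) (size q).
rewrite (@eig_coordE _ _ N); last first.
  by rewrite (leq_trans (size_polyD _ _))// geq_max !leq_max size_scale_leq leqnn !orbT.
rewrite !(@eig_coordE _ _ N) ?leq_maxl ?leq_maxr//.
rewrite mulr_sumr -big_split/=; apply: eq_bigr => i _.
by rewrite coefD coefZ; ring.
Qed.

HB.instance Definition _ k :=
  GRing.isLinear.Build R {poly R} R _ (eig_coord k) (eig_coord_is_linear k).

Lemma eig_coord0 k (p : {poly R}) : (size p <= k)%N -> eig_coord k p = 0.
Proof. by move=> pk; rewrite /eig_coord big_geq. Qed.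

Lemma eig_coord_lead k (p : {poly R}) : size p = k.+1 -> eig_coord k p = lead_coef p.
Proof.
by move=> pk; rewrite /eig_coord pk big_nat1 /eig_dual big_geq// mulr1 lead_coefE pk.
Qed.

Lemma eig_coord_Xn k n : (k <= n)%N -> eig_coord k 'X^n = eig_dual n k.
Proof.
move=> kn; rewrite /eig_coord size_polyXn big_nat_recr//= coefXn eqxx mul1r.
rewrite big1_seq ?add0r// => i /=; rewrite mem_index_iota => ni.
by rewrite coefXn ltn_eqF ?mul0r//; move: ni => /andP[].
Qed.

(** The leading coefficient of a nonzero polynomial is one of its coordinates. *)
Lemma eig_coord_inj p q : (forall k, eig_coord k p = eig_coord k q) -> p = q.
Proof.
move=> pq; apply/eqP; rewrite -subr_eq0; apply/eqP.
set r := p - q; have r0 k : eig_coord k r = 0 by rewrite linearB/= pq subrr.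
apply/eqP; rewrite -lead_coef_eq0; apply/negPn/negP => lr0.
case E : (size r) => [|m].
  by move/eqP : E; rewrite size_poly_eq0 -lead_coef_eq0 (negbTE lr0).
by move: lr0; rewrite -(eig_coord_lead E) r0 eqxx.
Qed.

Lemma shift_op1 : shift_op 1 = - th 0 *: 1.
Proof.
apply/polyP => i; rewrite coef_shift_op coefZ !coef1/=.
by case: eqP => [->|_]; rewrite !(mulr0, mulr1) sub0r // oppr0.
Qed.

Lemma shift_opXn n : shift_op 'X^(n.+1) = a n.+1 *: 'X^n - th n.+1 *: 'X^(n.+1).
Proof.
apply/polyP => i; rewrite coef_shift_op coefB !coefZ !coefXn eqSS.
by congr (_ - _); case: eqP => [->|]; rewrite ?mulr0.
Qed.

Lemma eigenvalue_diff_neq0 n k : (k < n)%N -> th n - th k != 0.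
Proof. by move=> kn; rewrite subr_eq0; apply/eqP => /th_inj nk; rewrite nk ltnn in kn. Qed.

Lemma eig_dualS n k : (k <= n)%N ->
  a n.+1 * eig_dual n k = (th n.+1 - th k) * eig_dual n.+1 k.
Proof.
move=> kn; rewrite /eig_dual [in RHS]big_nat_recr//=.
have := @eigenvalue_diff_neq0 n.+1 k; rewrite ltnS => /(_ kn).
by move: (\prod_(_ <= _ < _) _) => x h; field.
Qed.

Lemma eig_coord_shift_op k p : eig_coord k (shift_op p) = - th k * eig_coord k p.
Proof.
rewrite -[p]coefK poly_def; rewrite (linear_sum shift_op) !(linear_sum (eig_coord k)) mulr_sumr.
apply: eq_bigr => -[n /= _] _; rewrite !linearZ/= mulrCA; congr (_ * _).
have [nk|kn] := ltnP n k.
  by rewrite !eig_coord0 ?mulr0 ?size_polyXn// (leq_trans (size_poly _ _))// size_polyXn.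
case: n kn => [|n] kn.
  by move: kn; rewrite leqn0 => /eqP ->; rewrite expr0 shift_op1 linearZ.
rewrite shift_opXn linearB/= !linearZ/= (eig_coord_Xn kn).
move: kn; rewrite leq_eqVlt => /predU1P[->|kn].
  by rewrite eig_coord0 ?size_polyXn// mulr0 sub0r mulNr.
by rewrite eig_coord_Xn// eig_dualS//; ring.
Qed.

Definition eig_vec n : {poly R} :=
  \poly_(j < n.+1) \prod_(j <= i < n) (- a i.+1 / (th n - th i)).

Lemma size_eig_vec n : size (eig_vec n) = n.+1.
Proof. by apply: size_poly_eq; rewrite big_geq ?oner_neq0. Qed.

Lemma lead_coef_eig_vec n : lead_coef (eig_vec n) = 1.
Proof. by rewrite lead_coefE size_eig_vec/= coef_poly ltnSn big_geq. Qed.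

Lemma shift_op_eig_vec n : shift_op (eig_vec n) = - th n *: eig_vec n.
Proof.
apply/polyP => j; rewrite coef_shift_op coefZ !coef_poly !ltnS.
have [jn|jn|->] := ltngtP j n.
- rewrite [in RHS]big_ltn// [in X in _ - X]big_ltn//.
  by have h := eigenvalue_diff_neq0 jn; field.
- by rewrite !mulr0 subr0.
- by rewrite big_geq// mulr0 sub0r mulNr mulr1.
Qed.

(** Coordinate functionals and eigenpolynomials are left and right eigenvectors, hence
    orthogonal for distinct eigenvalues. *)
Lemma eig_coord_vec k n : eig_coord k (eig_vec n) = (k == n)%:R.
Proof.
case: eqP => [->|/eqP kn].
  by rewrite (eig_coord_lead (size_eig_vec n)) lead_coef_eig_vec.
have := eig_coord_shift_op k (eig_vec n).
rewrite shift_op_eig_vec linearZ/= => /eqP.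
rewrite -subr_eq0 -mulrBl opprK mulf_eq0 => /orP[|/eqP ->//].
by rewrite addrC subr_eq0 => /eqP /th_inj nk; rewrite nk eqxx in kn.
Qed.

(** [eig_mult F] is the operator that multiplies the k-th eigenpolynomial by [F k],
   that is, the function of [shift_op] with value [F k] at the eigenvalue [- th k]. *)
Definition eig_mult (F : nat -> R) (p : {poly R}) : {poly R} :=
  \sum_(k < size p) (F k * eig_coord k p) *: eig_vec k.

Lemma eig_coord_mult F k p : eig_coord k (eig_mult F p) = F k * eig_coord k p.
Proof.
rewrite /eig_mult (linear_sum (eig_coord k)).
under eq_bigr do rewrite linearZ/= eig_coord_vec.
have [kp|pk] := ltnP k (size p).
  rewrite (bigD1 (Ordinal kp))//= eqxx mulr1 big1 ?addr0// => i ik.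
  rewrite (_ : _ == _ = false) ?mulr0//; apply/negbTE; apply: contra ik => /eqP ki.
  by apply/eqP/val_inj.
rewrite eig_coord0// mulr0 big1// => i _.
by rewrite gtn_eqF ?mulr0// (leq_trans (ltn_ord i)).
Qed.

Lemma eig_mult_is_linear F : linear (eig_mult F).
Proof.
move=> c p q; apply: eig_coord_inj => k.
by rewrite eig_coord_mult !linearP/= !eig_coord_mult; ring.
Qed.

Lemma eig_mult_comp F G p : eig_mult F (eig_mult G p) = eig_mult (fun k => F k * G k) p.
Proof. by apply: eig_coord_inj => k; rewrite !eig_coord_mult mulrA. Qed.

Lemma eig_mult_id F p : (forall k, F k = 1) -> eig_mult F p = p.
Proof. by move=> F1; apply: eig_coord_inj => k; rewrite eig_coord_mult F1 mul1r. Qed.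

Lemma eig_mult_shift_op p : eig_mult (fun k => - th k) p = shift_op p.
Proof. by apply: eig_coord_inj => k; rewrite eig_coord_mult eig_coord_shift_op. Qed.

Lemma eq_eig_mult F G p : F =1 G -> eig_mult F p = eig_mult G p.
Proof. by move=> FG; apply: eig_coord_inj => k; rewrite !eig_coord_mult FG. Qed.

Lemma eig_multD F G p : eig_mult (fun k => F k + G k) p = eig_mult F p + eig_mult G p.
Proof. by apply: eig_coord_inj => k; rewrite linearD/= !eig_coord_mult mulrDl. Qed.

Lemma eig_multZ c F p : eig_mult (fun k => c * F k) p = c *: eig_mult F p.
Proof. by apply: eig_coord_inj => k; rewrite linearZ/= !eig_coord_mult mulrA. Qed.

Lemma eig_multN F p : eig_mult (fun k => - F k) p = - eig_mult F p.
Proof. by apply: eig_coord_inj => k; rewrite linearN/= !eig_coord_mult mulNr. Qed.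

Lemma eig_mult_sum I (r : seq I) (F : I -> nat -> R) p :
  eig_mult (fun k => \sum_(i <- r) F i k) p = \sum_(i <- r) eig_mult (F i) p.
Proof.
apply: eig_coord_inj => k; rewrite eig_coord_mult mulr_suml (linear_sum (eig_coord k)).
by apply: eq_bigr => i _; rewrite /= eig_coord_mult.
Qed.

Lemma eig_vec0 : eig_vec 0 = 1.
Proof.
apply/polyP => i; rewrite coef_poly coef1; case: i => // .
by rewrite big_geq.
Qed.

Lemma eig_mult1 F : eig_mult F 1 = (F 0%N)%:P.
Proof.
apply: eig_coord_inj => k; rewrite eig_coord_mult -[_%:P]mulr1 mul_polyC linearZ/=.
by rewrite -eig_vec0 eig_coord_vec; case: eqP => [->|]; rewrite ?mulr0.
Qed.

Lemma eig_mult_at0 (c : R) p : eig_mult (fun k => c * (k == 0)%:R) p = (c * eig_coord 0 p)%:P.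
Proof.
apply: eig_coord_inj => k; rewrite eig_coord_mult -[_%:P]mulr1 mul_polyC -eig_vec0.
by rewrite linearZ/= eig_coord_vec; case: eqP => [->|]; rewrite !(mulr1, mulr0, mul0r).
Qed.

End EigenCalculus.

(** * From polynomials on [0,1] to a Markov semigroup on C[0,1] *)

Section UniformContinuity.
Context {R : realType}.
Implicit Types f g : R -> R.

Lemma C01P f : C01 f <-> forall x e : R, x \in `[0, 1] -> 0 < e ->
  exists2 d : R, 0 < d & forall y, y \in `[0, 1] -> `|x - y| < d -> `|f x - f y| < e.
Proof.
split=> [/subspace_continuousP cf x e x01 e0|H].
  have /cvgrPdist_lt/(_ _ e0) := cf x x01.
  rewrite /prop_near1 /= /within/= => /nbhs_ballP[d /= d0 xd].
  by exists d => // y y01 xy; exact: xd.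
apply/subspace_continuousP => x x01; apply/cvgrPdist_lt => e e0.
have [d d0 xd] := H x e x01 e0.
rewrite /prop_near1 /= /within/=; apply/nbhs_ballP; exists d => //= y xy y01.
exact: xd.
Qed.

Lemma C01_unif f (e : R) : C01 f -> 0 < e ->
  exists2 d : R, 0 < d & forall x y, x \in `[0, 1] -> y \in `[0, 1] ->
    `|x - y| < d -> `|f x - f y| < e.
Proof.
move=> /C01P cf e0.
have K : compact (`[0, 1]%classic : set R) by exact: segment_compact.
pose P (d x : R) := x \in `[0, 1] -> forall y, y \in `[0, 1] -> `|x - y| < d -> `|f x - f y| < e.
have : \forall d \near (0:R)^'+, `[0, 1]%classic `<=` P d.
  move/compact_near_coveringP : K; apply => x x01.
  have e20 : 0 < e / 2 by rewrite divr_gt0.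
  have [d d0 xd] := cf x (e / 2) x01 e20.
  exists (ball x (d / 2), [set i | i < d / 2]).
    split => /=; first by apply: nbhsx_ballx; rewrite divr_gt0.
    by apply: nbhs_right_lt; rewrite divr_gt0.
  move=> [x' i] /= [xx' id] x'01 y y01 x'y.
  have h1 : `|f x - f x'| < e / 2.
    by apply: xd => //; apply: (lt_le_trans xx'); rewrite ler_pdivrMr// ler_pMr// ler1n.
  have h2 : `|f x - f y| < e / 2.
    apply: xd => //; rewrite -(subrK x' x) -addrA (le_lt_trans (ler_normD _ _))//.
    by rewrite [ltRHS]splitr ltrD// (lt_trans x'y).
  rewrite -(subrK (f x) (f x')) -addrA (le_lt_trans (ler_normD _ _))//.
  by rewrite [ltRHS]splitr ltrD// distrC.
move=> /(filterI (nbhs_right_gt 0))/filter_ex[d [d0 H]]; exists d => // x y x01 y01 xy.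
exact: (H x x01 x01).
Qed.

Lemma C01_bounded f : C01 f -> exists2 M : R, 0 < M & forall x, x \in `[0, 1] -> `|f x| <= M.
Proof.
move=> cf; have [c1 c1I H1] := EVT_max ler01 cf; have [c2 c2I H2] := EVT_min ler01 cf.
exists (`|f c1| + `|f c2| + 1); first by rewrite ltr_wpDl// addr_ge0.
move=> x xI; rewrite ler_norml; apply/andP; split.
  rewrite lerNl (le_trans _ (_ : - f c2 <= _))// ?lerN2 ?H2//.
  by rewrite (le_trans (ler_norm _))// normrN -addrA addrCA lerDl addr_ge0.
by rewrite (le_trans (H1 x xI))// (le_trans (ler_norm _))// -addrA lerDl addr_ge0.
Qed.

Lemma C01_horner (p : {poly R}) : C01 (horner p).
Proof. by apply: continuous_subspaceT; exact: continuous_horner. Qed.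

Lemma sup_norm01_le f (M : R) : (forall x, x \in `[0, 1] -> `|f x| <= M) -> sup_norm01 f <= M.
Proof.
move=> H; apply: ge_sup.
  by exists `|f 0|, 0 => //=; rewrite in_itv/= lexx ler01.
by move=> _ [x /= x01 <-]; exact: H.
Qed.

Lemma le_sup_norm01 f x : C01 f -> x \in `[0, 1] -> `|f x| <= sup_norm01 f.
Proof.
move=> cf x01; have [M _ HM] := C01_bounded cf.
apply: sup_upper_bound; last by exists x.
split; first by exists `|f x|, x.
by exists M => _ [y /= y01 <-]; exact: HM.
Qed.

Lemma sup_norm01_ge0 f : C01 f -> 0 <= sup_norm01 f.
Proof.
move=> cf; apply: le_trans (le_sup_norm01 cf (_ : 0 \in `[0, 1])) => //.
by rewrite in_itv/= lexx ler01.
Qed.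

End UniformContinuity.

Section Bernstein.
Context {R : realType}.
Implicit Types (phi psi : nat -> R) (x : R).

(** Law of the number of successes in n Bernoulli trials: [(bernstein n phi).[x]] is
   the mean of [phi], obtained by conditioning on the first trial. *)
Fixpoint bernstein n phi : {poly R} :=
  if n is n'.+1 then 'X * bernstein n' (phi \o succn) + (1 - 'X) * bernstein n' phi
  else (phi 0%N)%:P.

Lemma horner_bernsteinS n phi x : (bernstein n.+1 phi).[x] =
  x * (bernstein n (phi \o succn)).[x] + (1 - x) * (bernstein n phi).[x].
Proof. by rewrite /= !hornerE. Qed.

Lemma le_bernstein n phi psi x : 0 <= x <= 1 -> (forall k, (k <= n)%N -> phi k <= psi k) ->
  (bernstein n phi).[x] <= (bernstein n psi).[x].
Proof.
move=> x01; have /andP[x0 x1] := x01.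
elim: n phi psi => [|n ih] phi psi pp; first by rewrite /= !hornerC pp.
rewrite !horner_bernsteinS lerD// ler_wpM2l ?subr_ge0//; apply: ih => k kn; apply: pp => //.
exact: leqW.
Qed.

Lemma bernsteinD n phi psi x : (bernstein n (fun k => phi k + psi k)).[x] =
  (bernstein n phi).[x] + (bernstein n psi).[x].
Proof.
elim: n phi psi => [|n ih] phi psi; first by rewrite /= !hornerC.
rewrite !horner_bernsteinS ih (_ : _ \o succn = (fun k => (phi \o succn) k + (psi \o succn) k))//.
by rewrite ih; ring.
Qed.

Lemma bernsteinZ n c phi x : (bernstein n (fun k => c * phi k)).[x] = c * (bernstein n phi).[x].
Proof.
elim: n phi => [|n ih] phi; first by rewrite /= !hornerC.
rewrite !horner_bernsteinS ih (_ : _ \o succn = (fun k => c * (phi \o succn) k))//.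
by rewrite ih; ring.
Qed.

Lemma bernstein_cst n c x : (bernstein n (fun=> c)).[x] = c.
Proof.
elim: n => [|n ih]; first by rewrite /= hornerC.
by rewrite horner_bernsteinS (_ : _ \o succn = (fun=> c))// ih; ring.
Qed.

Lemma bernstein_sqr n c x : (bernstein n (fun k => (k%:R - c) ^+ 2)).[x] =
  (n%:R * x - c) ^+ 2 + n%:R * (x * (1 - x)).
Proof.
elim: n c => [|n ih] c; first by rewrite /= hornerC !mul0r addr0.
rewrite horner_bernsteinS ih.
rewrite (_ : _ \o succn = (fun k => (k%:R - (c - 1)) ^+ 2)); last first.
  by apply/funext => k /=; rewrite -natr1; congr (_ ^+ 2); ring.
by rewrite ih -natr1; ring.
Qed.

(** Bernstein's proof: f is within b of f x, where b charges the squared distance to x,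
    and the binomial variance makes the mean of b small. *)
Lemma weierstrass01 (f : R -> R) (e : R) : C01 f -> 0 < e ->
  exists p : {poly R}, forall x, x \in `[0, 1] -> `|f x - p.[x]| < e.
Proof.
move=> cf e0; have e20 : 0 < e / 2 by rewrite divr_gt0.
have [d d0 Hd] := C01_unif cf e20; have [M M0 HM] := C01_bounded cf.
(* makes 2 M / (d^2 n), which bounds the contribution of the variance, less than e / 2 *)
pose n := (Num.truncn (4 * M / (d ^+ 2 * e))).+1.
have n0 : 0 < n%:R :> R by rewrite ltr0n.
have hn : 4 * M / (d ^+ 2 * e) < n%:R by exact: truncnS_gt.
pose phi k := f (k%:R / n%:R).
exists (bernstein n phi) => x x01.
have x01' : 0 <= x <= 1 by move: x01; rewrite in_itv.
pose b k := e / 2 + 2 * M / d ^+ 2 / n%:R ^+ 2 * (k%:R - n%:R * x) ^+ 2.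
have bound k : (k <= n)%N -> `|f x - phi k| <= b k.
  move=> kn; have kn01 : k%:R / n%:R \in `[0, (1:R)].
    by rewrite in_itv/= divr_ge0//= ler_pdivrMr// mul1r ler_nat.
  have [xk|xk] := ltP `|x - k%:R / n%:R| d.
    rewrite (le_trans (ltW (Hd _ _ x01 kn01 xk)))// lerDl mulr_ge0 ?sqr_ge0//.
    by rewrite !mulr_ge0 ?invr_ge0 ?exprn_ge0// ltW.
  apply: (@le_trans _ _ (2 * M)).
    by rewrite (le_trans (ler_normB _ _))// mulr_natl mulr2n lerD// HM.
  rewrite /b -[leLHS]add0r; apply: lerD; first exact: ltW.
  rewrite (_ : _ * _ ^+ 2 = 2 * M * ((x - k%:R / n%:R) ^+ 2 / d ^+ 2)); last first.
    by field; rewrite !gt_eqF.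
  have M20 : 0 <= 2 * M by rewrite mulr_ge0// ltW.
  apply: ler_peMr => //; rewrite ler_pdivlMr ?exprn_gt0// mul1r.
  by rewrite -[leRHS]real_normK ?num_real// lerXn2r// nnegrE ltW.
have Eb : (bernstein n b).[x] < e.
  rewrite /b bernsteinD bernstein_cst bernsteinZ bernstein_sqr subrr expr0n add0r.
  rewrite [ltRHS]splitr ltrD2l.
  have h4 : x * (1 - x) <= 1 by case/andP: x01' => *; nra.
  apply: (@le_lt_trans _ _ (2 * M / d ^+ 2 / n%:R ^+ 2 * (n%:R * 1))).
    by rewrite !ler_wpM2l// !mulr_ge0// ?invr_ge0 ?exprn_ge0// ltW.
  rewrite (_ : _ * _ = 2 * M / d ^+ 2 / n%:R); last by field; rewrite !gt_eqF.
  rewrite ltr_pdivrMr//; move: hn; rewrite !ltr_pdivrMr ?mulr_gt0 ?exprn_gt0//.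
  move: (n%:R : R) => y H; nra.
have h1 : f x <= (bernstein n phi).[x] + (bernstein n b).[x].
  rewrite -{1}(bernstein_cst n (f x) x) -bernsteinD; apply: le_bernstein => // k kn.
  by have := bound k kn; rewrite ler_norml => /andP[_]; rewrite lerBlDl.
have h2 : (bernstein n phi).[x] <= f x + (bernstein n b).[x].
  rewrite -{1}(bernstein_cst n (f x) x) -bernsteinD; apply: le_bernstein => // k kn.
  by have := bound k kn; rewrite ler_norml => /andP[+ _]; rewrite lerNl opprB lerBlDl.
by rewrite ltr_norml; apply/andP; split; lra.
Qed.

End Bernstein.

Section UniformExtension.
Context {R : realType}.
Implicit Types (f g : R -> R) (p q : {poly R}) (T S : {linear {poly R} -> {poly R}}).

Definition approx01 f p (e : R) := forall x, x \in `[0, 1] -> `|f x - p.[x]| <= e.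

Definition markov_poly T := T 1 = 1 /\
  forall p, (forall x, x \in `[0, 1] -> 0 <= p.[x]) ->
    forall x, x \in `[0, 1] -> 0 <= (T p).[x].

Lemma markov_poly_le T p (M : R) : markov_poly T ->
  (forall x, x \in `[0, 1] -> `|p.[x]| <= M) ->
  forall x, x \in `[0, 1] -> `|(T p).[x]| <= M.
Proof.
move=> [T1 T0] pM x x01.
have TM : T M%:P = M%:P by rewrite -[M%:P]mulr1 mul_polyC linearZ/= T1.
rewrite ler_norml; apply/andP; split.
  have := T0 (p + M%:P) _ x x01; rewrite linearD/= TM hornerD hornerC -lerBlDr sub0r; apply.
  by move=> y /pM; rewrite ler_norml hornerD hornerC -lerBlDr sub0r => /andP[].
have := T0 (M%:P - p) _ x x01; rewrite linearB/= TM hornerD hornerN hornerC subr_ge0; apply.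
by move=> y /pM; rewrite ler_norml hornerD hornerN hornerC subr_ge0 => /andP[].
Qed.

(** The continuous extension of [T]; any [(T p).[x] + e] with [p] within [e] of [f]
    bounds it from above, and two such values cannot cross. *)
Definition extend01 T f x : R :=
  inf [set y | exists p e, approx01 f p e /\ y = (T p).[x] + e].

Lemma approx01_dist f p q (e d : R) : approx01 f p e -> approx01 f q d ->
  forall x, x \in `[0, 1] -> `|(p - q).[x]| <= e + d.
Proof.
move=> fp fq x x01; rewrite hornerD hornerN -(subrK (f x) p.[x]) -addrA.
by rewrite (le_trans (ler_normD _ _))// lerD ?fq// distrC fp.
Qed.

Lemma extend01P T f p (e : R) : markov_poly T -> C01 f -> approx01 f p e ->
  forall x, x \in `[0, 1] -> `|extend01 T f x - (T p).[x]| <= e.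
Proof.
move=> mT cf fp x x01.
have cross q d : approx01 f q d -> (T p).[x] - e <= (T q).[x] + d.
  move=> fq; have := markov_poly_le mT (approx01_dist fp fq) x01.
  rewrite linearB/= hornerD hornerN => /(le_trans (ler_norm _)) ?; lra.
rewrite ler_distl; apply/andP; split.
  apply: lb_le_inf; first by exists ((T p).[x] + e), p, e.
  by move=> _ [q [d [fq ->]]]; exact: cross.
apply: ge_inf; last by exists p, e.
by exists ((T p).[x] - e) => _ [q [d [fq ->]]]; exact: cross.
Qed.

Lemma approx01_ex f (e : R) : C01 f -> 0 < e -> exists p, approx01 f p e.
Proof. by move=> cf /(weierstrass01 cf)[p fp]; exists p => x x01; exact/ltW/fp. Qed.

Lemma eq_extend01 T f x (y : R) : markov_poly T -> C01 f -> x \in `[0, 1] ->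
  (forall e : R, 0 < e -> exists p, approx01 f p e /\ `|y - (T p).[x]| <= e) ->
  extend01 T f x = y.
Proof.
move=> mT cf x01 H; apply/eqP; rewrite -subr_eq0 -normr_le0.
apply/ler_addgt0Pl => e e0; rewrite addr0.
have e20 : 0 < e / 2 by rewrite divr_gt0.
have [p [fp yp]] := H _ e20.
rewrite -(subrK (T p).[x] (extend01 _ _ _)) -addrA (le_trans (ler_normD _ _))//.
by rewrite [leRHS]splitr lerD// ?(extend01P mT)// distrC.
Qed.

Lemma extend01_horner T p x : markov_poly T -> x \in `[0, 1] ->
  extend01 T (horner p) x = (T p).[x].
Proof.
move=> mT x01; apply: eq_extend01 => //; first exact: C01_horner.
by move=> e e0; exists p; split=> [y _|]; rewrite subrr normr0 ltW.
Qed.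

Lemma extend01_C01 T f : markov_poly T -> C01 f -> C01 (extend01 T f).
Proof.
move=> mT cf; apply/C01P => x e x01 e0.
have e30 : 0 < e / 3 by rewrite divr_gt0.
have [p fp] := approx01_ex cf e30.
have /C01P/(_ x _ x01 e30)[d d0 H] := @C01_horner _ (T p).
exists d => // y y01 xy.
have h1 := extend01P mT cf fp x01; have h2 := extend01P mT cf fp y01.
have h3 := H y y01 xy.
move: h1 h2 h3; rewrite !ler_norml !ltr_norml => /andP[? ?] /andP[? ?] /andP[? ?].
by apply/andP; split; lra.
Qed.

Lemma extend01_compat T f g : {in `[0, 1], f =1 g} -> extend01 T f = extend01 T g.
Proof.
move=> fg; apply/funext => x; congr inf; apply/seteqP; split=> y [p [e [H ->]]];
  exists p, e; split => // z z01; [rewrite -fg//|rewrite fg//]; exact: H.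
Qed.

Lemma C01D f g : C01 f -> C01 g -> C01 (f + g).
Proof. by move=> cf cg x; apply: cvgD; [exact: cf|exact: cg]. Qed.

Lemma C01Z (c : R) f : C01 f -> C01 (c *: f).
Proof. by move=> cf x; apply: cvgM; [exact: cvg_cst|exact: cf]. Qed.

Lemma C01B f g : C01 f -> C01 g -> C01 (f - g).
Proof. by move=> cf cg x; apply: cvgB; [exact: cf|exact: cg]. Qed.

Lemma C01_cst (c : R) : C01 (cst c).
Proof. by move=> x; exact: cvg_cst. Qed.

Lemma extend01_linear T (c : R) f g x : markov_poly T -> C01 f -> C01 g -> x \in `[0, 1] ->
  extend01 T (c *: f + g) x = c * extend01 T f x + extend01 T g x.
Proof.
move=> mT cf cg x01; apply: eq_extend01 => //; first by apply: C01D => //; exact: C01Z.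
move=> e e0; set d := e / (`|c| + 1).
have c1 : 0 < `|c| + 1 by rewrite ltr_wpDl.
have d0 : 0 < d by rewrite divr_gt0.
have de : `|c| * d + d = e by rewrite /d; field; rewrite gt_eqF.
have [p fp] := approx01_ex cf d0; have [q fq] := approx01_ex cg d0.
exists (c *: p + q); split => [y y01|].
  rewrite hornerD hornerZ -de [X in `|X|](_ : _ = c * (f y - p.[y]) + (g y - q.[y])); last first.
    have -> : (c *: f + g) y = c * f y + g y by [].
    by ring.
  by rewrite (le_trans (ler_normD _ _))// lerD ?fq// normrM ler_wpM2l// fp.
rewrite linearP/= hornerD hornerZ -de.
rewrite [X in `|X|](_ : _ = c * (extend01 T f x - (T p).[x]) + (extend01 T g x - (T q).[x])); last by ring.
by rewrite (le_trans (ler_normD _ _))// lerD ?normrM ?ler_wpM2l//; apply: extend01P.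
Qed.

Lemma extend01_comp T S f x : markov_poly T -> markov_poly S -> C01 f -> x \in `[0, 1] ->
  markov_poly (T \o S) -> extend01 (T \o S) f x = extend01 T (extend01 S f) x.
Proof.
move=> mT mS cf x01 mTS; apply: eq_extend01 => // e e0.
have [p fp] := approx01_ex cf e0; exists p; split => //=.
by apply: extend01P => //; [exact: extend01_C01|exact: extend01P].
Qed.

Lemma extend01_norm T f (M : R) x : markov_poly T -> C01 f ->
  (forall x, x \in `[0, 1] -> `|f x| <= M) -> x \in `[0, 1] -> `|extend01 T f x| <= M.
Proof.
move=> mT cf fM x01; have := @extend01P T f 0 M mT cf _ x x01.
by rewrite linear0 horner0 subr0; apply => y y01; rewrite horner0 subr0 fM.
Qed.

Lemma extend01_ge0 T f x : markov_poly T -> C01 f ->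
  (forall x, x \in `[0, 1] -> 0 <= f x) -> x \in `[0, 1] -> 0 <= extend01 T f x.
Proof.
move=> mT cf f0 x01; have [M M0 fM] := C01_bounded cf.
have := @extend01P T f (M / 2)%:P (M / 2) mT cf _ x x01.
have -> : T (M / 2)%:P = (M / 2)%:P by rewrite -[(M / 2)%:P]mulr1 mul_polyC linearZ/= mT.1.
rewrite hornerC ler_norml => H.
have /H/andP[] : approx01 f (M / 2)%:P (M / 2).
  move=> y y01; rewrite hornerC ler_norml.
  have := fM y y01; have := f0 y y01; rewrite ler_norml => ? /andP[? ?].
  by apply/andP; split; lra.
by move=> ? _; lra.
Qed.

End UniformExtension.

Section PolynomialSemigroup.
Context {R : realType}.
Variables (a th : nat -> R).
Hypotheses (th_inj : injective th) (th0 : th 0%N = 0) (th_ge0 : forall k, 0 <= th k).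
Local Notation J := (shift_op a th).
Local Notation calc := (eig_mult a th).
Let calc_linear F : linear (calc F) := eig_mult_is_linear a th_inj F.
HB.instance Definition _ F :=
  GRing.isLinear.Build R {poly R} {poly R} _ (calc F) (calc_linear F).

Definition eig_mult_linear F : {linear {poly R} -> {poly R}} := calc F.

Hypothesis minimum_principle : forall (p : {poly R}) x0, x0 \in `[0, 1] ->
  (forall x, x \in `[0, 1] -> p.[x0] <= p.[x]) -> 0 <= (J p).[x0].

(** At a minimum point c of q = (1 - s J)^-1 p, the minimum principle gives
    q.[c] >= p.[c] >= 0. *)
Lemma markov_resolvent (s : R) : 0 <= s -> markov_poly (calc (fun k => (1 + s * th k)^-1)).
Proof.
move=> s0; split => [|p p0 x x01]; first by rewrite /= eig_mult1// th0 mulr0 addr0 invr1.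
rewrite /=; set q := calc _ p.
have E : p = q - s *: J q.
  rewrite -(eig_mult_shift_op _ th_inj) -eig_multZ// -[q in q - _](@eig_mult_id _ a th th_inj (fun=> 1))//.
  rewrite -eig_multN// -eig_multD// /q eig_mult_comp// eig_mult_id// => k /=.
  rewrite mulrN opprK mulfV// gt_eqF//.
  by rewrite ltr_wpDr// mulr_ge0.
have [c c01 qc] := EVT_min (@ler01 R) (@C01_horner _ q).
apply: le_trans (qc x x01).
have := p0 c c01; rewrite E hornerD hornerN hornerZ subr_ge0; apply: le_trans.
by rewrite mulr_ge0// minimum_principle.
Qed.

Lemma markov_comp (T S : {linear {poly R} -> {poly R}}) :
  markov_poly T -> markov_poly S -> markov_poly (T \o S).
Proof.
move=> [T1 T0] [S1 S0]; split => /=; first by rewrite S1.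
by move=> p p0 x x01; apply: T0 => //; exact: S0.
Qed.

Lemma markov_resolvent_iter (s : R) n : 0 <= s ->
  markov_poly (calc (fun k => (1 + s * th k)^-1 ^+ n)).
Proof.
move=> s0; elim: n => [|n [ih1 ih0]].
  split=> [|p p0 x x01]; first by rewrite /= eig_mult_id.
  by rewrite /= eig_mult_id ?p0.
have [h1 h0] := markov_resolvent s0; split.
  by rewrite /= eig_mult1// th0 mulr0 addr0 invr1 expr1n.
move=> p p0 x x01.
rewrite /= (_ : calc _ p = calc (fun k => (1 + s * th k)^-1) (calc (fun k => (1 + s * th k)^-1 ^+ n) p)).
  by apply: h0 => //; exact: ih0.
by rewrite eig_mult_comp//; apply: eq_eig_mult => // k; rewrite exprS.
Qed.

(** On a fixed polynomial only finitely many eigenvalues matter. *)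
Lemma eig_mult_dist p : exists B : nat -> R, forall F G x, x \in `[0, 1] ->
  `|(calc F p).[x] - (calc G p).[x]| <= \sum_(k < size p) `|F k - G k| * B k.
Proof.
have bnd k : exists M : R, forall x, x \in `[0, 1] -> `|(eig_vec a th k).[x]| <= M.
  by have [M _ H] := C01_bounded (@C01_horner _ (eig_vec a th k)); exists M.
pose B k := `|eig_coord a th k p| * projT1 (cid (bnd k)).
exists B => F G x x01; rewrite -hornerN -hornerD -eig_multN// -eig_multD//.
rewrite /eig_mult horner_sum (le_trans (ler_norm_sum _ _ _))// ler_sum// => k _.
rewrite hornerZ !normrM /B -mulrA ler_wpM2l// ler_wpM2l//.
by case: cid => M /= /(_ x x01).
Qed.

Lemma eig_mult_cvg (T : Type) (Fl : set_system T) (F : T -> nat -> R) (G : nat -> R) p (e : R) :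
  Filter Fl -> (forall k, F t k @[t --> Fl] --> G k) -> 0 < e ->
  \forall t \near Fl, forall x, x \in `[0, 1] -> `|(calc (F t) p).[x] - (calc G p).[x]| < e.
Proof.
move=> FF FG e0; have [B HB] := eig_mult_dist p.
have : (\sum_(k < size p) `|F t k - G k| * B k) @[t --> Fl] --> (\sum_(k < size p) `|G k - G k| * B k).
  apply: cvg_big => [|k _]; first exact: add_continuous.
  by apply: cvgMl; apply: cvg_norm; apply: cvgB; [exact: FG|exact: cvg_cst].
rewrite [X in _ --> X]big1; last by move=> k _; rewrite subrr normr0 mul0r.
move=> /cvgrPdist_lt/(_ _ e0); apply: filterS => t H x x01.
apply: (le_lt_trans (HB _ _ x x01)); apply: le_lt_trans H; rewrite sub0r normrN; exact: ler_norm.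
Qed.

Lemma cvg_euler_expRN (u : R) : 0 <= u ->
  (1 + u / n.+1%:R)^-1 ^+ n.+1 @[n --> \oo] --> expR (- u).
Proof.
move=> u0.
have v0 n : 0 <= u / n.+1%:R :> R by rewrite divr_ge0.
have v1 n : 0 < 1 + u / n.+1%:R :> R by rewrite ltr_wpDr.
have nn n : n.+1%:R != 0 :> R by rewrite pnatr_eq0.
apply: (@squeeze_cvgr _ _ _ _ (fun=> expR (- u)) (fun n => expR (- (u / (1 + u / n.+1%:R))))).
- apply: nearW => n; apply/andP; split.
    rewrite (_ : - u = (- (u / n.+1%:R)) * n.+1%:R); last by field.
    rewrite expRM_natr ler_pXn2r ?nnegrE ?expR_ge0 ?invr_ge0//; last exact/ltW.
    rewrite expRN lef_pV2 ?posrE ?expR_gt0//.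
    exact: expR_ge1Dx.
  rewrite (_ : - (u / _) = (- (u / n.+1%:R / (1 + u / n.+1%:R))) * n.+1%:R); last first.
    by rewrite mulNr; congr (- _); rewrite mulrAC divfK.
  rewrite expRM_natr ler_pXn2r ?nnegrE ?expR_ge0 ?invr_ge0//; last exact/ltW.
  apply: le_trans (expR_ge1Dx _); rewrite le_eqVlt; apply/orP; left; apply/eqP.
  by have := lt0r_neq0 (v1 n); move: (_ / n.+1%:R) => w w1; field.
- exact: cvg_cst.
- apply: continuous_cvg; first exact: continuous_expR.
  rewrite -[X in _ --> - X](_ : u / (1 + u * 0) = u); last by rewrite mulr0 addr0 divr1.
  apply: cvgN; apply: cvgMr; apply: cvgV; first by rewrite mulr0 addr0 oner_neq0.
  apply: cvgD; first exact: cvg_cst.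
  by apply: cvgMr; exact: cvg_harmonic.
Qed.

Definition semigroup_poly (t : R) : {linear {poly R} -> {poly R}} :=
  eig_mult_linear (fun k => expR (- (th k * t))).

(** Euler's formula: exp (t J) is the limit of (1 - (t / n) J)^-n. *)
Lemma markov_semigroup_poly (t : R) : 0 <= t -> markov_poly (semigroup_poly t).
Proof.
move=> t0; split => [|p p0 x x01]; first by rewrite /= eig_mult1// th0 mul0r oppr0 expR0.
apply/ler_addgt0Pl => e e0.
have cv k : (1 + t / n.+1%:R * th k)^-1 ^+ n.+1 @[n --> \oo] --> expR (- (th k * t)).
  rewrite (_ : (fun _ => _) = fun n => (1 + (th k * t) / n.+1%:R)^-1 ^+ n.+1).
    by apply: cvg_euler_expRN; rewrite mulr_ge0.
  by apply/funext => n; rewrite mulrAC (mulrC t).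
have FF : Filter (\oo : set_system nat) by exact: eventually_filter.
have /filter_ex[n /(_ x x01)] := eig_mult_cvg p FF cv e0.
have s0 : 0 <= t / n.+1%:R by rewrite divr_ge0.
have := (markov_resolvent_iter n.+1 s0).2 p p0 x x01.
by rewrite ltr_norml /= => + /andP[_ +]; lra.
Qed.

Definition semigroup01 t : (R -> R) -> R -> R := extend01 (semigroup_poly t).

Lemma semigroup_polyD (s t : R) p :
  semigroup_poly (s + t) p = semigroup_poly s (semigroup_poly t p).
Proof.
rewrite /= eig_mult_comp//; apply: eq_eig_mult => // k.
by rewrite -expRD mulrDr opprD.
Qed.

Lemma semigroup_poly_cvg0 p (e : R) : 0 < e -> \forall t \near 0^'+,
  forall x, x \in `[0, 1] -> `|(semigroup_poly t p).[x] - p.[x]| < e.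
Proof.
move=> e0; have cv k : expR (- (th k * t)) @[t --> 0^'+] --> (1 : R).
  rewrite -[X in _ --> X](_ : expR (- (th k * 0)) = 1); last by rewrite mulr0 oppr0 expR0.
  apply: cvg_at_right_filter; apply: continuous_cvg; first exact: continuous_expR.
  by apply: cvgN; apply: cvgMr; exact: cvg_id.
have FF : Filter (0:R)^'+ by exact: at_right_proper_filter.
  have := eig_mult_cvg p FF cv e0; apply: filterS => t H x x01.
by have := H x x01; rewrite (@eig_mult_id _ _ _ _ (fun=> 1)).
Qed.

Lemma semigroup01_markov : Markov_semigroup_C01 semigroup01.
Proof.
split.
- by move=> t f t0 cf; apply: extend01_C01 => //; exact: markov_semigroup_poly.
- by move=> t f g t0 cf cg fg x _; rewrite /semigroup01 (extend01_compat _ fg).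
- move=> t c f g t0 cf cg x x01; rewrite /semigroup01 extend01_linear//.
  exact: markov_semigroup_poly.
- move=> f cf x x01; apply: eq_extend01 => //; first exact: markov_semigroup_poly.
  move=> e e0; have [p fp] := approx01_ex cf e0; exists p; split => //=.
  by rewrite eig_mult_id ?fp// => k; rewrite mulr0 oppr0 expR0.
- move=> s t f s0 t0 cf x x01; rewrite /semigroup01.
  have ms := markov_semigroup_poly s0; have mt := markov_semigroup_poly t0.
  rewrite -(extend01_comp ms mt cf x01 (markov_comp ms mt)).
  congr inf; apply/seteqP; split=> y [p [e [H ->]]];
    by exists p, e; split => //; rewrite semigroup_polyD.
- move=> t t0 x x01; rewrite /semigroup01.
  rewrite (@extend01_compat _ _ (cst 1) (horner 1)); last by move=> y _; rewrite hornerC.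
  have mt := markov_semigroup_poly t0.
  by rewrite extend01_horner// mt.1 hornerC.
- move=> t f t0 cf f0 x x01; apply: extend01_ge0 => //; exact: markov_semigroup_poly.
- move=> t f t0 cf; apply: sup_norm01_le => x x01; apply: extend01_norm => //.
    exact: markov_semigroup_poly.
  by move=> y y01; exact: le_sup_norm01.
- move=> f cf; apply/cvgrPdist_le => e e0.
  have e30 : 0 < e / 3 by rewrite divr_gt0.
  have [p fp] := approx01_ex cf e30.
  near=> t.
  have t0 : 0 <= t by near: t; exact: nbhs_right_ge.
  have mt := markov_semigroup_poly t0.
  have cE : C01 (semigroup01 t f) by exact: extend01_C01.
  rewrite sub0r normrN ger0_norm ?sup_norm01_ge0//; last exact: C01B.
  apply: sup_norm01_le => x x01.
  have h1 := extend01P mt cf fp x01; have h2 := fp x x01.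
  have h3 : `|(semigroup_poly t p).[x] - p.[x]| < e / 3.
    by move: x x01 {h1 h2}; near: t; exact: semigroup_poly_cvg0.
  move: h1 h2 h3; rewrite !ler_norml !ltr_norml !fctE => /andP[? ?] /andP[? ?] /andP[? ?].
  by apply/andP; split; rewrite /semigroup01; lra.
Unshelve. all: by end_near. Qed.

End PolynomialSemigroup.

(** * Smooth cutoff functions *)

Section Cutoff.
Context {R : realType}.
Implicit Types x y : R.

Definition pos_sqr y : R := Num.max 0 y ^+ 2.

Lemma pos_sqr_taylor y d : `|pos_sqr (y + d) - pos_sqr y - d * (2 * Num.max 0 y)| <= d ^+ 2.
Proof.
rewrite /pos_sqr /Num.max ler_norml.
case: ltP => h1; case: ltP => h2; apply/andP; split; nra.
Qed.

Lemma is_derive_of_taylor (f : R -> R) (a c y : R) :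
  (forall d, `|f (y + d) - f y - d * a| <= c * d ^+ 2) -> is_derive y 1 f a.
Proof.
move=> H.
have c0 : 0 <= c by have := H 1; rewrite expr1n mulr1; exact: le_trans.
have L : h^-1 *: (f (h *: 1 + y) - f y) @[h --> 0^'] --> a.
  apply/cvgrPdist_le => e e0.
  near=> d.
  have d0 : d != 0 by near: d; exact: nbhs_dnbhs_neq.
  rewrite /GRing.scale/= mulr1.
  rewrite (_ : a - _ = - (d^-1 * (f (y + d) - f y - d * a))); last by rewrite (addrC d); field.
  rewrite normrN normrM normfV ler_pdivrMl ?normr_gt0//.
  have dd : d ^+ 2 = `|d| * `|d| by rewrite -expr2 real_normK ?num_real.
  have hd : (c + 1) * `|d| <= e.
    rewrite -ler_pdivlMl ?ltr_wpDl//; near: d; apply: dnbhs0_le.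
    by rewrite mulr_gt0 ?invr_gt0 ?ltr_wpDl.
  apply: (le_trans (H d)); rewrite dd mulrA mulrC ler_wpM2l//.
  by apply: le_trans hd; rewrite ler_wpM2r// lerDl.
split; first by apply/cvg_ex; exists a.
exact/cvg_lim.
Unshelve. all: by end_near. Qed.

Definition tent y : R := Num.max 0 (y + 1) - 2 * Num.max 0 y + Num.max 0 (y - 1).

(** The quadratic spline whose derivative is the tent function. *)
Definition smoothstep y : R :=
  (pos_sqr (y + 1) - 2 * pos_sqr y + pos_sqr (y - 1)) / 2.

Lemma smoothstep_taylor y d :
  `|smoothstep (y + d) - smoothstep y - d * tent y| <= 2 * d ^+ 2.
Proof.
have h1 := pos_sqr_taylor (y + 1) d; have h2 := pos_sqr_taylor y d.
have h3 := pos_sqr_taylor (y - 1) d.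
move: h1 h2 h3; rewrite /smoothstep /tent (addrAC y 1) (addrAC y (-1)).
rewrite !ler_norml.
move: (pos_sqr _) (pos_sqr _) (pos_sqr _) (pos_sqr _) (pos_sqr _) (pos_sqr _) (d ^+ 2).
move: (Num.max _ _) (Num.max _ _) (Num.max _ _) => *.
by apply/andP; split; lra.
Qed.

Lemma is_derive_smoothstep y : is_derive y 1 smoothstep (tent y).
Proof. by apply: (@is_derive_of_taylor _ _ 2) => d; exact: smoothstep_taylor. Qed.

Lemma continuous_tent : continuous tent.
Proof.
have cm (c : R) : continuous (fun y => Num.max 0 (y + c)).
  have -> : (fun y => Num.max 0 (y + c)) = (fun y => (y + c + `|y + c|) / 2).
    by apply/funext => y; rewrite maxr_absE add0r sub0r normrN.
  have cD : continuous (fun y : R => y + c) by move=> y; apply: cvgD; [exact: cvg_id|exact: cvg_cst].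
  by move=> y; apply: cvgMl; apply: cvgD; [exact: cD|apply: cvg_norm; exact: cD].
move=> y; rewrite /tent; apply: cvgD; last exact: cm.
apply: cvgB; first exact: cm.
by apply: cvgMr; have := cm 0 y; rewrite (_ : (fun y => _) = Num.max 0) ?addr0//; apply/funext => z; rewrite addr0.
Qed.

Lemma tent_itv y : 0 <= tent y <= 1.
Proof. by rewrite /tent /Num.max; do 3 case: ltP => ?; apply/andP; split; lra. Qed.

Lemma tent_ge y : `|y| <= 2^-1 -> 2^-1 <= tent y.
Proof. by rewrite ler_norml /tent /Num.max => /andP[? ?]; do 3 case: ltP => ?; lra. Qed.

Lemma tent0 y : 1 <= `|y| -> tent y = 0.
Proof.
by rewrite ler_normr /tent /Num.max => /orP[] ?; do 3 case: ltP => ?; lra.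
Qed.

Lemma smoothstep0 y : y <= -1 -> smoothstep y = 0.
Proof. by move=> ?; rewrite /smoothstep /pos_sqr /Num.max; do 3 case: ltP => ?; nra. Qed.

Lemma smoothstep1 y : 1 <= y -> smoothstep y = 1.
Proof. by move=> ?; rewrite /smoothstep /pos_sqr /Num.max; do 3 case: ltP => ?; nra. Qed.

Lemma smoothstep_itv y : 0 <= smoothstep y <= 1.
Proof.
by rewrite /smoothstep /pos_sqr /Num.max; do 3 case: ltP => ?; apply/andP; split; nra.
Qed.

(** Vanishes near 0 and near infinity, and tends to 1 on (0, oo). *)
Definition cutoff n s : R := smoothstep (n.+3%:R * s - 2) - smoothstep (s - n.+3%:R).

Lemma cutoff_itv n (s : R) : 0 <= s -> 0 <= cutoff n s <= 1.
Proof.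
move=> s0; rewrite /cutoff.
have /andP[h1 h2] := smoothstep_itv (n.+3%:R * s - 2).
have /andP[h3 h4] := smoothstep_itv (s - n.+3%:R).
have [h|h] := lerP 1 (n.+3%:R * s - 2).
  by rewrite (smoothstep1 h); apply/andP; split; lra.
rewrite (@smoothstep0 (s - _)); first by apply/andP; split; lra.
move: h; rewrite -addn3 natrD; have : 0 <= n%:R :> R by [].
by move: (n%:R : R) => m ? ?; nra.
Qed.

Definition dcutoff n s : R := n.+3%:R * tent (n.+3%:R * s - 2) - tent (s - n.+3%:R).

Lemma is_derive_affine (f df : R -> R) (a b s : R) : (forall y, is_derive y 1 f (df y)) ->
  is_derive s 1 (fun s => f (a * s + b)) (a * df (a * s + b)).
Proof.
move=> fdf.
have h : is_derive s 1 (fun s => a * s + b) a.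
  by apply: is_derive_eq; rewrite /GRing.scale/= !(mulr0, mulr1, addr0, add0r).
have := @is_derive1_comp _ f (fun s => a * s + b) s (df (a * s + b)) a (fdf _) h.
by rewrite mulrC.
Qed.

Lemma is_derive_cutoff n (s : R) : is_derive s 1 (cutoff n) (dcutoff n s).
Proof.
rewrite /cutoff /dcutoff; apply: is_deriveB.
  exact: (is_derive_affine n.+3%:R (-2) s is_derive_smoothstep).
have := is_derive_affine 1 (- n.+3%:R) s is_derive_smoothstep.
rewrite (_ : (fun s => _) = (fun s => smoothstep (s - n.+3%:R))) ?mul1r//.
by apply/funext => z; rewrite mul1r.
Qed.

Lemma continuous_tent_affine (a b : R) : continuous (fun s => tent (a * s + b)).
Proof.
move=> s; apply: (@continuous_comp _ _ _ (fun s => a * s + b) tent); last exact: continuous_tent.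
by apply: cvgD; [apply: cvgMr; exact: cvg_id|exact: cvg_cst].
Qed.

Lemma continuous_dcutoff n : continuous (dcutoff n).
Proof.
move=> s; apply: cvgB; first by apply: cvgMr; exact: continuous_tent_affine.
have := @continuous_tent_affine 1 (- n.+3%:R) s.
rewrite (_ : (fun s => _) = (fun s => tent (s - n.+3%:R))) ?mul1r//.
by apply/funext => z; rewrite mul1r.
Qed.

Lemma cutoff_out n (s : R) : s \notin `[n.+3%:R^-1, n.+3%:R + 1] -> cutoff n s = 0.
Proof.
have n0 : 3 <= n.+3%:R :> R by rewrite ler_nat.
rewrite in_itv/= negb_and -!ltNge /cutoff => /orP[|] h.
  have h' : n.+3%:R * s < 1 by rewrite -ltr_pdivlMl ?mulr1// ?ltr0n.
  rewrite !smoothstep0 ?subrr//; last lra.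
  by move: h' n0; move: (n.+3%:R : R) => m; nra.
by rewrite !smoothstep1 ?subrr//; move: h n0; move: (n.+3%:R : R) => m; nra.
Qed.

(** The slope n + 3 is reached only at distance of order 1 / n from 0; against a function
    of the order of min s 1 the derivatives of the cutoffs stay bounded, as dominated
    convergence requires. *)
Lemma dcutoff_bound n (s : R) : 0 <= s -> `|dcutoff n s| * Num.min s 1 <= 4.
Proof.
move=> s0; have m0 : 0 <= Num.min s 1 by rewrite le_min s0 ler01.
have ms : Num.min s 1 <= s by rewrite ge_min lexx.
have m1 : Num.min s 1 <= 1 by rewrite ge_min lexx orbT.
have n0 : 3 <= n.+3%:R :> R by rewrite ler_nat.
have /andP[h3 h4] := tent_itv (s - n.+3%:R).
have /andP[h1 h2] := tent_itv (n.+3%:R * s - 2).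
have : n.+3%:R * tent (n.+3%:R * s - 2) * Num.min s 1 <= 3.
  have [h|h] := lerP 1 `|n.+3%:R * s - 2|; first by rewrite tent0// mulr0 mul0r.
  move: h h1 h2 n0 ms m0; rewrite ltr_norml => /andP[_].
  move: (tent _) => t; move: (n.+3%:R : R) (Num.min _ _) => m w *.
  apply: (@le_trans _ _ (m * t * s)); first by apply: ler_wpM2l => //; nra.
  by rewrite mulrAC; nra.
rewrite /dcutoff => h; rewrite -[X in _ * X]ger0_norm// -normrM mulrBl ler_norml.
have : 0 <= n.+3%:R * tent (n.+3%:R * s - 2) * Num.min s 1 by rewrite !mulr_ge0.
move: h; move: (_ * tent _ * _) => A ? ?.
have : tent (s - n.+3%:R) * Num.min s 1 <= 1 by rewrite mulr_ile1.
have : 0 <= tent (s - n.+3%:R) * Num.min s 1 by rewrite mulr_ge0.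
by move: (tent _ * _) => B ? ?; apply/andP; split; lra.
Qed.

Lemma near_cutoff (s : R) : 0 < s -> \forall n \near \oo, cutoff n s = 1 /\ dcutoff n s = 0.
Proof.
move=> s0; near=> n.
have h1 : 3 / s <= n%:R by near: n; exact: nbhs_infty_ger.
have h2 : s + 1 <= n%:R by near: n; exact: nbhs_infty_ger.
have h3 : 1 <= n.+3%:R * s - 2.
  move: h1; rewrite ler_pdivrMr// (_ : n.+3%:R = n%:R + 3); last by rewrite -addn3 natrD.
  by move=> ?; nra.
have h4 : s - n.+3%:R <= -1 by move: h2; rewrite -addn3 natrD; move: (n%:R : R) => m; lra.
rewrite /cutoff /dcutoff smoothstep1// smoothstep0// subr0 !tent0 ?mulr0 ?subrr//.
  by rewrite ler_normr; apply/orP; right; lra.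
by rewrite ler_normr h3.
Unshelve. all: by end_near. Qed.

End Cutoff.

(** * Moments and monotonicity of the jump density *)

Section RintegralExpr.
Context d (T : measurableType d) (R : realType) (mu : {measure set T -> \bar R}).
Variables (D : set T) (w : T -> R).
Hypotheses (mD : measurable D) (iw : mu.-integrable D (EFin \o w)).

Lemma integrable_mul_bounded (f : T -> R) (M : R) : measurable_fun D f ->
  (forall x, D x -> `|f x| <= M) -> mu.-integrable D (EFin \o (fun x => w x * f x)).
Proof.
move=> mf fM; have mw : measurable_fun D w by apply/measurable_EFinP; exact: measurable_int iw.
apply: (@le_integrable _ _ _ _ _ mD _ (EFin \o (fun x => w x * M))).
- by apply/measurable_EFinP; exact: measurable_funM.
- move=> x Dx; rewrite /= lee_fin !normrM ler_wpM2l// (le_trans (fM x Dx))//; exact: ler_norm.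
- have := integrableZr mD M iw; apply: eq_integrable => // x _; by rewrite /= EFinM.
Qed.

Variable y : T -> R.
Hypotheses (my : measurable_fun D y) (y1 : forall x, D x -> `|y x| <= 1).

Lemma integrable_mul_expr n : mu.-integrable D (EFin \o (fun x => w x * y x ^+ n)).
Proof.
apply: (@integrable_mul_bounded _ 1); first exact: measurable_funX.
by move=> x Dx; rewrite normrX exprn_ile1// y1.
Qed.

Lemma Rintegral_sum_expr N (c : 'I_N -> R) (k : 'I_N -> nat) :
  \int[mu]_(x in D) (\sum_(i < N) c i * (w x * y x ^+ k i)) =
  \sum_(i < N) c i * \int[mu]_(x in D) (w x * y x ^+ k i).
Proof.
have ic i : mu.-integrable D (fun x => ((c i)%:E * (w x * y x ^+ k i)%:E)%E).
  by apply: integrableZl => //; exact: integrable_mul_expr.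
rewrite /Rintegral (_ : (fun x => _) =
  (fun x => \sum_(i < N) ((c i)%:E * (w x * y x ^+ k i)%:E))%E); last first.
  by apply/funext => x /=; rewrite -sumEFin; apply: eq_bigr => i _; rewrite EFinM.
rewrite integral_sum// -sum_fine; last by move=> i _; exact: integrable_fin_num.
apply: eq_bigr => i _; rewrite integralZl//; last exact: integrable_mul_expr.
by rewrite fineM//; apply: integrable_fin_num => //; exact: integrable_mul_expr.
Qed.

End RintegralExpr.

Lemma measurable_invr {R : realType} : measurable_fun [set: R] (@GRing.inv R).
Proof.
rewrite (_ : GRing.inv = fun x => x * (x ^+ 2) `^ (-1)).
  apply: measurable_funM => //; apply: (measurableT_comp (measurable_powR _)).
  exact: measurable_funX.
apply/funext => x; rewrite powR_inv1 ?sqr_ge0//.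
have [->|x0] := eqVneq x 0; first by rewrite invr0 mul0r.
by rewrite expr2 invfM mulrA divff// mul1r.
Qed.

Section LogWeight.
Context {R : realType}.
Local Notation leb := (@lebesgue_measure R).
Variables (h : R -> R).
Hypotheses (h_ge0 : forall r, 0 <= h r) (h_out : forall r, r <= 1 -> h r = 0).
Hypothesis h_int : leb.-integrable `]1, +oo[ (EFin \o h).

(** The tail of [Pi], a function of s = ln r. *)
Definition log_weight s : R := expR s * h (expR s).
Local Notation g := log_weight.

Lemma measurable_h : measurable_fun [set: R] h.
Proof.
have mh : measurable_fun (`]1, +oo[%classic : set (measurableTypeR R)) h by apply/measurable_EFinP; exact: measurable_int h_int.
rewrite (_ : h = h \_ `]1, +oo[); first by apply/(measurable_restrictT _ _).1.
apply/funext => r; rewrite patchE mem_setE in_itv/= andbT.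
by case: ltP => // /h_out.
Qed.

Lemma measurable_log_weight : measurable_fun [set: R] g.
Proof.
apply: measurable_funM; first exact: measurable_expR.
apply: measurableT_comp; [exact: measurable_h|exact: measurable_expR].
Qed.

Lemma log_weight_ge0 s : 0 <= g s.
Proof. by rewrite mulr_ge0 ?expR_ge0. Qed.

Lemma log_weight0 s : s <= 0 -> g s = 0.
Proof. by move=> s0; rewrite /g h_out ?mulr0// -expR0 ler_expR. Qed.

Lemma ge0_integral_log_weight (psi : R -> \bar R) :
  measurable_fun [set: R] psi -> (forall x, (0 <= psi x)%E) ->
  (\int[leb]_s ((g s)%:E * psi (expR (- s))) =
   \int[leb]_(r in `]1%R, +oo[) ((h r)%:E * psi r^-1%R))%E.
Proof.
move=> mpsi psi0.
have minv : measurable_fun [set: R] (fun r : R => psi r^-1).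
  by apply: measurableT_comp => //; exact: measurable_invr.
have mf : measurable_fun [set: R] (fun r : R => ((h r)%:E * psi r^-1%R)%E).
  by apply: emeasurable_funM => //; apply/measurable_EFinP; exact: measurable_h.
have f0 r : (0 <= (h r)%:E * psi r^-1%R)%E by rewrite mule_ge0// lee_fin.
transitivity (\int[leb]_(r in `]0%R, +oo[) ((h r)%:E * psi r^-1%R))%E; last first.
  rewrite integral_mkcond [RHS]integral_mkcond; apply: eq_integral => r _.
  rewrite !patchE !mem_setE !in_itv/= !andbT.
  case: (ltP 1 r) => r1; first by rewrite (lt_trans ltr01 r1).
  by case: ifP => // _; rewrite h_out// mul0e.
rewrite ge0_integral_expRN//.
have mexpN : measurable_fun [set: R] (fun t : R => expR (- t)).
  by apply: continuous_measurable_fun => t; apply: continuous_comp; [exact: continuousN|exact: continuous_expR].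
rewrite -[RHS](ge0_integral_opp (f := fun t => (expR (- t))%:E * ((h (expR (- t)))%:E * psi (expR (- t))^-1%R))%E).
- apply: eq_integral => s _; rewrite opprK muleA -EFinM; congr (_ * psi _)%E.
  by rewrite expRN.
- apply: emeasurable_funM.
    exact/measurable_EFinP.
  exact: (measurableT_comp (f := fun r => ((h r)%:E * psi r^-1%R)%E)).
- by move=> t; rewrite mule_ge0 ?lee_fin ?expR_ge0.
Qed.

Lemma integral_log_weight : (\int[leb]_s (g s)%:E = (hbar h)%:E)%E.
Proof.
have := @ge0_integral_log_weight (cst 1%E) (measurable_cst _) (fun=> lee01).
under eq_integral do rewrite mule1.
move=> ->; under eq_integral do rewrite mule1.
by rewrite /hbar /Rintegral fineK//; exact: integrable_fin_num h_int.
Qed.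

Lemma integrable_log_weight : leb.-integrable [set: R] (EFin \o g).
Proof.
apply/integrableP; split; first by apply/measurable_EFinP; exact: measurable_log_weight.
under eq_integral => s _ do rewrite /= ger0_norm ?log_weight_ge0//.
by rewrite integral_log_weight ltry.
Qed.

Definition hmom n : R := \int[leb]_(r in `]1, +oo[) (h r * r^-1 ^+ n.+1).

Lemma hmom_integrable n : leb.-integrable `]1, +oo[ (EFin \o (fun r => h r * r^-1 ^+ n.+1)).
Proof.
apply: integrable_mul_expr => //; first by apply: measurable_funTS; exact: measurable_invr.
move=> r /=; rewrite in_itv/= andbT => r1.
by rewrite normfV invf_le1 ?normr_gt0 ?gt_eqF ?(lt_trans ltr01)// (le_trans (ltW r1))// ler_norm.
Qed.

Lemma hmomE n : (\int[leb]_s (g s * expR (- s) ^+ n.+1)%:E = (hmom n)%:E)%E.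
Proof.
have mpsi : measurable_fun [set: R] (fun x : R => (`|x| ^+ n.+1)%:E).
  by apply/measurable_EFinP; apply: measurable_funX; exact: normr_measurable.
have psi0 (x : R) : (0 <= (`|x| ^+ n.+1)%:E)%E by rewrite lee_fin exprn_ge0.
transitivity (\int[leb]_(r in `]1%R, +oo[) ((h r)%:E * (`|r^-1%R| ^+ n.+1)%:E))%E.
  rewrite -(ge0_integral_log_weight mpsi psi0); apply: eq_integral => s _.
  by rewrite -EFinM ger0_norm// expR_ge0.
rewrite /hmom /Rintegral fineK; last exact: integrable_fin_num (hmom_integrable n).
apply: eq_integral => r; rewrite inE/= in_itv/= andbT => r1.
by rewrite -EFinM ger0_norm// invr_ge0 (le_trans ler01)// ltW.
Qed.

Lemma hmom_ge0 n : 0 <= hmom n.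
Proof.
apply: Rintegral_ge0 => r /=; rewrite in_itv/= andbT => r1.
by rewrite mulr_ge0// exprn_ge0// invr_ge0 (le_trans ler01)// ltW.
Qed.

Lemma hmom_le_hbar n : hmom n <= hbar h.
Proof.
apply: le_Rintegral => //; first exact: hmom_integrable.
move=> r /=; rewrite in_itv/= andbT => r1; have r0 := lt_trans ltr01 r1.
by rewrite ler_piMr// exprn_ile1 ?invr_ge0 ?invf_le1// ltW.
Qed.

Variable Pi : {finite_measure set (measurableTypeR R) -> \bar R}.
Hypothesis h_Pi : minus_derivative_measure h Pi.

Lemma integral_log_weight_test (f df : R -> R) (a b : R) :
  (forall x : R, is_derive x 1 f (df x)) -> continuous df -> 0 < a ->
  (forall x, x \notin `[a, b] -> f x = 0) ->
  \int[leb]_s (g s * df s) = \int[Pi]_(r in `]0, +oo[) f r.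
Proof.
move=> fdf cdf a0 f0.
have E : derive1 f = df by apply/funext => x; rewrite derive1E; exact: derive_val.
rewrite -h_Pi.2; last first.
  split; first by move=> x; case: (fdf x).
    by rewrite E.
  by exists a, b.
rewrite E [RHS]Rintegral_mkcond; apply: eq_Rintegral => s _.
rewrite patchE mem_setE in_itv/= andbT; case: ltP => // /log_weight0 ->.
by rewrite mul0r.
Qed.

Lemma derive_measurable (f df : R -> R) : (forall x : R, is_derive x 1 f (df x)) ->
  measurable_fun [set: R] f.
Proof.
move=> fdf; apply: continuous_measurable_fun => x.
by apply: differentiable_continuous; apply/derivable1_diffP; case: (fdf x).
Qed.

Definition log_weight_bound : R := 2 * (fine (Pi [set: R]) + hbar h).

(** Pairs Pi with a function that rises across the ball and comes back down around 2.
    The pairing is at most the mass of Pi; the descent costs at most hbar; the rise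
    has slope at least 1 / (4 d) on the ball. *)
Lemma log_weight_ball (s d : R) : 0 < d -> 2 * d < s ->
  (\int[leb]_(t in ball s d) (g t)%:E <= (log_weight_bound * (d *+ 2))%:E)%E.
Proof.
move=> d0 ds; set c := (2 * d)^-1.
have c0 : 0 < c by rewrite invr_gt0 mulr_gt0.
pose f t := smoothstep (c * t + - (c * s)) - smoothstep (1 * t + - 2).
pose df t := c * tent (c * t + - (c * s)) - 1 * tent (1 * t + - 2).
have fdf x : is_derive x (1:R) f (df x).
  by apply: is_deriveB; apply: is_derive_affine; exact: is_derive_smoothstep.
have cdf : continuous df.
  by move=> x; apply: cvgB; apply: cvgMr; exact: continuous_tent_affine.
pose a := Num.min (s - 2 * d) 1; pose b := Num.max (s + 2 * d) 3.
have a0 : 0 < a by rewrite lt_min subr_gt0 ds ltr01.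
have f0 x : x \notin `[a, b] -> f x = 0.
  rewrite in_itv/= negb_and -!ltNge lt_min gt_max => /orP[/andP[h1 h2]|/andP[h1 h2]].
    rewrite /f !smoothstep0 ?subrr//; first lra.
    have : c * x + - (c * s) <= c * (- (2 * d)) by rewrite -mulrBr ler_wpM2l ?ltW//; lra.
    by rewrite mulrN /c mulVf// gt_eqF// mulr_gt0.
  rewrite /f !smoothstep1 ?subrr//; first lra.
  have : c * (2 * d) <= c * x + - (c * s) by rewrite -mulrBr ler_wpM2l ?ltW//; lra.
  by rewrite /c mulVf// gt_eqF// mulr_gt0.
have mt u v : measurable_fun [set: R] (fun t => tent (u * t + v)).
  by apply: continuous_measurable_fun; exact: continuous_tent_affine.
have bt u v t : [set: R] t -> `|tent (u * t + v)| <= 1.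
  by have /andP[? ?] := tent_itv (u * t + v); rewrite ger0_norm.
have ig := integrable_log_weight.
have i1 : leb.-integrable [set: R] (EFin \o (fun t => g t * (c * tent (c * t + - (c * s))))).
  apply: (@integrable_mul_bounded _ _ _ leb setT g measurableT ig _ c).
    by apply: measurable_funM; [exact: measurable_cst|exact: mt].
  by move=> t _; rewrite normrM gtr0_norm// ler_piMr ?(ltW c0)// bt.
have i2 : leb.-integrable [set: R] (EFin \o (fun t => g t * (1 * tent (1 * t + - 2)))).
  apply: (@integrable_mul_bounded _ _ _ leb setT g measurableT ig _ 1).
    by apply: measurable_funM; [exact: measurable_cst|exact: mt].
  by move=> t _; rewrite mul1r bt.
have E := integral_log_weight_test fdf cdf a0 f0.
have le1 : \int[Pi]_(r in `]0, +oo[) f r <= fine (Pi [set: R]).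
  have mI : measurable (`]0, +oo[%classic : set (measurableTypeR R)) by [].
  have f1 t : -1 <= f t <= 1.
    have /andP[? ?] := smoothstep_itv (c * t + - (c * s)).
    have /andP[? ?] := smoothstep_itv (1 * t + - 2).
    by rewrite /f; apply/andP; split; lra.
  have fin : (Pi (`]0%R, +oo[%classic : set (measurableTypeR R)) < +oo)%E by rewrite ltey_eq fin_num_measure.
  apply: (@le_trans _ _ (\int[Pi]_(r in `]0, +oo[) cst 1 r)).
    apply: le_Rintegral => //.
    - apply: measurable_bounded_integrable => //.
        by apply: measurable_funTS; exact: derive_measurable fdf.
      exists 1; split => // M M1 t _; rewrite /= ler_norml.
      by have := f1 t; move: M1 => /ltW M1 /andP[? ?]; apply/andP; split; lra.
    - apply: measurable_bounded_integrable => //.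
      exists 1; split => // M M1 t _; rewrite /= normr1; exact: ltW.
    - by move=> t _; have /andP[] := f1 t.
  rewrite Rintegral_cst// mul1r fine_le ?fin_num_measure// le_measure// inE//.
have le2 : \int[leb]_t (g t * (1 * tent (1 * t + - 2))) <= hbar h.
  rewrite (_ : hbar h = \int[leb]_t g t); last by rewrite [RHS]/Rintegral integral_log_weight.
  apply: le_Rintegral => // t _; rewrite mul1r ler_piMr ?log_weight_ge0//.
  by have /andP[] := tent_itv (1 * t + - 2).
have key : \int[leb]_t (g t * (c * tent (c * t + - (c * s)))) <= fine (Pi [set: R]) + hbar h.
  move: E; rewrite (_ : (fun s => _) = (fun t => g t * (c * tent (c * t + - (c * s))) - g t * (1 * tent (1 * t + - 2)))); last first.
    by apply/funext => t; rewrite mulrBr.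
  by rewrite RintegralB// => /eqP; rewrite subr_eq => /eqP ->; exact: lerD.
apply: (@le_trans _ _ (\int[leb]_t ((4 * d)%:E * (g t * (c * tent (c * t + - (c * s))))%:E))%E).
  rewrite integral_mkcond; apply: ge0_le_integral => //.
  - by move=> t _; rewrite patchE; case: ifP => // _; rewrite lee_fin log_weight_ge0.
  - apply/(measurable_restrictT _ _).1; first exact: measurable_ball.
    by apply: measurable_funTS; apply/measurable_EFinP; exact: measurable_log_weight.
  - apply/measurable_EFinP; apply: measurable_funM => //; apply: measurable_funM.
      exact: measurable_log_weight.
    by apply: measurable_funM; [exact: measurable_cst|exact: mt].
  - move=> t _; rewrite patchE -EFinM; case: ifPn => [|_]; last first.
      rewrite lee_fin !mulr_ge0 ?log_weight_ge0 ?(ltW d0) ?(ltW c0)//.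
      by have /andP[] := tent_itv (c * t + - (c * s)).
    rewrite inE /ball/= => /ltW tsd; rewrite lee_fin mulrCA ler_peMr ?log_weight_ge0//.
    rewrite mulrA (_ : 4 * d * c = 2); last by rewrite /c; field; rewrite gt_eqF.
    rewrite -ler_pdivrMl// mulr1 tent_ge// -mulrBr normrM gtr0_norm//.
    by rewrite -ler_pdivlMl// {1}/c invrK distrC (le_trans tsd)// /c; lra.
rewrite integralZl//.
rewrite -(@fineK _ (\int[leb]_t _)%E); last exact: integrable_fin_num i1.
rewrite -EFinM lee_fin -[fine _]/(\int[leb]_t (g t * (c * tent (c * t + - (c * s))))) /log_weight_bound.
move: key; move: (\int[leb]_t _) (_ + hbar h) => I C key.
by rewrite (_ : 2 * C * _ = 4 * d * C); [rewrite ler_wpM2l// mulr_ge0// ltW|rewrite mulr2n; ring].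
Qed.

(** The weak form of the monotonicity of [log_weight]: Pi >= 0 gives it for D with
    compact support, and cutoffs remove the restriction. *)
Lemma log_weight_monotone (D dD : R -> R) (K : R) :
  (forall s : R, is_derive s 1 D (dD s)) -> continuous dD ->
  (forall s, 0 <= s -> 0 <= D s <= K * Num.min s 1) ->
  (forall s, 0 <= s -> `|dD s| <= K) -> 0 <= \int[leb]_s (g s * dD s).
Proof.
move=> DdD cdD D0 dDK.
pose E n s := cutoff n s * D s; pose dE n s := cutoff n s * dD s + D s * dcutoff n s.
have EdE n (s : R) : is_derive s 1 (E n) (dE n s).
  exact: is_deriveM (is_derive_cutoff n s) (DdD s).
have cdE n : continuous (dE n).
  move=> s; apply: cvgD; apply: cvgM.
  - by apply: differentiable_continuous; apply/derivable1_diffP; case: (is_derive_cutoff n s).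
  - exact: cdD.
  - by apply: differentiable_continuous; apply/derivable1_diffP; case: (DdD s).
  - exact: continuous_dcutoff.
have bE n s : 0 <= s -> `|dE n s| <= 5 * K.
  move=> s0; have /andP[c0 c1] := cutoff_itv n s0; have /andP[D1 D2] := D0 s s0.
  have K0 : 0 <= K := le_trans (normr_ge0 _) (dDK s s0).
  rewrite (le_trans (ler_normD _ _))// (_ : 5 * K = K + K * 4); last by ring.
  rewrite lerD// normrM ger0_norm//.
    by rewrite (le_trans _ (dDK s s0))// ler_piMl.
  apply: (@le_trans _ _ (K * Num.min s 1 * `|dcutoff n s|)); first by rewrite ler_wpM2r.
  by rewrite -mulrA (mulrC (Num.min _ _)) ler_wpM2l// dcutoff_bound.
have ig := integrable_log_weight.
have F0 n : (0 <= \int[leb]_s (g s * dE n s)%:E)%E.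
  have := @integral_log_weight_test (E n) (dE n) n.+3%:R^-1 (n.+3%:R + 1) (EdE n) (cdE n).
  rewrite invr_gt0 ltr0n => /(_ isT) H.
  have {}H : \int[leb]_s (g s * dE n s) = \int[Pi]_(r in `]0, +oo[) E n r.
    by apply: H => x xI; rewrite /E cutoff_out ?mul0r.
  have : 0 <= \int[leb]_s (g s * dE n s).
    rewrite H; apply: Rintegral_ge0 => s /=; rewrite in_itv/= andbT => /ltW s0.
    by have /andP[? _] := cutoff_itv n s0; have /andP[? _] := D0 s s0; rewrite mulr_ge0.
  have iF : leb.-integrable [set: R] (EFin \o (fun s => g s * dE n s)).
    apply/integrableP; split.
      apply/measurable_EFinP; apply: measurable_funM; first exact: measurable_log_weight.
      exact: continuous_measurable_fun.
    apply: (@le_lt_trans _ _ (\int[leb]_s ((5 * K)%:E * (g s)%:E))%E).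
      apply: ge0_le_integral => //.
      - apply/measurable_EFinP; apply: measurableT_comp => //.
        apply: measurable_funM; first exact: measurable_log_weight.
        exact: continuous_measurable_fun.
      - by apply/measurable_EFinP; apply: measurable_funM => //; exact: measurable_log_weight.
      - move=> s _; rewrite -EFinM lee_fin normrM ger0_norm ?log_weight_ge0// mulrC.
        have [s0|s0] := leP s 0; first by rewrite log_weight0// !mulr0.
        by rewrite ler_wpM2r ?log_weight_ge0// bE// ltW.
    by rewrite integralZl// integral_log_weight -EFinM ltry.
  by rewrite /Rintegral -lee_fin fineK//; exact: integrable_fin_num iF.
have := @dominated_convergence _ _ _ leb setT measurableT
  (fun n s => (g s * dE n s)%:E) (fun s => (g s * dD s)%:E) (fun s => (g s * (5 * K))%:E).
case.
- move=> n; apply/measurable_EFinP; apply: measurable_funM; first exact: measurable_log_weight.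
  exact: continuous_measurable_fun.
- apply/measurable_EFinP; apply: measurable_funM; first exact: measurable_log_weight.
  exact: continuous_measurable_fun.
- apply/aeW => s _; apply: cvg_near_cst.
  have [s0|s0] := leP s 0; first by apply: nearW => n; rewrite log_weight0// !mul0r.
  have := near_cutoff s0; apply: filterS => n [c1 c2].
  by rewrite /dE c1 c2 mul1r mulr0 addr0.
- have := integrableZr measurableT (5 * K) ig; exact: eq_integrable.
- apply/aeW => s n _; rewrite abse_EFin lee_fin normrM ger0_norm ?log_weight_ge0//.
  have [s0|s0] := leP s 0; first by rewrite log_weight0// !mul0r.
  by rewrite ler_wpM2l ?log_weight_ge0// bE// ltW.
move=> _ _ cv; rewrite /Rintegral; apply: fine_ge0.
rewrite -(cvg_lim _ cv)//; apply: lime_ge; first by apply/cvg_ex; eexists; exact: cv.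
exact: nearW.
Qed.

(** Lebesgue differentiation of the averages bounded in [log_weight_ball]. *)
Lemma ae_log_weight_le : {ae leb, forall s, g s <= log_weight_bound}.
Proof.
have C0 : 0 <= log_weight_bound.
  rewrite /log_weight_bound mulr_ge0// addr_ge0 ?fine_ge0//.
  by apply: integral_ge0 => r _; rewrite lee_fin h_ge0.
have ig := integrable_log_weight.
have := lebesgue_differentiation (open_integrable_locally openT ig).
apply: (@filterS _ _ (ae_filter_ringOfSetsType leb)) => s ls; have [s0|s0] := leP s 0; first by rewrite log_weight0.
apply/ler_addgt0Pl => e e0.
have near_d : \forall d \near 0^'+, (davg g s d < e%:E)%E.
  have ne : nbhs (0%E : \bar R) [set x | (x < e%:E)%E].
    by apply: open_nbhs_nbhs; split; [exact: open_ereal_lt_ereal|rewrite /= lte_fin].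
  by move: ls; rewrite /lebesgue_pt => /(_ _ ne).
have [d [[d0 ds] de]] : exists d, ((0 < d) /\ (d < s / 2)) /\ (davg g s d < e%:E)%E.
  apply: (@filter_ex _ (0:R)^'+); apply: filterI => //.
  by apply: filterI; [exact: nbhs_right_gt|apply: nbhs_right_lt; rewrite divr_gt0].
have d20 : 0 < d *+ 2 by rewrite mulrn_wgt0.
have mB : measurable (ball s d : set (measurableTypeR R)) by exact: measurable_ball.
have mg : measurable_fun (ball s d : set (measurableTypeR R)) g.
  by apply: measurable_funTS; exact: measurable_log_weight.
have mgs : measurable_fun (ball s d : set (measurableTypeR R)) (fun t => `|g t - g s|).
  by apply: measurableT_comp => //; apply: measurable_funB.
rewrite -lee_fin -(@lee_pmul2r _ (d *+ 2)%:E)//.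
apply: (@le_trans _ _ (\int[leb]_(t in ball s d) ((g t)%:E + `|g t - g s|%:E))%E).
  rewrite -(lebesgue_measure_ball s (ltW d0)) -integral_cst//.
  apply: ge0_le_integral => //.
  - by move=> t _; rewrite lee_fin log_weight_ge0.
  - by apply/measurable_EFinP; apply: measurable_funD.
  - move=> t _; rewrite -EFinD lee_fin -lerBlDl distrC; exact: ler_norm.
rewrite ge0_integralD//; first last.
- exact/measurable_EFinP.
- exact/measurable_EFinP.
- by move=> t _; rewrite lee_fin log_weight_ge0.
rewrite EFinD addeC ge0_muleDl ?lee_fin ?(ltW e0)// leeD//; last first.
  by rewrite -EFinM log_weight_ball//; lra.
move: de; rewrite /davg /iavg lebesgue_measure_ball ?(ltW d0)// inver gt_eqF//.
by rewrite lte_pdivrMl// => /ltW; rewrite muleC; apply: le_trans.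
Qed.

End LogWeight.

(** * The Jacobi operator on polynomials and its minimum principle *)

Section PolynomialMinimum.
Context {R : realType}.
Implicit Types p q : {poly R}.

Lemma horner_ge0_right q (a b : R) : a < b ->
  (forall x, a < x < b -> 0 <= q.[x]) -> 0 <= q.[a].
Proof.
move=> ab H; rewrite leNgt; apply/negP => qa0.
have : \forall x \near a^'+, q.[x] < 0.
  apply: (@cvgr_lt _ _ _ _ (horner q) q.[a]) => //.
  by apply: cvg_at_right_filter; exact: continuous_horner.
move=> /(filterI (filterI (nbhs_right_gt a) (nbhs_right_lt ab)))/filter_ex[x [[ax xb]]].
by rewrite ltNge H// ax.
Qed.

Lemma horner_ge0_left q (a b : R) : b < a ->
  (forall x, b < x < a -> 0 <= q.[x]) -> 0 <= q.[a].
Proof.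
move=> ba H; have := @horner_ge0_right (q \Po (- 'X)) (- a) (- b).
rewrite horner_comp hornerN hornerX opprK ltrN2 => /(_ ba); apply.
by move=> x /andP[ax xb]; rewrite horner_comp hornerN hornerX H// ltrNr xb ltrNl ax.
Qed.

(** Divides p - p.[x0] by 'X - x0 once, then twice, and reads the signs of the quotients
    at x0. *)
Lemma horner_minimum p x0 : 0 < x0 <= 1 ->
  (forall x, x \in `[0, 1] -> p.[x0] <= p.[x]) ->
  p^`().[x0] <= 0 /\ (x0 < 1 -> p^`().[x0] = 0 /\ 0 <= p^`()^`().[x0]).
Proof.
move=> /andP[x00 x01] pmin.
have [r pr] : exists r, p - p.[x0]%:P = r * ('X - x0%:P).
  by apply/factor_theorem; rewrite /root !hornerE subrr.
have E : p = r * ('X - x0%:P) + p.[x0]%:P by rewrite -pr subrK.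
have dp : p^`() = r^`() * ('X - x0%:P) + r.
  by rewrite E derivD derivC addr0 derivM derivB derivX derivC subr0 mulr1.
have dx : p^`().[x0] = r.[x0] by rewrite dp !hornerE subrr mulr0 add0r.
have px x : x \in `[0, 1] -> 0 <= r.[x] * (x - x0).
  by move=> xI; have := pmin x xI; rewrite -subr_ge0 {1}E !hornerE addrK.
have d1 : p^`().[x0] <= 0.
  rewrite dx -oppr_ge0 -hornerN; apply: (horner_ge0_left x00) => x /andP[x0' xx0].
  rewrite hornerN oppr_ge0; have : x \in `[0, 1] by rewrite in_itv/= (ltW x0') (le_trans (ltW xx0)).
  by move/px; rewrite nmulr_lge0// subr_lt0.
split=> // x1.
have d2 : p^`().[x0] = 0.
  apply/eqP; rewrite eq_le d1/= dx; apply: (horner_ge0_right x1) => x /andP[xx0 x1'].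
  have : x \in `[0, 1] by rewrite in_itv/= (ltW x1') (ltW (lt_trans x00 xx0)).
  by move/px; rewrite pmulr_lge0// subr_gt0.
split => //.
have [r2 rr] : exists r2, r = r2 * ('X - x0%:P).
  by apply/factor_theorem; rewrite /root -dx d2.
have -> : p^`()^`().[x0] = 2 * r2.[x0].
  have dr : r^`() = r2^`() * ('X - x0%:P) + r2.
    by rewrite rr derivM derivB derivX derivC subr0 mulr1.
  have ddp : p^`()^`() = r^`()^`() * ('X - x0%:P) + r^`() + r^`().
    by rewrite {1}dp derivD derivM derivB derivX derivC subr0 mulr1.
  have dr0 : r^`().[x0] = r2.[x0] by rewrite dr hornerD hornerM hornerXsubC subrr mulr0 add0r.
  by rewrite ddp !hornerD hornerM hornerXsubC subrr mulr0 add0r dr0 mulr_natl mulr2n.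
rewrite mulr_ge0//; apply: (horner_ge0_right x1) => x /andP[xx0 x1'].
have : x \in `[0, 1] by rewrite in_itv/= (ltW x1') (ltW (lt_trans x00 xx0)).
by move/px; rewrite rr !hornerE -mulrA pmulr_lge0// mulr_gt0// subr_gt0.
Qed.

Lemma horner_lipschitz p : exists2 K : R, 0 <= K &
  forall x y, x \in `[0, 1] -> y \in `[0, 1] -> `|p.[x] - p.[y]| <= K * `|x - y|.
Proof.
elim/poly_ind: p => [|p c [K K0 H]].
  by exists 0 => // x y _ _; rewrite !horner0 subrr normr0 mul0r.
have [M M0 HM] := C01_bounded (@C01_horner _ p).
exists (K + M) => [|x y xI yI]; first by rewrite addr_ge0// ltW.
rewrite !hornerE (_ : _ - _ = (p.[x] - p.[y]) * x + p.[y] * (x - y)); last by ring.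
rewrite (le_trans (ler_normD _ _))// !normrM mulrDl lerD ?ler_wpM2r ?HM//.
rewrite (le_trans _ (H x y xI yI))// ler_piMr//.
by move: xI; rewrite in_itv/= ler_norml => /andP[? ->]; rewrite andbT (le_trans _ (_ : 0 <= x)).
Qed.

Lemma derive1_horner p : derive1 (horner p) = horner p^`().
Proof. by rewrite derivE. Qed.

End PolynomialMinimum.

Section JacobiPolynomials.
Context {R : realType}.
Local Notation leb := (@lebesgue_measure R).
Variables (lambda1 mu : R) (h : R -> R).
Variable Pi : {finite_measure set (measurableTypeR R) -> \bar R}.
Hypotheses (h_ge0 : forall r, 0 <= h r) (h_out : forall r, r <= 1 -> h r = 0).
Hypothesis h_int : leb.-integrable `]1, +oo[ (EFin \o h).
Hypothesis h_Pi : minus_derivative_measure h Pi.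
Hypotheses (mu_l1 : mu < lambda1) (hbar_mu : hbar h < mu).

(** The factors in J x^n = jacobi_lower n x^(n-1) - jacobi_eigenvalue n x^n. *)
Definition jacobi_lower (n : nat) : R := Psi mu h n%:R.
Definition jacobi_eigenvalue (n : nat) : R := n%:R * (n%:R - 1 + lambda1).
Local Notation a := jacobi_lower.
Local Notation th := jacobi_eigenvalue.

Lemma hbar_ge0 : 0 <= hbar h.
Proof. by apply: Rintegral_ge0 => r _. Qed.

Lemma jacobi_lowerE n : a n.+1 = n.+1%:R * (n%:R + mu - hmom h n).
Proof.
have E : \int[leb]_(r in `]1, +oo[) ((1 - r `^ (- n.+1%:R)) * h r) = hbar h - hmom h n.
  rewrite /hbar /hmom -RintegralB//; last exact: hmom_integrable.
  apply: eq_Rintegral => r; rewrite inE/= in_itv/= andbT => r1.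
  by rewrite powRN powR_mulrn ?(ltW (lt_trans ltr01 r1))// mulrBl mul1r exprVn mulrC.
rewrite /a /Psi E -natr1; ring.
Qed.

Lemma jacobi_eigenvalue0 : th 0 = 0. Proof. by rewrite /th mul0r. Qed.

Lemma lambda1_gt0_of_lt : 0 < lambda1.
Proof. exact: lt_trans (le_lt_trans hbar_ge0 hbar_mu) mu_l1. Qed.

Lemma jacobi_eigenvalueS n : th n.+1 = n.+1%:R * (n%:R + lambda1).
Proof. by rewrite /th -natr1; ring. Qed.

Lemma jacobi_eigenvalue_ge0 n : 0 <= th n.
Proof.
case: n => [|n]; first by rewrite jacobi_eigenvalue0.
by rewrite jacobi_eigenvalueS mulr_ge0// addr_ge0// ltW// lambda1_gt0_of_lt.
Qed.

Lemma jacobi_eigenvalue_lt : {homo th : m n / (m < n)%N >-> m < n}.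
Proof.
move=> m n; rewrite -(ler_nat R) -natr1 /th => mn; have := lambda1_gt0_of_lt.
have : 0 <= m%:R :> R by []. move: (m%:R : R) (n%:R : R) mn => x y ? ? ?.
rewrite -subr_gt0 (_ : _ - _ = (y - x) * (x + y - 1 + lambda1)); last by ring.
by rewrite mulr_gt0//; lra.
Qed.

Lemma jacobi_eigenvalue_inj : injective th.
Proof.
move=> m n mn; apply/eqP; case: ltngtP => // /jacobi_eigenvalue_lt; by rewrite mn ltxx.
Qed.

Lemma jacobi_lower_gt0 n : 0 < a n.+1.
Proof.
rewrite jacobi_lowerE mulr_gt0// -addrA ltr_wpDl// subr_gt0.
exact: le_lt_trans (hmom_le_hbar h_ge0 h_int n) hbar_mu.
Qed.

(** The integral term of the operator, coefficient by coefficient. *)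
Definition jump_part (p : {poly R}) : {poly R} :=
  \poly_(i < size p^`()) (p^`()`_i * hmom h i).

Lemma coef_jump_part p i : (jump_part p)`_i = p^`()`_i * hmom h i.
Proof. by rewrite coef_poly; case: ltnP => // ?; rewrite nth_default// mul0r. Qed.

Lemma shift_opE p : shift_op a th p =
  'X * (1 - 'X) * p^`()^`() - (lambda1 *: 'X - mu%:P) * p^`() - jump_part p.
Proof.
apply/polyP => i; rewrite coef_shift_op !coefB coef_jump_part.
rewrite -mulrA coefXM (mulrBl _ 1) mul1r coefB coefXM.
rewrite (_ : (lambda1 *: 'X - mu%:P) * p^`() = lambda1 *: ('X * p^`()) - mu%:P * p^`()); last first.
  by rewrite mulrBl scalerAl.
rewrite coefB coefZ coefXM coefCM !coef_deriv.
have e2 k : k.+2%:R = k%:R + 2 :> R by rewrite -addn2 natrD.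
have e3 k : k.+3%:R = k%:R + 3 :> R by rewrite -addn3 natrD.
case: i => [|[|i]] /=; rewrite jacobi_lowerE.
- by rewrite jacobi_eigenvalue0; move: p`_1 p`_0 (hmom h 0) => P1 P0 H; ring.
- by rewrite jacobi_eigenvalueS; move: p`_2 p`_1 (hmom h 1) => P2 P1 H; ring.
- rewrite jacobi_eigenvalueS; move: p`_i.+3 p`_i.+2 (hmom h i.+2) => P3 P2 H.
  rewrite -[P3 *+ _ *+ _]mulr_natr -[P3 *+ _]mulr_natr -[P2 *+ _ *+ _]mulr_natr -[P2 *+ _]mulr_natr.
  by rewrite e3 e2 -[i.+1%:R]natr1; move: (i%:R : R) => x; ring.
Qed.

Lemma Jacobi_op_horner p x : Jacobi_op lambda1 mu h (horner p) x = (shift_op a th p).[x].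
Proof.
rewrite /Jacobi_op /derive1n /= !derive1_horner shift_opE !hornerE.
congr (_ - _); rewrite horner_poly.
transitivity (\int[leb]_(r in `]1, +oo[)
    (\sum_(i < size p^`()) (p^`()`_i * x ^+ i) * (h r * r^-1 ^+ i.+1))).
  apply: eq_Rintegral => r _; rewrite horner_coef -mulrA mulr_suml mulr_sumr.
  by apply: eq_bigr => i _; rewrite exprMn exprSr; ring.
rewrite (@Rintegral_sum_expr _ _ _ leb `]1, +oo[ h _ _ (fun r => r^-1) _ _ _
  (fun i => p^`()`_i * x ^+ i) (fun i => i.+1))//.
- by apply: eq_bigr => i _; rewrite /hmom; ring.
- by apply: measurable_funTS; exact: measurable_invr.
- move=> r /=; rewrite in_itv/= andbT => r1.
  by rewrite normfV invf_le1 ?normr_gt0 ?gt_eqF ?(lt_trans ltr01)// (le_trans (ltW r1))// ler_norm.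
Qed.

(** D s = p (x0 e^-s) - p x0 is nonnegative and vanishes at 0, so its derivative has
    nonnegative integral against [log_weight] by [log_weight_monotone]. *)
Lemma jump_part_le0 p x0 : 0 < x0 <= 1 ->
  (forall x, x \in `[0, 1] -> p.[x0] <= p.[x]) -> (jump_part p).[x0] <= 0.
Proof.
move=> /andP[x00 x01] pmin.
have [L L0 HL] := horner_lipschitz p.
have [M M0 HM] := C01_bounded (@C01_horner _ p^`()).
pose D s := p.[x0 * expR (- s)] - p.[x0].
pose dD s := - (x0 * expR (- s) * p^`().[x0 * expR (- s)]).
have DdD (s : R) : is_derive s 1 D (dD s).
  have dE : is_derive s 1 (fun s => x0 * expR (- s)) (- (x0 * expR (- s))).
    by apply: is_derive_eq; rewrite /GRing.scale/=; ring.
  have dp : is_derive s 1 (fun s => p.[x0 * expR (- s)]) (dD s).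
    rewrite /dD -mulNr mulrC.
    exact: (@is_derive1_comp _ (horner p) (fun s => x0 * expR (- s)) s _ _ (is_derive_poly _ _) dE).
  by rewrite /D -[dD s]subr0; apply: is_deriveB.
have cdD : continuous dD.
  have cE : continuous (fun s : R => x0 * expR (- s)).
    move=> s; apply: cvgMr; apply: continuous_comp; [exact: continuousN|exact: continuous_expR].
  move=> s; apply: cvgN; apply: cvgM; first exact: cE.
  by apply: (@continuous_comp _ _ _ (fun s : R => x0 * expR (- s)) (horner p^`())); [exact: cE|exact: continuous_horner].
have eI (s : R) : 0 <= s -> x0 * expR (- s) \in `[0, 1].
  move=> s0; rewrite in_itv/= mulr_ge0 ?expR_ge0 ?(ltW x00)//= mulr_ile1 ?expR_ge0 ?(ltW x00)//.
  by rewrite -expR0 ler_expR oppr_le0.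
have xI : x0 \in `[0, 1] by rewrite in_itv/= (ltW x00).
have := @log_weight_monotone _ h h_ge0 h_out h_int Pi h_Pi D dD (L + M) DdD cdD.
have : \int[leb]_s (log_weight h s * dD s) = - x0 * (jump_part p).[x0].
  transitivity (\int[leb]_(s in `]0, +oo[) (\sum_(i < size p^`())
      (- (x0 * (p^`()`_i * x0 ^+ i))) * (log_weight h s * expR (- s) ^+ i.+1))).
    rewrite [RHS]Rintegral_mkcond; apply: eq_Rintegral => s _.
    rewrite patchE mem_setE in_itv/= andbT; case: ltP => [s0|/(log_weight0 h_out) ->]; last by rewrite mul0r.
    rewrite /dD horner_coef mulrN mulr_sumr mulr_sumr -sumrN; apply: eq_bigr => i _.
    by rewrite exprMn exprSr; ring.
  have ig : leb.-integrable `]0, +oo[ (EFin \o log_weight h).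
    exact: integrableS (integrable_log_weight h_ge0 h_out h_int).
  rewrite (@Rintegral_sum_expr _ _ _ leb `]0, +oo[ (log_weight h) _ ig (fun s => expR (- s)) _ _ _
    (fun i => - (x0 * (p^`()`_i * x0 ^+ i))) (fun i => i.+1))//.
  - rewrite horner_poly mulr_sumr; apply: eq_bigr => i _.
    rewrite (_ : \int[leb]_(s in _) _ = hmom h i); first by ring.
    rewrite Rintegral_mkcond (_ : _ \_ _ = (fun s => log_weight h s * expR (- s) ^+ i.+1)).
      by rewrite /Rintegral hmomE.
    apply/funext => s; rewrite patchE mem_setE in_itv/= andbT.
    by case: ltP => // /(log_weight0 h_out) ->; rewrite mul0r.
  - apply: measurable_funTS; apply: continuous_measurable_fun => s.
    by apply: continuous_comp; [exact: continuousN|exact: continuous_expR].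
  - move=> s /=; rewrite in_itv/= andbT => s0.
    by rewrite ger0_norm ?expR_ge0// -expR0 ler_expR oppr_le0 ltW.
move=> -> H.
suff : 0 <= - x0 * (jump_part p).[x0] by rewrite mulNr oppr_ge0 pmulr_rle0.
apply: H => s s0.
  rewrite subr_ge0 pmin ?eI//= (le_trans (ler_norm _))// (le_trans (HL _ _ (eI s s0) xI))//.
  have e1 : 0 <= 1 - expR (- s) by rewrite subr_ge0 -expR0 ler_expR oppr_le0.
  rewrite -[X in _ - X]mulr1 -mulrBr normrM distrC (gtr0_norm x00) (ger0_norm e1).
  apply: (@le_trans _ _ (L * (1 - expR (- s)))).
    by rewrite ler_wpM2l// ler_piMl.
  rewrite ler_pM ?lerDl ?(ltW M0)// le_min.
  have := expR_ge1Dx (- s); have := expR_ge0 (- s).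
  by move=> ? ?; apply/andP; split; lra.
rewrite normrN normrM (le_trans (_ : _ <= 1 * M))//.
  have := eI s s0; rewrite in_itv/= => /andP[? ?].
  by rewrite ler_pM// ?HM ?eI// ger0_norm.
by rewrite mul1r lerDr.
Qed.

(** At x0 = 0 only a_1 p'(0) remains; at x0 = 1 the diffusion vanishes and the drift
    points inwards because mu < lambda1; inside, p' vanishes and p'' >= 0. The jump
    part is controlled by [jump_part_le0]. *)
Lemma jacobi_minimum_principle p x0 : x0 \in `[0, 1] ->
  (forall x, x \in `[0, 1] -> p.[x0] <= p.[x]) -> 0 <= (shift_op a th p).[x0].
Proof.
rewrite in_itv/= => /andP[x00 x01] pmin.
move: x00; rewrite le_eqVlt => /predU1P[x00|x00].
  rewrite -x00 horner_coef0 coef_shift_op jacobi_eigenvalue0 mul0r subr0 mulr_ge0 ?(ltW (jacobi_lower_gt0 0))//.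
  have [r pr] : exists r, p - p.[0]%:P = r * 'X.
    have /factor_theorem[r] : root (p - p.[0]%:P) 0 by rewrite /root !hornerE subrr.
    by rewrite subr0 => ?; exists r.
  have -> : p`_1 = r.[0].
    have -> : p = r * 'X + p.[0]%:P by rewrite -pr subrK.
    by rewrite coefD coefC addr0 coefMX/= horner_coef0.
  apply: (horner_ge0_right ltr01) => x /andP[x0' x1].
  have xI : x \in `[0, 1] by rewrite in_itv/= !ltW.
  have := pmin x xI; rewrite -x00 -subr_ge0.
  have -> : p.[x] - p.[0] = r.[x] * x by rewrite -hornerMX -pr !hornerE.
  by rewrite pmulr_lge0.
have x0I : 0 < x0 <= 1 by rewrite x00.
have [d1 d2] := horner_minimum x0I pmin.
have jp := jump_part_le0 x0I pmin.
rewrite shift_opE !hornerE.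
move: x01; rewrite le_eqVlt => /predU1P[x1|x1].
  rewrite x1 in d1 jp *; rewrite subrr mulr0 mul0r sub0r mulr1 -mulNr.
  have : 0 <= - (lambda1 - mu) * p^`().[1] by rewrite mulNr oppr_ge0 pmulr_rle0// subr_gt0.
  lra.
have [-> d3] := d2 x1.
rewrite mulr0 subr0.
have : 0 <= x0 * (1 - x0) * p^`()^`().[x0] by rewrite !mulr_ge0// ?subr_ge0 ltW.
lra.
Qed.

End JacobiPolynomials.

(** * Existence of the invariant law *)

Section ProbabilityDensity.
Context d (T : measurableType d) {R : realType}.
Variables (mu : {measure set T -> \bar R}) (w : T -> R).
Hypotheses (mw : measurable_fun [set: T] w) (w0 : forall x, 0 <= w x).
Hypothesis w1 : (\int[mu]_x (w x)%:E = 1)%E.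

Let P := density_measure mu mw w0.
HB.instance Definition _ := Measure.on P.
Lemma density_measure_setT : P setT = 1%E. Proof. exact: w1. Qed.
HB.instance Definition _ := Measure_isProbability.Build _ _ _ P density_measure_setT.

Lemma probability_of_density : exists Q : probability T R,
  (forall A, Q A = \int[mu]_(x in A) (w x)%:E)%E /\
  forall f, measurable_fun [set: T] f -> (forall x, 0 <= f x)%E ->
    (\int[Q]_x f x = \int[mu]_x (f x * (w x)%:E))%E.
Proof. by exists P; split => // f mf f0; exact: ge0_integral_density. Qed.

End ProbabilityDensity.

Section InvariantLaw.
Context {R : realType}.
Local Notation leb := (@lebesgue_measure R).
Variables (lambda1 mu : R) (h : R -> R).
Variable Pi : {finite_measure set (measurableTypeR R) -> \bar R}.
Hypotheses (h_ge0 : forall r, 0 <= h r) (h_out : forall r, r <= 1 -> h r = 0).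
Hypothesis h_int : leb.-integrable `]1, +oo[ (EFin \o h).
Hypothesis h_Pi : minus_derivative_measure h Pi.
Hypotheses (mu_l1 : mu < lambda1) (hbar_mu : hbar h < mu).
Local Notation a := (jacobi_lower mu h).
Local Notation th := (jacobi_eigenvalue lambda1).
Local Notation g := (log_weight h).
Local Notation C := (log_weight_bound h Pi).

Let mu_gt0 : 0 < mu. Proof. exact: le_lt_trans (hbar_ge0 h_ge0) hbar_mu. Qed.

(** The kernel of the Volterra equation. The minimum changes it on a null set only, and
    provides the pointwise bound needed there. *)
Definition jump_tail s : R := expR (- s) * Num.min (g s) C.

Let C_ge0 : 0 <= C.
Proof. rewrite /log_weight_bound mulr_ge0// addr_ge0 ?fine_ge0//.
by apply: integral_ge0 => r _; rewrite lee_fin h_ge0. Qed.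

Let measurable_expN (c : R) : measurable_fun [set: R] (fun s : R => expR (- (c * s))).
Proof.
apply: continuous_measurable_fun => s; apply: continuous_comp; last exact: continuous_expR.
by apply: cvgN; apply: cvgMr; exact: cvg_id.
Qed.

Lemma measurable_jump_tail : measurable_fun [set: R] jump_tail.
Proof.
apply: measurable_funM.
  by have := measurable_expN 1; under eq_fun do rewrite mul1r.
by apply: measurable_minr => //; exact: measurable_log_weight.
Qed.

Lemma integral_jump_tail n :
  (\int[leb]_s (expR (- (n%:R * s)) * jump_tail s)%:E = (hmom h n)%:E)%E.
Proof.
rewrite -hmomE//; apply: ae_eq_integral => //.
- apply/measurable_EFinP; apply: measurable_funM; [exact: measurable_expN|exact: measurable_jump_tail].
- apply/measurable_EFinP; apply: measurable_funM; first exact: measurable_log_weight.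
  by apply: measurable_funX; have := measurable_expN 1; under eq_fun do rewrite mul1r.
- have := ae_log_weight_le h_ge0 h_out h_int h_Pi.
  apply: (@filterS _ _ (ae_filter_ringOfSetsType leb)) => s gs _.
  rewrite /jump_tail min_l// mulrA (mulrC (g s)) -expRM_natl -expRD; congr (_ * _)%:E.
  by congr expR; rewrite -natr1; ring.
Qed.

(** At p = n the balance equation is the recurrence of the moments. *)
Lemma exists_log_density : exists w : R -> R,
  [/\ measurable_fun [set: R] w, (forall t : R, t <= 0 -> w t = 0),
      (forall t : R, 0 < t -> 0 < w t), (forall t : R, 0 < t -> {for t, continuous w}) &
      exists2 I : R, 0 < I & forall n, (\int[leb]_t (expR (- (n%:R * t)) * w t)%:E =
        (I * eig_dual a th n 0)%:E)%E].
Proof.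
have gam_ge0 s : 0 <= jump_tail s by rewrite mulr_ge0 ?expR_ge0// le_min log_weight_ge0.
have gam_neg (s : R) : s <= 0 -> jump_tail s = 0.
  by move=> s0; rewrite /jump_tail log_weight0// min_l// mulr0.
have gam_le s : jump_tail s <= C * expR (- s).
  by rewrite /jump_tail [leRHS]mulrC ler_wpM2l ?expR_ge0// ge_min lexx orbT.
have gam_int : (\int[leb]_t (jump_tail t)%:E < mu%:E)%E.
  have := integral_jump_tail 0.
  under eq_integral do rewrite mul0r oppr0 expR0 mul1r.
  by move=> ->; rewrite lte_fin (le_lt_trans (hmom_le_hbar _ _ _)).
have [w [mw w0 wpos wc [wfin wrec]]] :=
  volterra_density mu_gt0 mu_l1 measurable_jump_tail gam_ge0 gam_neg gam_le gam_int.
have wge0 t : 0 <= w t by have [/w0 ->|/wpos/ltW] := leP t 0.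
exists w; split => //.
pose L n := (\int[leb]_t (expR (- (n%:R * t)) * w t)%:E)%E.
have Lge0 n : (0 <= L n)%E.
  by apply: integral_ge0 => t _; rewrite lee_fin mulr_ge0 ?expR_ge0.
have Lfin n : L n \is a fin_num.
  rewrite ge0_fin_numE//; apply: le_lt_trans wfin; apply: ge0_le_integral => //.
  - by move=> t _; rewrite lee_fin mulr_ge0 ?expR_ge0.
  - by apply/measurable_EFinP; apply: measurable_funM; [exact: measurable_expN|].
  - exact/measurable_EFinP.
  - move=> t _; rewrite lee_fin; have [/w0 ->|t0] := leP t 0; first by rewrite mulr0.
    by rewrite ler_piMl// -expR0 ler_expR oppr_le0 mulr_ge0// ltW.
have L0 : (L 0%N = \int[leb]_t (w t)%:E)%E.
  by apply: eq_integral => t _; rewrite mul0r oppr0 expR0 mul1r.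
exists (fine (L 0%N)) => [|n].
  rewrite fine_gt0// -ge0_fin_numE// Lfin andbT lt_neqAle Lge0 andbT eq_sym L0.
  apply/eqP => L00.
  have mw' : measurable_fun [set: R] (EFin \o w) by exact/measurable_EFinP.
  have := (ae_eq_integral_abs leb measurableT mw').1.
  rewrite (_ : (\int[leb]_(x in setT) _)%E = 0%E); last first.
    by rewrite -[RHS]L00; apply: eq_integral => t _; rewrite /= ger0_norm.
  move=> /(_ erefl)[N [mN N0 sN]].
  have : (leb `]0%R, 1%R[%classic <= leb N)%E.
    apply: le_measure; rewrite ?inE//; apply: subset_trans sN => t /=.
    rewrite in_itv/= => /andP[t0 _] /(_ I)[] wt0.
    by have := wpos t t0; rewrite wt0 ltxx.
  by rewrite N0 lebesgue_measure_itv/= lte_fin ltr01 oppr0 adde0 lee_fin ler10.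
rewrite -/(L n); elim: n => [|n ih].
  by rewrite /eig_dual big_geq// mulr1 fineK.
have := wrec n%:R (ler0n _ _).
have -> : (\int[leb]_t (expR (- ((n%:R + 1) * t)) * w t)%:E = L n.+1)%E.
  by rewrite /L -natr1.
rewrite -/(L n) integral_jump_tail ih -(fineK (Lfin n.+1)) -!EFinM -EFinD => -[] E.
congr EFin; rewrite /eig_dual big_nat_recr//= -/(eig_dual a th n 0).
have l1 : 0 < lambda1 := lt_trans mu_gt0 mu_l1.
have nl : n%:R + lambda1 != 0 by rewrite gt_eqF// ltr_wpDl.
have n1 : n.+1%:R != 0 :> R by [].
rewrite jacobi_lowerE// jacobi_eigenvalueS jacobi_eigenvalue0 subr0.
apply: (mulfI nl); move: E; move: (eig_dual _ _ _ _) (fine _) (fine _) (hmom _ _) => e i j k E.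
rewrite (_ : (n%:R + lambda1) * i = (n%:R + mu) * (j * e) - j * e * k); last by rewrite E; ring.
rewrite -[n.+1%:R * _ / _]mulf_div mulfV// mul1r.
by move: (n%:R : R) nl => x nl; field.
Qed.

(** The density w found above is carried to (0, 1) by x = exp (- t) and normalized. *)
Theorem exists_invariant_law : exists (beta : probability (measurableTypeR R) R) (f : R -> R),
  [/\ is_density beta f, {in `]0, 1[, continuous f}, {in `]0, 1[, forall x, 0 < f x},
      (forall x, x \notin `]0, 1[ -> f x = 0) &
      measurable_fun [set: R] f /\
      forall (D : set (measurableTypeR R)) n, measurable D ->
        `]0, 1[%classic `<=` D -> D `<=` `[0, +oo[%classic ->
        (\int[beta]_(x in D) (x ^+ n)%:E = (eig_dual a th n 0)%:E)%E].
Proof.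
have [w [mw w0 wpos wc [I I0 wmom]]] := exists_log_density.
have wge0 t : 0 <= w t by have [/w0 ->|/wpos/ltW] := leP t 0.
pose f x := if x \in `]0, 1[ then w (- ln x) / (x * I) else 0.
have f0 x : 0 <= f x.
  rewrite /f in_itv/=; case: ifP => // /andP[x0 x1].
  by rewrite divr_ge0// mulr_ge0// ltW.
have mf : measurable_fun [set: R] f.
  rewrite (_ : f = (fun x => w (- ln x) * (x * I)^-1) \_ `]0, 1[); last first.
    by apply/funext => x; rewrite patchE mem_setE.
  apply/(measurable_restrictT _ _).1 => //; apply: measurable_funTS.
  apply: measurable_funM.
    by apply: (measurableT_comp mw); apply: measurableT_comp => //; exact: measurable_ln.
  by apply: (measurableT_comp measurable_invr); apply: measurable_funM.
have tr (psi : R -> \bar R) : measurable_fun [set: R] psi -> (forall x, 0 <= psi x)%E ->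
    (\int[leb]_x (psi x * (f x)%:E) = \int[leb]_t (psi (expR (- t)) * (I^-1 * w t)%:E))%E.
  move=> mpsi psi0.
  transitivity (\int[leb]_(x in `]0%R, +oo[) (psi x * (f x)%:E))%E.
    rewrite [RHS]integral_mkcond; apply: eq_integral => x _.
    rewrite patchE mem_setE in_itv/= andbT; case: ltP => // x0.
    by rewrite /f in_itv/= ltNge x0/= mule0.
  rewrite ge0_integral_expRN; first last.
  - by move=> x; rewrite mule_ge0// lee_fin.
  - by apply: emeasurable_funM => //; exact/measurable_EFinP.
  apply: eq_integral => t _; rewrite muleCA -EFinM; congr (_ * _%:E)%E.
  rewrite /f in_itv/= expR_gt0/= expRK opprK -{1}expR0 ltr_expR oppr_lt0.
  case: ltP => [t0|/w0 ->]; last by rewrite !mulr0.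
  by field; rewrite !gt_eqF ?expR_gt0.
have f1 : (\int[leb]_x (f x)%:E = 1)%E.
  have := tr (cst 1%E) (measurable_cst _) (fun=> lee01).
  under eq_integral do rewrite mul1e; move=> ->.
  have := wmom 0%N; rewrite /eig_dual big_geq// mulr1 => H.
  under eq_integral do rewrite mul1e EFinM.
  have {}H : (\int[leb]_t (w t)%:E = I%:E)%E.
    by rewrite -H; apply: eq_integral => t _; rewrite mul0r oppr0 expR0 mul1r.
  rewrite ge0_integralZl//; first last.
  - by rewrite lee_fin invr_ge0 ltW.
  - by move=> t _; rewrite lee_fin.
  - exact/measurable_EFinP.
  by rewrite H -EFinM mulVf// gt_eqF.
have [beta [betaE betaI]] := @probability_of_density _ (measurableTypeR R) R leb f mf f0 f1.
exists beta, f; split.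
- by move=> A mA; exact: betaE.
- move=> x x01; have := x01; rewrite in_itv/= => /andP[x0 x1].
  have fE : {near nbhs x, (fun x => w (- ln x) / (x * I)) =1 f}.
    have : nbhs x `]0, 1[%classic by apply: near_in_itvoo.
    by apply: filterS => y y01; rewrite /f y01.
  rewrite /continuous_at (_ : f x = w (- ln x) / (x * I)); last by rewrite /f x01.
  apply: cvg_trans; first exact: (near_eq_cvg fE).
  apply: cvgM; last first.
    by apply: cvgV; [rewrite mulf_neq0// gt_eqF|apply: cvgMl; exact: cvg_id].
  apply: (@continuous_comp _ _ _ (fun x => - ln x) w); last by apply: wc; rewrite oppr_gt0 ln_lt0// x0.
  by apply: cvgN; exact: continuous_ln.
- move=> x x01; rewrite /f x01; move: x01; rewrite in_itv/= => /andP[x0 x1].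
  by rewrite divr_gt0 ?mulr_gt0// wpos// oppr_gt0 ln_lt0// x0.
- by move=> x /negbTE xn; rewrite /f xn.
split => // D n mD D1 D2.
pose psi := (fun x : R => (x ^+ n)%:E) \_ D.
have mpsi : measurable_fun [set: R] psi.
  apply/(measurable_restrictT _ _).1 => //; apply: measurable_funTS.
  by apply/measurable_EFinP; exact: measurable_funX.
have psi0 x : (0 <= psi x)%E.
  rewrite /psi patchE; case: ifPn => //; rewrite inE => /D2/=.
  by rewrite in_itv/= andbT lee_fin => x0; rewrite exprn_ge0.
rewrite integral_mkcond betaI// tr//.
transitivity (\int[leb]_t (I^-1%:E * (expR (- (n%:R * t)) * w t)%:E))%E.
  apply: eq_integral => t _; have [t0|t0] := leP t 0.
    by rewrite w0// !mulr0 !mule0.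
  rewrite /psi patchE mem_set/=; last first.
    by apply: D1 => /=; rewrite in_itv/= expR_gt0 -expR0 ltr_expR oppr_lt0.
  by rewrite -expRM_natl -!EFinM mulrN mulrCA.
rewrite ge0_integralZl//; first last.
- by rewrite lee_fin invr_ge0 ltW.
- by move=> t _; rewrite lee_fin mulr_ge0 ?expR_ge0.
- by apply/measurable_EFinP; apply: measurable_funM; [exact: measurable_expN|].
by rewrite wmom -EFinM mulKf// gt_eqF.
Qed.

End InvariantLaw.

(** * Measures on [0,1]: determinacy and support *)

Section MeasuresOn01.
Context {R : realType}.
Implicit Types nu : probability (measurableTypeR R) R.
Local Notation D01 := (`[0%R, 1%R]%classic : set (measurableTypeR R)).

Lemma measurable_D01 : measurable D01. Proof. exact: measurable_itv. Qed.
Hint Resolve measurable_D01 : core.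

Lemma C01_measurable (f : R -> R) : C01 f -> measurable_fun D01 f.
Proof. by move=> cf; exact: subspace_continuous_measurable_fun. Qed.

Lemma bounded_integrable nu (f : R -> R) (M : R) : measurable_fun D01 f ->
  (forall x, x \in `[0, 1] -> `|f x| <= M) -> nu.-integrable D01 (EFin \o f).
Proof.
move=> mf fM; apply: measurable_bounded_integrable => //.
  by rewrite ltey_eq fin_num_measure.
by exists M; split; rewrite ?num_real// => N MN x /fM; move/le_trans; apply; exact: ltW.
Qed.

Lemma C01_integrable nu (f : R -> R) : C01 f -> nu.-integrable D01 (EFin \o f).
Proof.
move=> cf; have [M _ fM] := C01_bounded cf.
exact: (bounded_integrable _ (C01_measurable cf) fM).
Qed.

Lemma Rintegral_C01_dist nu f g (e : R) : C01 f -> C01 g ->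
  (forall x, x \in `[0, 1] -> `|f x - g x| <= e) ->
  `|\int[nu]_(x in D01) f x - \int[nu]_(x in D01) g x| <= e.
Proof.
move=> cf cg fg; rewrite -RintegralB//; [|exact: C01_integrable|exact: C01_integrable].
have cfg := C01B cf cg.
have ifg := C01_integrable nu cfg.
apply: (le_trans (le_normr_Rintegral _ ifg)) => //.
have e0 : 0 <= e by apply: le_trans (fg 0 _); rewrite // in_itv/= lexx ler01.
apply: (@le_trans _ _ (\int[nu]_(x in D01) cst e x)).
  apply: le_Rintegral => //; first exact: integrable_norm.
  exact: (C01_integrable nu (@C01_cst R e)).
rewrite Rintegral_cst// ler_piMr// -lee_fin fineK ?fin_num_measure//.
exact: probability_le1.
Qed.

(** The indicators of half-lines are pointwise limits of bounded continuous functions. *)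
Lemma probability01_unique nu1 nu2 : nu1 D01 = 1%E -> nu2 D01 = 1%E ->
  (forall f, C01 f -> \int[nu1]_(x in D01) f x = \int[nu2]_(x in D01) f x) ->
  forall A : set (measurableTypeR R), measurable A -> nu1 A = nu2 A.
Proof.
move=> n11 n21 H.
have full nu (A : set (measurableTypeR R)) : nu D01 = 1%E -> measurable A -> nu A = nu (A `&` D01).
  move=> n1 mA; rewrite -[in LHS](setIT A) -(setUv D01) setIUr measureU//; first last.
  - by rewrite setIACA setICr setI0.
  - by apply: measurableI => //; exact: measurableC.
  - exact: measurableI.
  rewrite [X in (_ + X)%E](_ : _ = 0%E) ?adde0 ?setIT//.
  apply: (@subset_measure0 _ _ _ _ _ (~` D01)) => //.
  - by apply: measurableI => //; exact: measurableC.
  - exact: measurableC.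
  - apply: etrans (@probability_setC _ _ _ nu _ measurable_D01) _.
    by rewrite n1 subee.
apply: (@measure_unique _ _ (measurableTypeR R) (@RGenOInfty.G R) (fun n => `]- n%:R, +oo[%classic) _ _ _ _ nu1 nu2).
- exact: RGenOInfty.measurableE.
- move=> _ _ [x ->] [y ->]; exists (Num.max x y).
  by apply/seteqP; split => z /=; rewrite !in_itv/= !andbT gt_max; [case=> -> ->|move/andP].
- by move=> n; exists (- n%:R).
- apply/seteqP; split => // x _; exists (Num.truncn `|x|).+1 => //=.
  rewrite in_itv/= andbT ltrNl (le_lt_trans (ler_norm _))// normrN; exact: truncnS_gt.
- move=> _ [c ->].
  have mc : measurable (`]c, +oo[%classic : set (measurableTypeR R)) by [].
  apply: etrans (full nu1 _ n11 mc) _; apply: etrans _ (esym (full nu2 _ n21 mc)).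
  pose u k x : R := smoothstep (k%:R * x + - (k%:R * c + 1)).
  have cu k : continuous (u k).
    move=> x; apply: differentiable_continuous; apply/derivable1_diffP.
    by case: (is_derive_affine k%:R (- (k%:R * c + 1)) x (@is_derive_smoothstep R)).
  have u01 k x : 0 <= u k x <= 1 by exact: smoothstep_itv.
  have lim nu : (\int[nu]_(x in D01) (u k x)%:E)%E @[k --> \oo] --> nu (`]c, +oo[ `&` D01).
    rewrite -integral_indic//.
    have := @dominated_convergence _ _ _ nu D01 measurable_D01 (fun k x => (u k x)%:E)
      (fun x => (\1_(`]c, +oo[%classic) x)%:E) (cst 1%E).
    case=> //.
    - move=> k; apply/measurable_EFinP; apply: measurable_funTS; exact: continuous_measurable_fun.
    - by apply/measurable_EFinP; apply: measurable_funTS; exact: measurable_indic.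
    - apply/aeW => x _; apply: cvg_near_cst; near=> k.
      rewrite indicE; have [cx|xc] := ltP c x.
        rewrite mem_set/=; last by rewrite in_itv/= cx.
        congr EFin; rewrite /u smoothstep1//.
        rewrite opprD addrA -mulrBr lerBrDr -ler_pdivrMr ?subr_gt0//.
        by near: k; exact: nbhs_infty_ger.
      rewrite memNset/=; last by rewrite in_itv/= andbT; apply/negP; rewrite -leNgt.
      congr EFin; rewrite /u smoothstep0// opprD addrA -mulrBr gerDr.
      by rewrite mulr_ge0_le0// subr_le0.
    - exact: (C01_integrable nu (@C01_cst R 1)).
    - by apply/aeW => x k _; rewrite lee_fin; have /andP[? ?] := u01 k x; rewrite ger0_norm.
  have E k : (\int[nu1]_(x in D01) (u k x)%:E = \int[nu2]_(x in D01) (u k x)%:E)%E.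
    have ck : C01 (u k) by apply: continuous_subspaceT; exact: cu.
    rewrite -[LHS]fineK ?(integrable_fin_num _ (C01_integrable nu1 ck))//.
    rewrite -[RHS]fineK ?(integrable_fin_num _ (C01_integrable nu2 ck))//.
    by congr EFin; exact: H.
  have := lim nu1; under eq_fun do rewrite E.
  by move=> l1; exact: (cvg_unique _ l1 (lim nu2)).
- by move=> n; rewrite ltey_eq fin_num_measure.
Unshelve. all: by end_near. Qed.

Lemma Rintegral_horner nu p : \int[nu]_(x in D01) p.[x] =
  \sum_(i < size p) p`_i * \int[nu]_(x in D01) (x ^+ i).
Proof.
have i1 : nu.-integrable D01 (EFin \o cst 1) := C01_integrable nu (@C01_cst R 1).
transitivity (\int[nu]_(x in D01) (\sum_(i < size p) p`_i * (cst 1 x * x ^+ i))).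
  apply: eq_Rintegral => x _; rewrite horner_coef; apply: eq_bigr => i _.
  by rewrite mul1r.
rewrite (@Rintegral_sum_expr _ _ _ nu D01 (cst 1) _ i1 id _ _ _ (fun i => p`_i) (fun i => i))//.
- by apply: eq_bigr => i _; congr (_ * _); apply: eq_Rintegral => x _; rewrite mul1r.
- by move=> x /=; rewrite in_itv/= => /andP[? ?]; rewrite ger0_norm.
Qed.

Lemma eq_moments_C01 nu1 nu2 :
  (forall n, \int[nu1]_(x in D01) (x ^+ n) = \int[nu2]_(x in D01) (x ^+ n)) ->
  forall f, C01 f -> \int[nu1]_(x in D01) f x = \int[nu2]_(x in D01) f x.
Proof.
move=> H f cf; apply/eqP; rewrite -subr_eq0 -normr_le0.
apply/ler_addgt0Pl => e e0; rewrite addr0.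
have e20 : 0 < e / 2 by rewrite divr_gt0.
have [p fp] := approx01_ex cf e20.
have cp := @C01_horner _ p.
have h1 := Rintegral_C01_dist nu1 cf cp fp; have h2 := Rintegral_C01_dist nu2 cf cp fp.
have E : \int[nu1]_(x in D01) p.[x] = \int[nu2]_(x in D01) p.[x].
  by rewrite !Rintegral_horner; apply: eq_bigr => i _; rewrite H.
rewrite E in h1; rewrite -(subrK (\int[nu2]_(x in D01) p.[x]) (\int[nu1]_(x in _) _)) -addrA.
by rewrite (le_trans (ler_normD _ _))// [leRHS]splitr lerD// distrC.
Qed.

(** Bounded moments force the mass of (1, oo) to vanish. *)
Lemma Stieltjes_moments_supp m nu : Stieltjes_moments m nu -> (forall n, m n <= 1) ->
  nu D01 = 1%E /\ forall n, \int[nu]_(x in D01) (x ^+ n) = m n.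
Proof.
move=> [n1 mm] m1.
have mxn n (D : set (measurableTypeR R)) : measurable D -> measurable_fun D (fun x : R => (x ^+ n)%:E).
  by move=> mD; apply: measurable_funTS; apply/measurable_EFinP; exact: measurable_funX.
have m0 : measurable (`[0%R, +oo[%classic : set (measurableTypeR R)) by [].
have z : nu `]1%R, +oo[%classic = 0%E.
  have zk k : nu `[1 + k.+1%:R^-1, +oo[%classic = 0%E.
    set c := 1 + _; have c1 : 1 < c by rewrite ltrDl.
    have mc : measurable (`[c, +oo[%classic : set (measurableTypeR R)) by [].
    have H n : (nu `[c, +oo[%classic * (c ^+ n)%:E <= 1)%E.
      rewrite muleC -integral_cst//.
      apply: (@le_trans _ _ (\int[nu]_(x in `[0%R, +oo[) (x ^+ n)%:E)%E); last by rewrite mm lee_fin.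
      apply: (@le_trans _ _ (\int[nu]_(x in `[c, +oo[) (x ^+ n)%:E)%E).
        apply: ge0_le_integral => //.
        - by move=> x _; rewrite lee_fin exprn_ge0// ltW// (lt_trans ltr01).
        - exact: mxn.
        - move=> x /=; rewrite in_itv/= andbT => cx; rewrite lee_fin lerXn2r// nnegrE.
            by rewrite ltW// (lt_trans ltr01).
          by rewrite (le_trans _ cx)// ltW// (lt_trans ltr01).
      apply: ge0_subset_integral => //.
      - exact: mxn.
      - by move=> x /=; rewrite in_itv/= andbT => x0; rewrite lee_fin exprn_ge0.
      - by move=> x /=; rewrite !in_itv/= !andbT; apply: le_trans; rewrite ltW// (lt_trans ltr01).
    have nf : nu `[c, +oo[%classic \is a fin_num by rewrite fin_num_measure.
    apply/eqP; rewrite -(fineK nf) eqe eq_le fine_ge0// andbT.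
    have {}H n : fine (nu `[c, +oo[%classic) * c ^+ n <= 1.
      by rewrite -lee_fin EFinM fineK.
    rewrite leNgt; apply/negP => p0.
    have : \forall n \near \oo, c ^- n < fine (nu `[c, +oo[%classic).
      apply: (@cvgr_lt _ _ _ _ (fun n => c ^- n) 0) => //.
      under eq_fun do rewrite -exprVn.
      by apply: cvg_expr; rewrite ger0_norm ?invr_ge0 ?invf_lt1// ?ltW// (lt_trans ltr01).
    move=> /filter_ex[n]; rewrite -[c ^- n]mul1r ltr_pdivrMr ?exprn_gt0 ?(lt_trans _ c1)//.
    by rewrite ltNge H.
  have : (nu `]1%R, +oo[%classic <= \sum_(k <oo) nu `[(1 + k.+1%:R^-1)%R, +oo[%classic)%E.
    apply: measure_sigma_subadditive => //.
    move=> x /=; rewrite in_itv/= andbT => x1.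
    exists (Num.truncn (x - 1)^-1) => //=; rewrite in_itv/= andbT.
    rewrite -lerBrDl invf_ple ?posrE ?subr_gt0//.
    exact/ltW/truncnS_gt.
  by rewrite eseries0 => [|k _ _]; [|exact: zk]; move=> ?; apply/eqP; rewrite eq_le measure_ge0 andbT.
have U : `[0%R, +oo[%classic = D01 `|` `]1%R, +oo[%classic :> set (measurableTypeR R).
  apply/seteqP; split => x /=; rewrite !in_itv/= !andbT.
    by move=> x0; case: (lerP x 1) => x1; [left; rewrite x0|right].
  by case=> [/andP[]//|/ltW]; apply: le_trans.
have dis : D01 `&` `]1%R, +oo[%classic = set0.
  by apply/seteqP; split => x //= []; rewrite !in_itv/= andbT => /andP[_ x1]; rewrite ltNge x1.
split=> [|n].
  have := n1; rewrite U => <-; have -> := @measureU _ _ _ nu _ _ measurable_D01 (measurable_itv _) dis.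
  by apply/esym; apply: etrans (adde0 _); congr (_ + _)%E; exact: z.
apply: EFin_inj; rewrite -mm U integral_setU//; first last.
- exact/disj_set2P.
- by rewrite -U; exact: mxn.
rewrite [X in (_ + X)%E](null_set_integral _ _ z)//; last exact: mxn.
by rewrite adde0 /Rintegral fineK// integrable_fin_num//; apply: C01_integrable; rewrite -(_ : horner 'X^n = fun x => x ^+ n); [exact: C01_horner|apply/funext => x; rewrite hornerXn].
Qed.

Lemma density_support (beta : probability (measurableTypeR R) R) f : is_density beta f ->
  measurable_fun [set: R] f -> {in `]0, 1[, forall x, 0 < f x} ->
  (forall x, x \notin `]0, 1[ -> f x = 0) -> beta `<< @lebesgue_measure R /\
  msupport beta = `[0, 1]%classic.
Proof.
move=> df mf fpos f0.
have fge0 x : 0 <= f x by case: (boolP (x \in `]0, 1[)) => [/fpos/ltW|/f0 ->].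
split.
  move=> N N0 A mA AN; rewrite df// null_set_integral//; last exact: N0.
  by apply: measurable_funTS; exact/measurable_EFinP.
apply/seteqP; split => x /=.
  apply: contraPP => xn /(_ (~` `[0, 1]%classic)) H.
  have : (0 < beta (~` D01))%E by apply: H => //; apply: closed_openC; exact: interval_closed.
  rewrite df; last exact: measurableC.
  rewrite integral0_eq ?ltxx// => y /= yn; rewrite f0//; apply/negP.
  by rewrite in_itv/= => /andP[y0 y1]; apply: yn; rewrite /= in_itv/= !ltW.
rewrite in_itv/= => /andP[x0 x1] U oU Ux.
have [a [b [ab aI]]] : exists a b : R, a < b /\ `]a, b[%classic `<=` U `&` `]0, 1[%classic.
  have /nbhs_ballP[e /= e0 eU] : nbhs x U by apply: open_nbhs_nbhs; split.
  exists (Num.max 0 (x - e)), (Num.min 1 (x + e)); split.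
    by rewrite gt_max !lt_min ltr01; apply/andP; split; apply/andP; split; lra.
  move=> y /=; rewrite in_itv/= gt_max lt_min => /andP[/andP[y0 y1] /andP[y2 y3]].
  by split; [apply: eU; rewrite /ball/= ltr_distlC y1|rewrite in_itv/= y0].
have mU : measurable (U : set (measurableTypeR R)) by exact: open_measurable.
rewrite lt_neqAle measure_ge0 andbT eq_sym; apply/eqP => U0.
have mI : measurable (`]a, b[%classic : set (measurableTypeR R)) by [].
have : beta `]a, b[%classic = 0%E.
  apply/eqP; rewrite eq_le measure_ge0 andbT -U0.
  by apply: le_measure; rewrite ?inE// => y /aI[].
rewrite df// => I0.
have mf' : measurable_fun `]a, b[%classic (EFin \o f) by apply: measurable_funTS; exact/measurable_EFinP.
have := (ae_eq_integral_abs (@lebesgue_measure R) mI mf').1.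
rewrite (_ : (\int[_]_(x in _) _)%E = 0%E); last first.
  by rewrite -[RHS]I0; apply: eq_integral => t _; rewrite /= ger0_norm.
move=> /(_ erefl)[N [mN N0 sN]].
have : (@lebesgue_measure R `]a, b[%classic <= @lebesgue_measure R N)%E.
  apply: le_measure; rewrite ?inE//; apply: subset_trans sN => t tI /(_ tI) [] ft0.
  by have [_ /fpos] := aI t tI; rewrite ft0 ltxx.
rewrite N0 lebesgue_measure_itv/= lte_fin ab -EFinB lee_fin subr_le0.
by rewrite leNgt ab.
Qed.

End MeasuresOn01.

(** * The norm of L2 *)

Section L2Norm.
Context {R : realType} (beta : probability (measurableTypeR R) R).
Implicit Types f g u v : R -> R.
Local Notation L2 := (L2 beta).
Local Notation l2norm := (l2norm beta).
Local Notation D01 := (`[0%R, 1%R]%classic : set (measurableTypeR R)).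

Definition nrm2 f : R := fine (l2norm f).

Lemma l2norm_ge0 f : (0 <= l2norm f)%E. Proof. exact: Lnorm_ge0. Qed.

Lemma nrm2_ge0 f : 0 <= nrm2 f. Proof. by rewrite fine_ge0// l2norm_ge0. Qed.

Lemma L2P f : L2 f <-> measurable_fun [set: R] f /\ (l2norm f < +oo)%E.
Proof.
split; first by move=> /andP[]; rewrite !inE.
by move=> [mf lf]; apply/andP; rewrite !inE.
Qed.

Lemma L2_measurable f : L2 f -> measurable_fun [set: R] f. Proof. by case/L2P. Qed.

Lemma l2normE f : L2 f -> l2norm f = (nrm2 f)%:E.
Proof.
move=> /L2P[_ lf]; rewrite /nrm2 fineK// ge0_fin_numE//; exact: l2norm_ge0.
Qed.

Lemma integral_sqr_ge0 f : (0 <= \int[beta]_x (f x ^+ 2)%:E)%E.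
Proof. by apply: integral_ge0 => x _; rewrite lee_fin sqr_ge0. Qed.

Lemma l2norm_le f (M : R) : 0 <= M ->
  (l2norm f <= M%:E)%E = (\int[beta]_x (f x ^+ 2)%:E <= (M ^+ 2)%:E)%E.
Proof.
move=> M0; have := @poweR_Lnorm _ _ _ beta (EFin \o f) 2 _.
rewrite pnatr_eq0 => /(_ isT).
have -> : (\int[beta]_x (`|(EFin \o f) x| `^ 2) = \int[beta]_x (f x ^+ 2)%:E)%E.
  by apply: eq_integral => x _; rewrite /= powR_mulrn// real_normK// num_real.
move=> <-; have := l2norm_ge0 f; rewrite /l2norm; case: ('N[_]_ _ [_])%E => [r r0| _|//].
  by rewrite /= !lee_fin powR_mulrn// ler_sqr.
by rewrite /= pnatr_eq0.
Qed.

Lemma nrm2_le f (M : R) : L2 f -> 0 <= M ->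
  (nrm2 f <= M) = (\int[beta]_x (f x ^+ 2)%:E <= (M ^+ 2)%:E)%E.
Proof. by move=> lf M0; rewrite -l2norm_le// l2normE. Qed.

Lemma nrm2_sqr f : L2 f -> (\int[beta]_x (f x ^+ 2)%:E = (nrm2 f ^+ 2)%:E)%E.
Proof.
move=> lf; apply/eqP; rewrite eq_le -nrm2_le ?nrm2_ge0// lexx/=.
have i1 : (\int[beta]_x (f x ^+ 2)%:E \is a fin_num)%E.
  rewrite ge0_fin_numE ?integral_sqr_ge0//; have := lexx (nrm2 f).
  rewrite [X in X = true -> _](nrm2_le lf) ?nrm2_ge0// => /le_lt_trans; apply; exact: ltry.
rewrite -(fineK i1) lee_fin; set I := fine _.
have I0 : 0 <= I by rewrite fine_ge0// integral_sqr_ge0.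
rewrite -(sqr_sqrtr I0) lerXn2r ?nnegrE ?nrm2_ge0 ?sqrtr_ge0//.
by rewrite nrm2_le ?sqrtr_ge0// sqr_sqrtr// fineK.
Qed.

Lemma L2D f g : L2 f -> L2 g -> L2 (f + g).
Proof.
move=> /L2P[mf lf] /L2P[mg lg]; apply/L2P; split; first exact: measurable_funD.
apply: (@le_lt_trans _ _ (l2norm f + l2norm g)%E); last by rewrite lte_add_pinfty.
by apply: minkowski_EFin => //; rewrite ler1n.
Qed.

Lemma L2N f : L2 f -> L2 (- f).
Proof.
move=> /L2P[mf lf]; apply/L2P; split; first exact: measurable_funN.
by move: lf; rewrite /l2norm -(oppe_Lnorm beta (EFin \o f)).
Qed.

Lemma L2B f g : L2 f -> L2 g -> L2 (f - g).
Proof. by move=> lf lg; apply: L2D => //; exact: L2N. Qed.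

Lemma l2norm_bounded f (M : R) : measurable_fun [set: R] f -> (forall x, `|f x| <= M) ->
  (l2norm f <= M%:E)%E.
Proof.
move=> mf fM; have M0 : 0 <= M by apply: le_trans (fM 0).
rewrite l2norm_le//.
apply: (@le_trans _ _ (\int[beta]_x (cst (M ^+ 2)%:E x))%E).
  apply: ge0_le_integral => //.
  - by move=> x _; rewrite lee_fin sqr_ge0.
  - by apply/measurable_EFinP; exact: measurable_funX.
  - by move=> x _; rewrite lee_fin -real_normK ?num_real// lerXn2r// nnegrE.
apply: (@le_trans _ _ ((M ^+ 2)%:E * 1)%E); last by rewrite mule1.
rewrite integral_cst//; apply: lee_wpmul2l; [by rewrite lee_fin sqr_ge0|exact: probability_le1].
Qed.

Lemma L2_bounded f (M : R) : measurable_fun [set: R] f -> (forall x, `|f x| <= M) -> L2 f.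
Proof.
by move=> mf fM; apply/L2P; split => //; exact: le_lt_trans (l2norm_bounded mf fM) (ltry M).
Qed.

Lemma nrm2_bounded f (M : R) : measurable_fun [set: R] f -> (forall x, `|f x| <= M) -> nrm2 f <= M.
Proof.
move=> mf fM; rewrite -lee_fin -l2normE; first exact: l2norm_bounded.
exact: L2_bounded mf fM.
Qed.

Lemma L2Z (c : R) f : L2 f -> L2 (c *: f).
Proof.
move=> lf; have := @Lfun_scale _ _ _ beta f c 2 _ lf.
rewrite ler1n => /(_ isT).
by rewrite (_ : c \o* f = c *: f)//; apply/funext => x; rewrite /= mulrC.
Qed.

Lemma nrm2D f g : L2 f -> L2 g -> nrm2 (f + g) <= nrm2 f + nrm2 g.
Proof.
move=> lf lg; rewrite -lee_fin EFinD -!l2normE//; last exact: L2D.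
by apply: minkowski_EFin; [exact: L2_measurable|exact: L2_measurable|rewrite ler1n].
Qed.

Lemma nrm2Z (c : R) f : L2 f -> nrm2 (c *: f) = `|c| * nrm2 f.
Proof.
move=> lf; have lcf := L2Z c lf.
apply/eqP; rewrite -(@eqrXn2 _ 2) ?nrm2_ge0 ?mulr_ge0 ?nrm2_ge0//; apply/eqP.
apply: EFin_inj; rewrite -nrm2_sqr// exprMn EFinM -nrm2_sqr//.
rewrite -ge0_integralZl//; first last.
- by move=> x _; rewrite lee_fin sqr_ge0.
- by apply/measurable_EFinP; apply: measurable_funX; exact: L2_measurable.
apply: eq_integral => x _; rewrite -EFinM real_normK ?num_real//.
by rewrite [(c *: f) x]/(c * f x) exprMn.
Qed.

Lemma nrm2N f : nrm2 (- f) = nrm2 f.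
Proof.
rewrite /nrm2 /l2norm; congr fine; rewrite -(oppe_Lnorm beta (EFin \o f)).
by congr Lnorm.
Qed.

Lemma nrm2_distC f g : nrm2 (f - g) = nrm2 (g - f).
Proof. by rewrite -nrm2N opprB. Qed.

Lemma nrm2_dist_le g f v : L2 f -> L2 g -> L2 v -> nrm2 (f - v) <= nrm2 (f - g) + nrm2 (g - v).
Proof.
move=> lf lg lv; rewrite (_ : f - v = (f - g) + (g - v)); last by rewrite addrA subrK.
by apply: nrm2D; exact: L2B.
Qed.

Lemma nrm2_ae f g : L2 f -> L2 g -> f = g %[ae beta] -> nrm2 f = nrm2 g.
Proof.
move=> lf lg fg.
apply/eqP; rewrite -(@eqrXn2 _ 2) ?nrm2_ge0//; apply/eqP.
apply: EFin_inj; rewrite -!nrm2_sqr//; apply: ae_eq_integral => //.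
- by apply/measurable_EFinP; apply: measurable_funX; exact: L2_measurable.
- by apply/measurable_EFinP; apply: measurable_funX; exact: L2_measurable.
- by apply: (@filterS _ _ (ae_filter_ringOfSetsType beta)) fg => x fgx _; rewrite fgx.
Qed.

Lemma nrm2_eq0 f : L2 f -> nrm2 f = 0 -> f = cst 0 %[ae beta].
Proof.
move=> lf f0; have : l2norm f = 0%E by rewrite l2normE// f0.
have mf : measurable_fun [set: measurableTypeR R] (EFin \o f).
  by apply/measurable_EFinP; exact: L2_measurable.
move=> H0; have := Lnorm_eq0_eq0 mf (lte0n 2) H0.
by apply: (@filterS _ _ (ae_filter_ringOfSetsType beta)) => x /(_ I) [] ->.
Qed.

Lemma ae_eq_nrm2 f g : L2 f -> L2 g -> (forall e : R, 0 < e -> nrm2 (f - g) <= e) ->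
  f = g %[ae beta].
Proof.
move=> lf lg H; have /nrm2_eq0 : L2 (f - g) by exact: L2B.
have -> : nrm2 (f - g) = 0.
  apply/eqP; rewrite eq_le nrm2_ge0 andbT; apply/ler_addgt0Pl => e e0; rewrite addr0; exact: H.
move=> /(_ erefl); apply: (@filterS _ _ (ae_filter_ringOfSetsType beta)) => x h hT.
by apply/eqP; rewrite -subr_eq0; apply/eqP; exact: h.
Qed.

Lemma L2_cst (c : R) : L2 (cst c).
Proof. by apply: (@L2_bounded (cst c) `|c|) => //; exact: measurable_cst. Qed.

Lemma nrm2_0 : nrm2 (cst 0) = 0.
Proof.
apply/eqP; rewrite eq_le nrm2_ge0 andbT; apply: (@nrm2_bounded (cst 0) 0).
  exact: measurable_cst.
by move=> x; rewrite normr0.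
Qed.

Lemma nrm2_dist_ae f g : L2 f -> L2 g -> f = g %[ae beta] -> nrm2 (f - g) = 0.
Proof.
move=> lf lg fg; rewrite (@nrm2_ae _ (cst 0)); [exact: nrm2_0|exact: L2B|exact: L2_cst|].
by apply: (@filterS _ _ (ae_filter_ringOfSetsType beta)) fg => x h hT; rewrite !fctE h// subrr.
Qed.

Lemma L2_integrable f : L2 f -> beta.-integrable [set: R] (EFin \o f).
Proof.
move=> lf; apply/Lfun1_integrable; apply: Lfun_subset12 => //.
exact: fin_num_measure.
Qed.

Lemma integral_norm_le_nrm2 f : L2 f -> (\int[beta]_x `|f x|%:E <= (nrm2 f)%:E)%E.
Proof.
move=> lf; have mf := L2_measurable lf.
have := @hoelder _ _ _ beta f (cst 1) 2 2 mf (measurable_cst _).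
have h2 : 2^-1 + 2^-1 = 1 :> R by field.
rewrite !ltr0n => /(_ isT isT h2); rewrite Lnorm1.
rewrite (_ : (\int[_]_x _)%E = \int[beta]_x `|f x|%:E)%E; last first.
  by apply: eq_integral => x _; rewrite /= mulr1.
move/le_trans; apply; rewrite -l2normE// -[leRHS]mule1 lee_wpmul2l ?l2norm_ge0//.
rewrite (l2norm_le (cst 1) ler01) (_ : (\int[_]_x _)%E = \int[beta]_x cst 1%E x)%E; last first.
  by apply: eq_integral => x _; rewrite /= expr1n.
by rewrite integral_cst// mul1e expr1n; exact: probability_le1.
Qed.

Lemma Rintegral_le_nrm2 f : L2 f -> `|\int[beta]_x f x| <= nrm2 f.
Proof.
move=> lf; apply: (le_trans (le_normr_Rintegral _ (L2_integrable lf))) => //.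
rewrite -lee_fin; apply: le_trans (integral_norm_le_nrm2 lf).
rewrite /Rintegral fineK//; apply: integrable_fin_num => //.
exact: integrable_norm (L2_integrable lf).
Qed.

End L2Norm.

(** * Completeness of L2 and density of polynomials *)

Section L2Complete.
Context {R : realType} (beta : probability (measurableTypeR R) R).
Implicit Types f g u v : R -> R.
Local Notation L2 := (L2 beta).
Local Notation nrm2 := (nrm2 beta).

Lemma limn_einf_le (u : (\bar R)^nat) (M : \bar R) :
  (forall n, u n <= M)%E -> (limn_einf u <= M)%E.
Proof.
move=> uM; rewrite limn_einf_lim; apply: lime_le; first exact: is_cvg_einfs.
apply: nearW => n; apply: le_trans (uM n); apply: ereal_inf_lbound.
by exists n => /=.
Qed.

(** A fast Cauchy sequence converges almost everywhere, because the total variation of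
   the sequence is integrable; Fatou then bounds the distance to the limit. *)
Lemma L2_complete (f : nat -> R -> R) : (forall n, L2 (f n)) ->
  (forall n, nrm2 (f n.+1 - f n) <= 2^-1 ^+ n) ->
  exists2 g, L2 g & forall n, nrm2 (f n - g) <= 2 * 2^-1 ^+ n.
Proof.
move=> lf df.
have mf n : measurable_fun [set: measurableTypeR R] (f n) := L2_measurable (lf n).
pose d n (x : R) : R := `|f n.+1 x - f n x|.
have d0 n x : (0 <= (d n x)%:E)%E by rewrite lee_fin normr_ge0.
have ld n : L2 (f n.+1 - f n) by exact: L2B.
have md n : measurable_fun [set: measurableTypeR R] (fun x => (d n x)%:E).
  by apply/measurable_EFinP; apply: measurableT_comp; [exact: normr_measurable|exact: measurable_funB (mf n.+1) (mf n)].
pose G x := (\sum_(n <oo) (d n x)%:E)%E.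
have mG : measurable_fun [set: measurableTypeR R] G.
  by apply: (@ge0_emeasurable_sum _ _ _ setT (fun n x => (d n x)%:E) predT) => // n _; exact: md.
have GE : (\int[beta]_x G x <= 2%:E)%E.
  rewrite integral_nneseries//.
  apply: lime_le; first by apply: is_cvg_ereal_nneg_natsum => n _; exact: integral_ge0.
  apply: nearW => n.
  apply: (@le_trans _ _ (\sum_(0 <= k < n) (2^-1 ^+ k)%:E)%E).
    apply: lee_sum => k _; apply: (le_trans (integral_norm_le_nrm2 (ld k))).
    by rewrite lee_fin.
  rewrite sumEFin lee_fin.
  have -> : \sum_(0 <= k < n) (2^-1 : R) ^+ k = 2 - 2 * 2^-1 ^+ n.
    elim: n => [|n ih]; first by rewrite big_geq// expr0 mulr1 subrr.
    by rewrite big_nat_recr//= ih exprS; field.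
  by rewrite gerBl mulr_ge0// exprn_ge0.
have iG : beta.-integrable [set: measurableTypeR R] G.
  apply/integrableP; split => //; apply: le_lt_trans (ltry 2).
  apply: le_trans GE; rewrite le_eqVlt; apply/orP; left; apply/eqP.
  by apply: eq_integral => x _; rewrite gee0_abs// nneseries_ge0.
pose g x := fine (limn_esup (fun n => (f n x)%:E)).
have mg : measurable_fun [set: measurableTypeR R] g.
  apply: measurableT_comp; first exact: fine_measurable.
  by apply: measurable_fun_limn_esup => n; exact/measurable_EFinP.
have cv : {ae beta, forall x, f n x @[n --> \oo] --> g x}.
  have := integrable_ae measurableT iG.
  apply: (@filterS _ _ (ae_filter_ringOfSetsType beta)) => x /(_ I) Gx.
  have c1 : cvgn [normed series (fun n => f n.+1 x - f n x)].
    apply: nondecreasing_is_cvgn.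
      by apply/nondecreasing_seqP => n; rewrite /normed_series_of !seriesEnat/= big_nat_recr//= lerDl.
    exists (fine (G x)) => _ [n _ <-]; rewrite -lee_fin fineK// /normed_series_of seriesEnat/= -sumEFin.
    by apply: nneseries_lim_ge => k _ _; rewrite lee_fin.
  have c2 := normed_cvg c1.
  have c3 : cvgn (fun n => f n x).
    have /cvg_ex[l sl] := c2; apply/cvg_ex; exists (l + f 0%N x).
    rewrite (_ : (fun n => f n x) = (fun n => series (fun n => f n.+1 x - f n x) n + f 0%N x)).
      by apply: cvgD => //; exact: cvg_cst.
    by apply/funext => n; rewrite seriesEnat/= telescope_sumr// subrK.
  have /cvg_ex[l fl] := c3.
  have El : (f n x)%:E @[n --> \oo] --> l%:E by apply: cvg_EFin; [exact: nearW|exact: fl].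
  by rewrite /g (cvg_limn_einf_sup El).2.
have dist n m : nrm2 (f n - f (n + m)%N) <= 2 * 2^-1 ^+ n - 2 * 2^-1 ^+ (n + m).
  elim: m => [|m ih]; first by rewrite addn0 !subrr nrm2_0.
  rewrite addnS; apply: (le_trans (nrm2_dist_le (lf n) (lf (n + m)%N) (lf _))).
  rewrite (nrm2_distC _ (f (n + m)%N)); apply: (le_trans (lerD ih (df _))).
  by rewrite exprS le_eqVlt; apply/orP; left; apply/eqP; field.
have key n : (\int[beta]_x ((f n - g) x ^+ 2)%:E <= ((2 * 2^-1 ^+ n) ^+ 2)%:E)%E.
  pose F m x := (((f n - f (n + m)%N) x) ^+ 2)%:E.
  have mF m : measurable_fun [set: measurableTypeR R] (F m).
    by apply/measurable_EFinP; apply: measurable_funX; exact: measurable_funB.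
  have F0 m x : [set: measurableTypeR R] x -> (0 <= F m x)%E by rewrite lee_fin sqr_ge0.
  have := fatou beta measurableT mF F0.
  rewrite (_ : (\int[beta]_(x in _) limn_einf _)%E = (\int[beta]_x ((f n - g) x ^+ 2)%:E)%E).
    move/le_trans; apply; apply: limn_einf_le => m.
    rewrite -nrm2_le; [|exact: L2B|by rewrite mulr_ge0// exprn_ge0].
    by apply: (le_trans (dist n m)); rewrite gerBl mulr_ge0// exprn_ge0.
  apply: ae_eq_integral => //.
  - rewrite /limn_einf; apply: measurableT_comp => //; apply: measurable_fun_limn_esup => m.
    by apply: measurableT_comp => //; exact: mF.
  - by apply/measurable_EFinP; apply: measurable_funX; exact: measurable_funB.
  - apply: (@filterS _ _ (ae_filter_ringOfSetsType beta)) cv => x fx _.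
    apply: (cvg_limn_einf_sup _).1; apply: cvg_EFin; first exact: nearW.
    have h : (f n - f (n + m)%N) x @[m --> \oo] --> (f n - g) x.
      apply: cvgB; first exact: cvg_cst.
      by apply: cvg_comp fx; exact: cvg_addnl.
    rewrite (_ : fine \o _ = (fun m => (f n - f (n + m)%N) x * (f n - f (n + m)%N) x))//.
    by rewrite expr2; exact: (cvgM h h).
have lfg n : L2 (f n - g).
  apply/L2P; split; first exact: (measurable_funB (mf n) mg).
  apply: le_lt_trans (ltry (2 * 2^-1 ^+ n)); rewrite l2norm_le ?key// mulr_ge0// exprn_ge0.
exists g => [|n]; last by rewrite nrm2_le// mulr_ge0// exprn_ge0.
have := L2B (lf 0%N) (lfg 0%N); congr (_ _ _).
by apply/funext => x; rewrite !fctE; ring.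
Qed.

End L2Complete.

Section PolynomialsDense.
Context {R : realType} (beta : probability (measurableTypeR R) R).
Implicit Types f g u v : R -> R.
Local Notation L2 := (L2 beta).
Local Notation nrm2 := (nrm2 beta).
Local Notation D01 := (`[0%R, 1%R]%classic : set (measurableTypeR R)).
Hypothesis beta01 : beta D01 = 1%E.

Lemma on01_measurable f : C01 f -> measurable_fun [set: R] (on01 f).
Proof.
by move=> cf; apply/(measurable_restrictT _ _).1; [exact: measurable_D01|exact: C01_measurable].
Qed.

Lemma on01E f x : x \in `[0, 1] -> on01 f x = f x.
Proof. by move=> xI; rewrite /on01 patchE mem_setE xI. Qed.

Lemma on01_bound f (M : R) : 0 <= M -> (forall x, x \in `[0, 1] -> `|f x| <= M) ->
  forall x, `|on01 f x| <= M.
Proof.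
move=> M0 fM x; rewrite /on01 patchE mem_setE; case: ifPn => [/fM//|_].
by rewrite [X in `|X|](_ : _ = 0)// normr0.
Qed.

Lemma L2_on01 f : C01 f -> L2 (on01 f).
Proof.
move=> cf; have [M M0 fM] := C01_bounded cf.
exact: (@L2_bounded _ beta _ M (on01_measurable cf) (on01_bound (ltW M0) fM)).
Qed.

Lemma nrm2_on01 f (M : R) : C01 f -> 0 <= M ->
  (forall x, x \in `[0, 1] -> `|f x| <= M) -> nrm2 (on01 f) <= M.
Proof. by move=> cf M0 fM; exact: nrm2_bounded (on01_measurable cf) (on01_bound M0 fM). Qed.

Lemma on01B f g : on01 f - on01 g = on01 (f - g).
Proof.
by apply/funext => x; rewrite !fctE /on01 !patchE; case: ifP => // _; rewrite subrr.
Qed.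

Lemma on01D f g : on01 f + on01 g = on01 (f + g).
Proof.
by apply/funext => x; rewrite !fctE /on01 !patchE; case: ifP => // _; rewrite addr0.
Qed.

Lemma on01Z (c : R) f : c *: on01 f = on01 (c *: f).
Proof.
apply/funext => x; rewrite [LHS]/(c * on01 f x) /on01 !patchE; case: ifP => // _.
exact: mulr0.
Qed.

Definition l2approx f := forall e : R, 0 < e -> exists p : {poly R}, nrm2 (f - on01 (horner p)) <= e.

Lemma L2_horner p : L2 (on01 (horner p)). Proof. exact: L2_on01 (@C01_horner _ p). Qed.

Lemma l2approx_C01 f : C01 f -> l2approx (on01 f).
Proof.
move=> cf e e0; have [p fp] := approx01_ex cf e0; exists p.
rewrite on01B; apply: nrm2_on01 => //; last exact: ltW.
exact: C01B cf (@C01_horner _ p).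
Qed.

Lemma l2approx_lim f : L2 f ->
  (forall e : R, 0 < e -> exists g, [/\ L2 g, l2approx g & nrm2 (f - g) <= e]) -> l2approx f.
Proof.
move=> lf H e e0; have e20 : 0 < e / 2 by rewrite divr_gt0.
have [g [lg ag fg]] := H _ e20; have [p gp] := ag _ e20; exists p.
apply: (le_trans (nrm2_dist_le lf lg (L2_horner p))).
by rewrite [leRHS]splitr lerD.
Qed.

Lemma l2approxD f g : L2 f -> L2 g -> l2approx f -> l2approx g -> l2approx (f + g).
Proof.
move=> lf lg af ag e e0; have e20 : 0 < e / 2 by rewrite divr_gt0.
have [p fp] := af _ e20; have [q gq] := ag _ e20; exists (p + q).
rewrite (_ : f + g - _ = (f - on01 (horner p)) + (g - on01 (horner q))).
  apply: (le_trans (nrm2D (L2B lf (L2_horner p)) (L2B lg (L2_horner q)))).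
  by rewrite [leRHS]splitr lerD.
rewrite addrACA -opprD on01D; congr (_ - on01 _).
by apply/funext => x; rewrite hornerD.
Qed.

Lemma l2approxZ (c : R) f : L2 f -> l2approx f -> l2approx (c *: f).
Proof.
move=> lf af e e0; have c0 : 0 < `|c| + 1 by rewrite ltr_wpDl.
have [p fp] := af (e / (`|c| + 1)) (divr_gt0 e0 c0); exists (c *: p).
rewrite (_ : c *: f - _ = c *: (f - on01 (horner p))).
  rewrite nrm2Z; last exact: L2B lf (L2_horner p).
  move: fp; rewrite ler_pdivlMr// => fp; apply: le_trans fp.
  by rewrite mulrC ler_wpM2l ?nrm2_ge0// lerDl.
rewrite scalerBr on01Z; congr (_ - on01 _).
by apply/funext => x; rewrite hornerZ.
Qed.

Lemma l2approx_ae f g : L2 f -> L2 g -> f = g %[ae beta] -> l2approx g -> l2approx f.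
Proof.
move=> lf lg fg ag; apply: l2approx_lim => // e e0; exists g; split => //.
by rewrite nrm2_dist_ae// ltW.
Qed.

Lemma ae_D01 : {ae beta, forall x, x \in `[0, 1]}.
Proof.
exists (~` D01); split.
- by apply: measurableC; exact: measurable_D01.
- apply: etrans (@probability_setC _ _ _ beta _ measurable_D01) _.
  by rewrite beta01 subee.
- by move=> x.
Qed.

Lemma L2_indic (A : set (measurableTypeR R)) : measurable A -> L2 (\1_A).
Proof.
move=> mA; apply: (@L2_bounded _ _ _ 1); first exact: measurable_indic.
by move=> x; rewrite indicE ger0_norm// lern1 leq_b1.
Qed.

Lemma L2_le u v : measurable_fun [set: R] u -> (forall x, `|u x| <= `|v x|) -> L2 v -> L2 u.
Proof.
move=> mu uv lv; apply/L2P; split => //; apply: le_lt_trans (ltry (nrm2 v)).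
rewrite l2norm_le ?nrm2_ge0// -nrm2_sqr//; apply: ge0_le_integral => //.
- by move=> x _; rewrite lee_fin sqr_ge0.
- by apply/measurable_EFinP; exact: measurable_funX.
- by apply/measurable_EFinP; apply: measurable_funX; exact: (L2_measurable lv).
- move=> x _; rewrite lee_fin -(real_normK (num_real (u x))) -(real_normK (num_real (v x))).
  by rewrite lerXn2r// nnegrE.
Qed.

Lemma nrm2_dominated (u : nat -> R -> R) v (e : R) : (forall n, measurable_fun [set: R] (u n)) ->
  L2 v -> (forall n x, `|u n x| <= `|v x|) ->
  (forall x, u n x @[n --> \oo] --> (0 : R)) -> 0 < e -> exists n, nrm2 (u n) <= e.
Proof.
move=> mu lv uv u0 e0.
have lu n : L2 (u n) := L2_le (mu n) (uv n) lv.
have mv : measurable_fun [set: measurableTypeR R] v := L2_measurable lv.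
have := @dominated_convergence _ _ _ beta setT measurableT (fun n x => (u n x ^+ 2)%:E)
  (cst 0%E) (fun x => (v x ^+ 2)%:E).
case.
- by move=> n; apply/measurable_EFinP; apply: measurable_funX; exact: mu.
- exact: measurable_cst.
- apply/aeW => x _; apply: cvg_EFin; first exact: nearW.
  rewrite (_ : fine \o _ = (fun n => u n x * u n x))// -(mulr0 (0 : R)).
  exact: (cvgM (u0 x) (u0 x)).
- apply/integrableP; split; first by apply/measurable_EFinP; exact: measurable_funX.
  have -> : (\int[beta]_x `|(v x ^+ 2)%:E| = \int[beta]_x (v x ^+ 2)%:E)%E.
    by apply: eq_integral => x _; rewrite /= ger0_norm ?sqr_ge0.
  by rewrite nrm2_sqr ?ltry.
- apply/aeW => x n _; rewrite /= lee_fin ger0_norm ?sqr_ge0//.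
  rewrite -(real_normK (num_real (u n x))) -(real_normK (num_real (v x))).
  by rewrite lerXn2r// nnegrE.
move=> _ _; rewrite integral_cst// mul0e => cv.
have : nbhs (0%E : \bar R) [set x | (x < (e ^+ 2)%:E)%E].
  by apply: open_nbhs_nbhs; split; [exact: open_ereal_lt_ereal|rewrite /= lte_fin exprn_gt0].
move=> /cv H; have [n /= un] := @filter_ex _ (\oo : set_system nat) _ _ H; exists n.
by rewrite nrm2_le// ltW.
Qed.

Lemma l2approx_sum (I : Type) (r : seq I) (u : I -> R -> R) : (forall i, L2 (u i)) ->
  (forall i, l2approx (u i)) -> L2 (\sum_(i <- r) u i) /\ l2approx (\sum_(i <- r) u i).
Proof.
move=> lu au; elim: r => [|i r [ih1 ih2]]; last first.
  by rewrite big_cons; split; [exact: L2D|exact: l2approxD].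
rewrite big_nil; split; first exact: L2_cst.
move=> e e0; exists 0; rewrite (_ : 0 - _ = cst 0) ?nrm2_0 ?ltW//.
apply/funext => x; rewrite !fctE /on01 patchE; case: ifP => _; rewrite ?horner0 subr0//.
Qed.

(** The sets whose indicator is approximable form a Dynkin system containing the
    half-lines, which are closed under intersection. *)
Lemma l2approx_indic (A : set (measurableTypeR R)) : measurable A -> l2approx (\1_A).
Proof.
have P1 : l2approx (cst 1).
  apply: (@l2approx_ae _ (on01 (cst 1))).
  - exact: L2_cst.
  - exact: L2_on01 (@C01_cst R 1).
  - apply: (@filterS _ _ (ae_filter_ringOfSetsType beta)) ae_D01 => x xI _.
    by rewrite on01E.
  - exact: l2approx_C01 (@C01_cst R 1).
have E : @measurable _ (measurableTypeR R) = <<s @RGenOInfty.G R >> := RGenOInfty.measurableE R.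
rewrite E.
move: A; apply: (@dynkin_induction _ (measurableTypeR R) (@RGenOInfty.G R) (fun A : set (measurableTypeR R) => l2approx (\1_A : R -> R))).
- exact: RGenOInfty.measurableE.
- move=> _ _ [x ->] [y ->]; exists (Num.max x y).
  by apply/seteqP; split => z /=; rewrite !in_itv/= !andbT gt_max; [case=> -> ->|move/andP].
- by rewrite indicT.
- move=> _ [c ->].
  have mc : measurable (`]c, +oo[%classic : set (measurableTypeR R)) by [].
  pose w k x : R := smoothstep (k%:R * x + - (k%:R * c + 1)).
  have cw k : continuous (w k).
    move=> x; apply: differentiable_continuous; apply/derivable1_diffP.
    by case: (is_derive_affine k%:R (- (k%:R * c + 1)) x (@is_derive_smoothstep R)).
  have cwI k : C01 (w k) by apply: continuous_subspaceT; exact: cw.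
  apply: l2approx_lim => [|e e0]; first exact: L2_indic.
  pose I1 : R -> R := \1_(`]c, +oo[ `&` D01).
  have mI1 : measurable (`]c, +oo[ `&` D01 : set (measurableTypeR R)).
    by apply: measurableI => //; exact: measurable_D01.
  have mu k : measurable_fun [set: R] (I1 - on01 (w k)).
    exact: (measurable_funB (L2_measurable (L2_indic mI1)) (on01_measurable (cwI k))).
  have I1E x : x \in `[0, 1] -> I1 x = (c < x)%R%:R.
    move=> xI; rewrite /I1 indicE; congr (_%:R); congr nat_of_bool.
    by apply/idP/idP => [|cx]; rewrite ?inE /= in_itv/= andbT; [case|split].
  have uE k x : (I1 - on01 (w k)) x = if x \in `[0, 1] then (c < x)%R%:R - w k x else 0.
    rewrite !fctE; case: ifPn => xI; first by rewrite I1E// on01E.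
    rewrite /on01 patchE mem_setE (negbTE xI) subr0 /I1 indicE memNset// => -[_].
    exact/negP.
  have u1 k x : `|(I1 - on01 (w k)) x| <= `|cst (1 : R) x|.
    rewrite uE normr1; case: ifP => _; last by rewrite normr0.
    have := smoothstep_itv (k%:R * x + - (k%:R * c + 1)).
    rewrite /w; move: (smoothstep _) => y /andP[? ?].
    by case: (c < x); rewrite ler_norml /=; apply/andP; split; lra.
  have u0 x : (I1 - on01 (w k)) x @[k --> \oo] --> (0 : R).
    apply: cvg_near_cst; near=> k; rewrite uE; case: ifP => // _.
    have [cx|xc] := ltP c x.
      rewrite /w smoothstep1 ?subrr// opprD addrA -mulrBr lerBrDr -ler_pdivrMr ?subr_gt0//.
      by near: k; exact: nbhs_infty_ger.
    by rewrite /w smoothstep0 ?subr0// opprD addrA -mulrBr gerDr mulr_ge0_le0// subr_le0.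
  have [n un] := nrm2_dominated mu (L2_cst beta 1) u1 u0 e0.
  exists (on01 (w n)); split; [exact: L2_on01|exact: l2approx_C01|].
  apply: le_trans un; rewrite le_eqVlt; apply/orP; left; apply/eqP; apply: nrm2_ae.
  - by apply: L2B; [exact: L2_indic|exact: L2_on01].
  - by apply: L2B; [exact: L2_indic|exact: L2_on01].
  - apply: (@filterS _ _ (ae_filter_ringOfSetsType beta)) ae_D01 => x xI _.
    rewrite !fctE I1E// indicE; congr (_%:R - _); congr nat_of_bool.
    by apply/idP/idP => [|cx]; rewrite ?inE /= in_itv/= andbT.
- move=> S mS aS; rewrite (_ : \1_(~` S) = cst 1 + (-1) *: \1_S); last first.
    apply/funext => x; rewrite [RHS]/(1 + -1 * \1_S x) !indicE in_setC mulN1r.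
    have E2 (b : bool) : (~~ b)%:R = 1 - b%:R :> R by case: b; rewrite ?subrr ?subr0.
    exact: E2.
  apply: l2approxD; [exact: L2_cst|by apply: L2Z; exact: L2_indic|exact: P1|].
  by apply: l2approxZ => //; exact: L2_indic.
- move=> F mF tF aF.
  pose A := \bigcup_k F k; have mA : measurable A by exact: bigcupT_measurable.
  apply: l2approx_lim => [|e e0]; first exact: L2_indic.
  pose S n : R -> R := \sum_(i <- index_iota 0 n) \1_(F i).
  have LS n : L2 (S n) /\ l2approx (S n) by apply: l2approx_sum => i; [exact: L2_indic|exact: aF].
  have SE n x : S n x = (x \in \bigcup_(k < n) F k)%:R.
    rewrite /S fct_sumE; have [xA|xA] := boolP (x \in _).
      move: xA; rewrite inE => -[k /= kn Fkx].
      rewrite (bigD1_seq k) ?mem_index_iota ?iota_uniq//= indicE mem_set// big1 ?addr0// => i ik.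
      rewrite indicE memNset// => Fix; move/eqP : ik; apply.
      by apply: tF => //; exists x.
    rewrite big1_seq// => i /=; rewrite mem_index_iota => /andP[_ i_n].
    rewrite indicE memNset// => Fix; move/negP : xA; apply.
    by rewrite inE; exists i.
  have mu n : measurable_fun [set: R] (\1_A - S n).
    exact: (measurable_funB (L2_measurable (L2_indic mA)) (L2_measurable (LS n).1)).
  have sub n x : x \in \bigcup_(k < n) F k -> x \in A by rewrite !inE => -[k _ Fkx]; exists k.
  have u1 n x : `|(\1_A - S n) x| <= `|cst (1 : R) x|.
    rewrite !fctE SE indicE normr1; case: (boolP (x \in \bigcup_(k < n) F k)) => [/sub ->|_].
      by rewrite subrr normr0.
    by rewrite subr0; case: (x \in A); rewrite ?normr1 ?normr0.
  have u0 x : (\1_A - S n) x @[n --> \oo] --> (0 : R).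
    apply: cvg_near_cst; have [xA|xA] := boolP (x \in A); last first.
      apply: nearW => n; rewrite !fctE SE indicE (negbTE xA).
      by case: (boolP (x \in \bigcup_(k < n) F k)) => [/sub|_]; rewrite ?(negbTE xA)// subr0.
    have := xA; rewrite inE => -[k _ Fkx].
    near=> n; rewrite !fctE SE indicE xA mem_set ?subrr//; exists k => //=.
    by near: n; exact: nbhs_infty_gt.
  have [n un] := nrm2_dominated mu (L2_cst beta 1) u1 u0 e0.
  by exists (S n); split => //; case: (LS n).
Unshelve. all: by end_near. Qed.

Import HBNNSimple.

(** Simple functions are dense, and their level sets have approximable indicators. *)
Lemma polynomials_dense f : L2 f -> l2approx f.
Proof.
suff pos g : L2 g -> (forall x, 0 <= g x) -> l2approx g.
  move=> lf; pose fp x := Num.max (f x) 0; pose fm x := Num.max (- f x) 0.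
  have lp : L2 fp.
    apply: (L2_le _ _ lf); first by apply: measurable_maxr => //; exact: (L2_measurable lf).
    by move=> x; rewrite /fp; case: (leP (f x) 0) => // _; rewrite normr0.
  have lm : L2 fm.
    apply: (L2_le _ _ lf).
      by apply: measurable_maxr => //; apply: measurable_funN; exact: (L2_measurable lf).
    by move=> x; rewrite /fm; case: (leP (- f x) 0) => // _; rewrite ?normr0 ?normrN.
  rewrite (_ : f = fp + (-1) *: fm).
    apply: l2approxD; [by []|exact: L2Z|by apply: pos => // x; rewrite le_max lexx orbT|].
    by apply: l2approxZ => //; apply: pos => // x; rewrite le_max lexx orbT.
  apply/funext => x; rewrite [RHS]/(fp x + -1 * fm x) mulN1r /fp /fm.
  have E (y : R) : y = Num.max y 0 - Num.max (- y) 0.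
    by case: (leP y 0); case: (leP (- y) 0) => *; lra.
  exact: E.
move=> lg g0; apply: l2approx_lim => // e e0.
have mg : measurable_fun [set: measurableTypeR R] (EFin \o g).
  by apply/measurable_EFinP; exact: (L2_measurable lg).
pose t n := nnsfun_approx measurableT mg n; pose s n : R -> R := t n.
have sg n x : s n x <= g x.
  rewrite /s /t nnsfun_approxE -lee_fin.
  by apply: (@le_approx _ _ _ setT (EFin \o g)) => // y _; rewrite lee_fin.
have ms n : measurable_fun [set: measurableTypeR R] (s n) := measurable_funP (t n).
have ls n : L2 (s n).
  by apply: (L2_le (ms n) _ lg) => x; rewrite !ger0_norm.
have mu n : measurable_fun [set: R] (g - s n) by exact: (measurable_funB (L2_measurable lg) (ms n)).
have u1 n x : `|(g - s n) x| <= `|g x|.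
  rewrite !fctE (ger0_norm (g0 x)) ger0_norm ?subr_ge0//.
  by rewrite gerBl.
have u0 x : (g - s n) x @[n --> \oo] --> (0 : R).
  have : (s n x)%:E @[n --> \oo] --> (g x)%:E.
    have g0' y : [set: measurableTypeR R] y -> (0 <= (EFin \o g) y)%E by rewrite lee_fin.
    exact: (@cvg_nnsfun_approx _ _ _ _ measurableT _ mg g0' x I).
  move=> /fine_cvg/= h; rewrite -(subrr (g x)); apply: cvgB => //; exact: cvg_cst.
have [n un] := nrm2_dominated mu lg u1 u0 e0.
exists (s n); split => //.
have [r E] : exists r : seq R, s n = \sum_(y <- r) (y *: \1_(s n @^-1` [set y])) :> (R -> R).
  eexists; apply/funext => x; rewrite fct_sumE [LHS](fimfunE (t n)) fsbig_finite//=.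
rewrite E; have mI i : measurable (s n @^-1` [set i] : set (measurableTypeR R)).
  by rewrite -[X in measurable X]setTI; exact: ms.
apply: (proj2 (l2approx_sum _ _ _)) => i.
- by apply: L2Z; exact: L2_indic.
- by apply: l2approxZ; [exact: L2_indic|exact: l2approx_indic].
Qed.

End PolynomialsDense.

(** * Extension of polynomial contractions to L2 *)

Section L2Extension.
Context {R : realType} (beta : probability (measurableTypeR R) R).
Implicit Types (f g : R -> R) (p q : {poly R}) (T S : {linear {poly R} -> {poly R}}).
Local Notation L2 := (L2 beta).
Local Notation nrm2 := (nrm2 beta).
Local Notation D01 := (`[0%R, 1%R]%classic : set (measurableTypeR R)).
Hypothesis beta01 : beta D01 = 1%E.

Definition poly01 p : R -> R := on01 (horner p).

Lemma L2_poly01 p : L2 (poly01 p). Proof. exact: L2_on01 (@C01_horner _ p). Qed.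

Lemma poly01D p q : poly01 (p + q) = poly01 p + poly01 q.
Proof. by rewrite /poly01 on01D; congr on01; apply/funext => x; rewrite hornerD. Qed.

Lemma poly01Z (c : R) p : poly01 (c *: p) = c *: poly01 p.
Proof. by rewrite /poly01 on01Z; congr on01; apply/funext => x; rewrite hornerZ. Qed.

Lemma poly01B p q : poly01 (p - q) = poly01 p - poly01 q.
Proof. by rewrite /poly01 on01B; congr on01; apply/funext => x; rewrite hornerD hornerN. Qed.

Lemma poly01_0 : poly01 0 = 0.
Proof. by rewrite -(subrr 0) poly01B subrr. Qed.

Lemma nrm2_poly01 p (M : R) : 0 <= M -> (forall x, x \in `[0, 1] -> `|p.[x]| <= M) ->
  nrm2 (poly01 p) <= M.
Proof. by move=> M0 pM; apply: nrm2_on01 => //; exact: C01_horner. Qed.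

Definition l2contraction T := forall p, nrm2 (poly01 (T p)) <= nrm2 (poly01 p).

(** Jensen's inequality for the kernel of [T]: the polynomial [(p - (T p).[x]%:P) ^+ 2]
    is nonnegative. *)
Lemma markov_poly_sqr T p x : markov_poly T -> x \in `[0, 1] ->
  (T p).[x] ^+ 2 <= (T (p ^+ 2)).[x].
Proof.
move=> [T1 T0] xI; set c := (T p).[x].
have := T0 ((p - c%:P) ^+ 2).
have E : (p - c%:P) ^+ 2 = p ^+ 2 - (c *+ 2) *: p + (c ^+ 2) *: 1.
  by rewrite sqrrB -mul_polyC -mul_polyC mulr1 polyCMn polyC_exp mulrnAl mulrC.
move=> /(_ _ x xI) H.
have : 0 <= (T (p ^+ 2)).[x] - c *+ 2 * c + c ^+ 2.
  have : 0 <= (T ((p - c%:P) ^+ 2)).[x] by apply: H => y yI; rewrite horner_exp sqr_ge0.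
  rewrite E linearD linearB !linearZ/= T1 !(hornerD, hornerN, hornerZ) hornerC mulr1.
  by [].
lra.
Qed.

Lemma Rintegral_poly01 p : \int[beta]_x poly01 p x = \int[beta]_(x in D01) p.[x].
Proof. by rewrite [RHS]Rintegral_mkcond. Qed.

(** Integrates Jensen's inequality and uses the invariance of the integral. *)
Lemma markov_l2contraction T : markov_poly T ->
  (forall p, \int[beta]_(x in D01) (T p).[x] = \int[beta]_(x in D01) p.[x]) -> l2contraction T.
Proof.
move=> mT Tint p.
have sq q : nrm2 (poly01 q) ^+ 2 = \int[beta]_(x in D01) (q ^+ 2).[x].
  rewrite -Rintegral_poly01 /Rintegral -[LHS]/(fine (nrm2 (poly01 q) ^+ 2)%:E).
  rewrite -nrm2_sqr; last exact: L2_poly01.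
  congr fine; apply: eq_integral => x _; congr EFin.
  by rewrite /poly01 /on01 !patchE; case: ifP => _; rewrite ?horner_exp// expr2 mul0r.
rewrite -(@ler_pXn2r _ 2) ?nnegrE ?nrm2_ge0// !sq -[leRHS]Tint.
apply: le_Rintegral => //.
- exact: C01_integrable (@C01_horner _ _).
- exact: C01_integrable (@C01_horner _ _).
- by move=> x xI; rewrite horner_exp; exact: markov_poly_sqr.
Qed.

(** The images of polynomials converging fast to f form a fast Cauchy sequence. *)
Lemma l2extend_ex T f : l2contraction T -> L2 f ->
  exists2 g, L2 g & forall p, nrm2 (g - poly01 (T p)) <= nrm2 (f - poly01 p).
Proof.
move=> cT lf.
(* with these errors, consecutive approximations are at distance at most 2^-n *)
have e0 n : 0 < 2^-1 ^+ n / 4 :> R by rewrite divr_gt0// exprn_gt0.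
pose s n := projT1 (cid (polynomials_dense beta01 lf (e0 n))).
have fs n : nrm2 (f - poly01 (s n)) <= 2^-1 ^+ n / 4 by rewrite /s; case: cid.
have dT p q : nrm2 (poly01 (T p) - poly01 (T q)) <= nrm2 (poly01 p - poly01 q).
  by rewrite -!poly01B -linearB; exact: cT.
have [|g lg H] := @L2_complete _ beta (fun n => poly01 (T (s n))) (fun n => L2_poly01 _).
  move=> n; apply: (le_trans (dT _ _)).
  apply: (le_trans (nrm2_dist_le (L2_poly01 _) lf (L2_poly01 _))).
  rewrite nrm2_distC; apply: (le_trans (lerD (fs _) (fs _))).
  have : 0 < 2^-1 ^+ n :> R by rewrite exprn_gt0.
  by rewrite exprS => ?; lra.
exists g => // p; apply/ler_addgt0Pl => e ep.
have [n ne] : exists n, 3 * 2^-1 ^+ n <= e :> R.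
  have : (fun n => 3 * 2^-1 ^+ n : R) @ \oo --> 3 * (0 : R).
    by apply: cvgMr; apply: cvg_expr; rewrite ger0_norm ?invr_ge0// invf_lt1 ?ltr1n.
  rewrite mulr0 => /cvgrPdist_le/(_ _ ep)/filter_ex[n]; rewrite sub0r normrN => ne.
  by exists n; apply: le_trans ne; exact: ler_norm.
apply: (le_trans (nrm2_dist_le lg (L2_poly01 (T (s n))) (L2_poly01 _))).
rewrite nrm2_distC; apply: (le_trans (lerD (H n) (dT _ _))).
apply: (le_trans (lerD (lexx _) (nrm2_dist_le (L2_poly01 _) lf (L2_poly01 _)))).
rewrite (nrm2_distC _ _ f) addrA lerD2r; apply: le_trans ne.
apply: (le_trans (lerD (lexx _) (fs n))).
have : 0 < 2^-1 ^+ n :> R by rewrite exprn_gt0.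
by move=> ?; lra.
Qed.

(** Specified by requiring that [T] do not increase any distance to a polynomial, which
    determines the class of the image when [T] is a contraction. *)
Definition l2extend T f : R -> R :=
  if pselect (exists2 g, L2 g & forall p, nrm2 (g - poly01 (T p)) <= nrm2 (f - poly01 p))
  is left e then projT1 (cid2 e) else f.

Lemma l2extendP T f : l2contraction T -> L2 f -> L2 (l2extend T f) /\
  forall p, nrm2 (l2extend T f - poly01 (T p)) <= nrm2 (f - poly01 p).
Proof.
move=> cT lf; rewrite /l2extend; case: pselect => [e|[]]; last exact: l2extend_ex.
by case: cid2.
Qed.

Lemma L2_l2extend T f : l2contraction T -> L2 f -> L2 (l2extend T f).
Proof. by move=> cT lf; case: (l2extendP cT lf). Qed.

Lemma l2extend_dist T f p : l2contraction T -> L2 f ->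
  nrm2 (l2extend T f - poly01 (T p)) <= nrm2 (f - poly01 p).
Proof. by move=> cT lf; case: (l2extendP cT lf). Qed.

Lemma eq_l2extend T f g : l2contraction T -> L2 f -> L2 g ->
  (forall e : R, 0 < e -> exists p, nrm2 (f - poly01 p) <= e /\ nrm2 (g - poly01 (T p)) <= e) ->
  l2extend T f = g %[ae beta].
Proof.
move=> cT lf lg H; apply: ae_eq_nrm2 => // [|e e0]; first exact: L2_l2extend.
have [p [fp gp]] := H _ (divr_gt0 e0 (ltr0n R 2) : 0 < e / 2).
apply: (le_trans (nrm2_dist_le (L2_l2extend cT lf) (L2_poly01 (T p)) lg)).
rewrite [leRHS]splitr lerD//; last by rewrite nrm2_distC.
exact: le_trans (l2extend_dist _ cT lf) fp.
Qed.

Lemma l2extend_poly T p : l2contraction T -> l2extend T (poly01 p) = poly01 (T p) %[ae beta].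
Proof.
move=> cT; apply: eq_l2extend => //; [exact: L2_poly01|exact: L2_poly01|].
by move=> e e0; exists p; rewrite !subrr nrm2_0 ltW.
Qed.

Lemma l2extend_ae T f g : l2contraction T -> L2 f -> L2 g -> f = g %[ae beta] ->
  l2extend T f = l2extend T g %[ae beta].
Proof.
move=> cT lf lg fg; apply: eq_l2extend => // [|e e0]; first exact: L2_l2extend.
have [p fp] := polynomials_dense beta01 lf e0; exists p; split => //.
apply: (le_trans (l2extend_dist _ cT lg)).
rewrite (le_trans (nrm2_dist_le lg lf (L2_poly01 _)))// (@nrm2_dist_ae _ beta g f) ?add0r//.
by apply: (@filterS _ _ (ae_filter_ringOfSetsType beta)) fg => x h hT; rewrite h.
Qed.

Lemma l2extend_norm T f : l2contraction T -> L2 f -> nrm2 (l2extend T f) <= nrm2 f.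
Proof.
move=> cT lf; have := l2extend_dist 0 cT lf.
by rewrite linear0 poly01_0 !subr0.
Qed.

Lemma l2extend_linear T (c : R) f g : l2contraction T -> L2 f -> L2 g ->
  l2extend T (c *: f + g) = c *: l2extend T f + l2extend T g %[ae beta].
Proof.
move=> cT lf lg.
have lTf := L2_l2extend cT lf; have lTg := L2_l2extend cT lg.
apply: eq_l2extend => //; [exact: L2D (L2Z c lf) lg|exact: L2D (L2Z c lTf) lTg|].
move=> e e0; set d := e / (`|c| + 1).
have c1 : 0 < `|c| + 1 by rewrite ltr_wpDl.
have d0 : 0 < d by rewrite divr_gt0.
have de : `|c| * d + d = e by rewrite /d; field; rewrite gt_eqF.
have [p fp] := polynomials_dense beta01 lf d0; have [q gq] := polynomials_dense beta01 lg d0.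
have key u v p' q' : L2 u -> L2 v -> nrm2 (u - poly01 p') <= d -> nrm2 (v - poly01 q') <= d ->
    nrm2 (c *: u + v - poly01 (c *: p' + q')) <= e.
  move=> lu lv up vq; rewrite poly01D poly01Z opprD addrACA -scalerBr -de.
  have lup := L2B lu (L2_poly01 p'); have lvq := L2B lv (L2_poly01 q').
  apply: (le_trans (nrm2D (L2Z c lup) lvq)).
  by rewrite lerD// nrm2Z// ler_wpM2l.
exists (c *: p + q); split; first exact: key.
rewrite linearP; apply: key => //.
- exact: le_trans (l2extend_dist _ cT lf) fp.
- exact: le_trans (l2extend_dist _ cT lg) gq.
Qed.

Lemma l2extend_comp T S U f : l2contraction T -> l2contraction S -> l2contraction U ->
  (forall p, U p = T (S p)) -> L2 f ->
  l2extend U f = l2extend T (l2extend S f) %[ae beta].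
Proof.
move=> cT cS cU UE lf; have lSf := L2_l2extend cS lf.
apply: eq_l2extend => // [|e e0]; first exact: L2_l2extend.
have [p fp] := polynomials_dense beta01 lf e0; exists p; split => //.
rewrite UE; apply: (le_trans (l2extend_dist _ cT lSf)).
exact: le_trans (l2extend_dist _ cS lf) fp.
Qed.

Lemma l2extend_on01 T f : l2contraction T -> markov_poly T -> C01 f ->
  l2extend T (on01 f) = on01 (extend01 T f) %[ae beta].
Proof.
move=> cT mT cf; have cTf := extend01_C01 mT cf.
apply: eq_l2extend => //; [exact: L2_on01|exact: L2_on01|].
move=> e e0; have [p fp] := approx01_ex cf e0; exists p; split; rewrite /poly01 on01B.
  by apply: nrm2_on01; [exact: C01B cf (@C01_horner _ p)|exact: ltW|].
apply: nrm2_on01; [exact: C01B cTf (@C01_horner _ _)|exact: ltW|].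
exact: extend01P.
Qed.

Lemma l2norm_cvg0 (Fl : set_system R) (u : R -> R -> R) : Filter Fl ->
  (\forall t \near Fl, L2 (u t)) ->
  (forall e : R, 0 < e -> \forall t \near Fl, nrm2 (u t) <= e) <->
  l2norm beta (u t) @[t --> Fl] --> 0%E.
Proof.
move=> FF lu; split=> [H|H e e0].
  apply/fine_cvgP; split; first by apply: filterS lu => t lut; rewrite l2normE.
  apply/cvgrPdist_le => e e0; apply: filterS (H e e0) => t.
  by rewrite sub0r normrN ger0_norm// nrm2_ge0.
move/fine_cvgP : H => [_ /cvgrPdist_le/(_ e e0)]; apply: filterS => t.
by rewrite sub0r normrN ger0_norm// nrm2_ge0.
Qed.

End L2Extension.

(** * The semigroup on L2: invariance, generator, core, ergodicity *)

Section L2Semigroup.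
Context {R : realType} (beta : probability (measurableTypeR R) R).
Implicit Types (f g : R -> R) (p q : {poly R}).
Local Notation L2 := (L2 beta).
Local Notation nrm2 := (nrm2 beta).
Local Notation D01 := (`[0%R, 1%R]%classic : set (measurableTypeR R)).
Hypothesis beta01 : beta D01 = 1%E.
Variables (a th : nat -> R).
Hypotheses (th_inj : injective th) (th0 : th 0%N = 0) (th_ge0 : forall k, 0 <= th k).
Local Notation J := (shift_op a th).
Local Notation calc := (eig_mult a th).
Hypothesis minimum_principle : forall (p : {poly R}) x0, x0 \in `[0, 1] ->
  (forall x, x \in `[0, 1] -> p.[x0] <= p.[x]) -> 0 <= (J p).[x0].
Hypothesis moments : forall n, \int[beta]_(x in D01) (x ^+ n) = eig_dual a th n 0.
Local Notation TQ := (semigroup_poly a th_inj).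
Local Notation QC := (semigroup01 a th_inj).

(** The moments are the left eigenvector of J for the eigenvalue 0. *)
Lemma Rintegral_eig_coord p : \int[beta]_(x in D01) p.[x] = eig_coord a th 0 p.
Proof.
rewrite Rintegral_horner /eig_coord big_mkord; apply: eq_bigr => i _.
by rewrite moments.
Qed.

Lemma Rintegral_eig_mult F p : F 0%N = 1 ->
  \int[beta]_(x in D01) (calc F p).[x] = \int[beta]_(x in D01) p.[x].
Proof. by move=> F0; rewrite !Rintegral_eig_coord eig_coord_mult// F0 mul1r. Qed.

Lemma Rintegral_semigroup_poly (t : R) p :
  \int[beta]_(x in D01) (TQ t p).[x] = \int[beta]_(x in D01) p.[x].
Proof. by rewrite Rintegral_eig_mult// th0 mul0r oppr0 expR0. Qed.

Lemma semigroup01_invariant : invariant_measure QC beta.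
Proof.
split => // t f t0 cf; have mt := markov_semigroup_poly th_inj th0 th_ge0 minimum_principle t0.
apply/eqP; rewrite -subr_eq0 -normr_le0; apply/ler_addgt0Pl => e e0; rewrite addr0.
have e20 : 0 < e / 2 by rewrite divr_gt0.
have [p fp] := approx01_ex cf e20.
have h1 := Rintegral_C01_dist beta (extend01_C01 mt cf) (@C01_horner _ (TQ t p)) (extend01P mt cf fp).
have h2 := Rintegral_C01_dist beta cf (@C01_horner _ p) fp.
rewrite Rintegral_semigroup_poly in h1.
rewrite -(subrK (\int[beta]_(x in D01) p.[x]) (\int[beta]_(x in _) QC t f x)) -addrA.
by rewrite (le_trans (ler_normD _ _))// [leRHS]splitr lerD// distrC.
Qed.

(** All eigenvalues but the first decay. *)
Lemma semigroup_poly_infty p (e : R) : 0 < e -> \forall t \near +oo,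
  forall x, x \in `[0, 1] -> `|(TQ t p).[x] - eig_coord a th 0 p| < e.
Proof.
move=> e0; have cv k : expR (- (th k * t)) @[t --> +oo] --> ((k == 0)%:R : R).
  case: k => [|k].
    rewrite th0 eqxx; apply: cvg_near_cst; apply: nearW => t.
    by rewrite mul0r oppr0 expR0.
  have tk : 0 < th k.+1.
    by rewrite lt_neqAle th_ge0 andbT eq_sym -th0; apply/eqP => /th_inj.
  apply/cvgrPdist_le => d d0.
  near=> t; rewrite sub0r normrN ger0_norm ?expR_ge0//.
  have t0 : 0 < t by near: t; by apply: nbhs_pinfty_gt; rewrite num_real.
  have : (th k.+1 * d)^-1 <= t by near: t; by apply: nbhs_pinfty_ge; rewrite num_real.
  rewrite -ler_pV2 ?inE ?unitfE ?gt_eqF ?invr_gt0 ?mulr_gt0// invrK => H.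
  rewrite expRN invf_ple ?posrE ?expR_gt0//.
  apply: le_trans (expR_ge1Dx _).
  rewrite (le_trans (_ : _ <= th k.+1 * t)) ?lerDr//.
  rewrite invf_ple ?posrE ?mulr_gt0//.
  by rewrite invfM mulrC ler_pdivrMr// mulrC.
have FF : Filter (pinfty_nbhs R) by exact: proper_pinfty_nbhs.
have := eig_mult_cvg a th_inj p FF cv e0; apply: filterS => t H x xI.
have := H x xI; rewrite [X in _ - X.[x]](_ : _ = (1 * eig_coord a th 0 p)%:P).
  by rewrite hornerC mul1r.
by rewrite -eig_mult_at0//; apply: eq_eig_mult => // k; rewrite mul1r.
Unshelve. all: by end_near. Qed.

(** By invariance a monomial has the same integral as its image at time t, which tends
    uniformly to a constant: the moments are forced. *)
Lemma semigroup01_invariant_unique nu : invariant_measure QC nu ->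
  forall A : set (measurableTypeR R), measurable A -> nu A = beta A.
Proof.
move=> [nu1 inv]; apply: probability01_unique => //; apply: eq_moments_C01 => n.
rewrite moments -eig_coord_Xn//.
have cn := @C01_horner R 'X^n.
rewrite (_ : (fun x => x ^+ n) = horner ('X^n : {poly R})); last by apply/funext => x; rewrite hornerXn.
apply/eqP; rewrite -subr_eq0 -normr_le0; apply/ler_addgt0Pl => e e0; rewrite addr0.
near (pinfty_nbhs R) => t.
have t0 : 0 <= t by near: t; by apply: nbhs_pinfty_ge; rewrite num_real.
have mt := markov_semigroup_poly th_inj th0 th_ge0 minimum_principle t0.
rewrite -(inv t _ t0 cn).
have H x : x \in `[0, 1] -> `|QC t (horner ('X^n : {poly R})) x - cst (eig_coord a th 0 'X^n) x| <= e.
  move=> xI; rewrite /semigroup01 extend01_horner//; apply: ltW; move: x xI.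
  by near: t; exact: semigroup_poly_infty.
have := Rintegral_C01_dist nu (extend01_C01 mt cn) (@C01_cst R _) H.
rewrite Rintegral_cst//.
by rewrite (_ : fine _ = 1) ?mulr1//; exact: (congr1 fine nu1).
Unshelve. all: by end_near. Qed.

Lemma semigroup_l2contraction (t : R) : 0 <= t -> l2contraction beta (TQ t).
Proof.
move=> t0; apply: markov_l2contraction; first exact: markov_semigroup_poly.
exact: Rintegral_semigroup_poly.
Qed.

Definition semigroup2 (t : R) f : R -> R := l2extend beta (TQ t) f.
Local Notation Q := semigroup2.

Lemma L2_semigroup2 (t : R) f : 0 <= t -> L2 f -> L2 (Q t f).
Proof. by move=> t0 lf; apply: L2_l2extend => //; exact: semigroup_l2contraction. Qed.

Lemma semigroup2_dist (t : R) f p : 0 <= t -> L2 f ->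
  nrm2 (Q t f - poly01 (TQ t p)) <= nrm2 (f - poly01 p).
Proof. by move=> t0 lf; apply: l2extend_dist => //; exact: semigroup_l2contraction. Qed.

Lemma semigroup2_cvg0 f (e : R) : L2 f -> 0 < e ->
  \forall t \near 0^'+, nrm2 (Q t f - f) <= e.
Proof.
move=> lf e0; have e30 : 0 < e / 3 by rewrite divr_gt0.
have [p fp] := polynomials_dense beta01 lf e30.
near=> t; have t0 : 0 <= t by near: t; exact: nbhs_right_ge.
have lQ := L2_semigroup2 t0 lf.
apply: (le_trans (nrm2_dist_le lQ (L2_poly01 _ (TQ t p)) lf)).
have h1 := le_trans (semigroup2_dist p t0 lf) fp.
have h2 := nrm2_dist_le (L2_poly01 beta (TQ t p)) (L2_poly01 beta p) lf.
have h3 : nrm2 (poly01 (TQ t p) - poly01 p) <= e / 3.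
  rewrite -poly01B; apply: nrm2_poly01; first exact: ltW.
  move=> x xI; rewrite hornerD hornerN; apply: ltW; move: x xI.
  by near: t; exact: semigroup_poly_cvg0.
rewrite nrm2_distC in fp.
have -> : e = e / 3 + (e / 3 + e / 3) by field.
apply: lerD => //; apply: (le_trans h2); exact: lerD.
Unshelve. all: by end_near. Qed.

Lemma semigroup2_extension : L2_extension beta QC Q.
Proof.
have cT := semigroup_l2contraction.
split.
- by move=> t f t0; exact: L2_semigroup2.
- by move=> t f g t0 lf lg; apply: l2extend_ae => //; exact: cT.
- by move=> t c f g t0 lf lg; apply: l2extend_linear => //; exact: cT.
- move=> t f t0 lf; rewrite !l2normE//; last exact: L2_semigroup2.
  by rewrite lee_fin; apply: l2extend_norm => //; exact: cT.
- move=> f lf; apply: eq_l2extend => //; first exact: cT.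
  move=> e e0; have [p fp] := polynomials_dense beta01 lf e0; exists p; split => //=.
  by rewrite eig_mult_id// => k; rewrite mulr0 oppr0 expR0.
- move=> s t f s0 t0 lf; apply: l2extend_comp => //; [exact: cT|exact: cT| |].
    by apply: cT; rewrite addr_ge0.
  exact: semigroup_polyD.
- move=> f lf; have FF : Filter (0:R)^'+ by exact: at_right_proper_filter.
  apply/(@l2norm_cvg0 _ beta _ _ FF) => [|e e0]; last exact: semigroup2_cvg0.
  by apply: filterS (nbhs_right_ge (0 : R)) => t t0; apply: L2B => //; exact: L2_semigroup2.
- move=> t f t0 cf; apply: l2extend_on01 => //; first exact: cT.
  exact: markov_semigroup_poly.
Qed.

Lemma cvg_expR_rate (c : R) : 0 <= c ->
  t^-1 * (expR (- (c * t)) - 1) @[t --> 0^'+] --> - c.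
Proof.
move=> c0; apply/cvgrPdist_le => e e0; near=> t.
have t0 : 0 < t by near: t; exact: nbhs_right_gt.
have te : t <= e / (c ^+ 2 + 1).
  by near: t; apply: nbhs_right_le; rewrite divr_gt0// ltr_wpDl// sqr_ge0.
have h1 := expR_ge1Dx (- (c * t)).
have h2 : expR (- (c * t)) <= (1 + c * t)^-1.
  rewrite expRN lef_pV2 ?posrE ?expR_gt0 ?expR_ge1Dx//.
  by rewrite ltr_wpDr// mulr_ge0// ltW.
have h3 : (1 + c * t)^-1 <= 1 - c * t + (c * t) ^+ 2.
  have ct : 0 <= c * t by rewrite mulr_ge0// ltW.
  rewrite -div1r ler_pdivrMr ?ltr_wpDr//; move: (c * t) ct => u u0.
  have : 0 <= u ^+ 3 by rewrite exprn_ge0.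
  by rewrite !exprS expr0 mulr1 => ?; lra.
rewrite -(ler_pM2l t0).
have -> : t * `|- c - t^-1 * (expR (- (c * t)) - 1)| = `|expR (- (c * t)) - 1 + c * t|.
  rewrite -{1}(gtr0_norm t0) -normrM -normrN; congr `|_|.
  by rewrite mulrBr mulrA mulfV ?gt_eqF//; ring.
have h4 : c ^+ 2 * t <= e.
  move: te; rewrite ler_pdivlMr ?ltr_wpDl ?sqr_ge0// => te; apply: le_trans te.
  by rewrite mulrC ler_wpM2l ?(ltW t0)// lerDl.
have h5 : (c * t) ^+ 2 <= t * e.
  by rewrite exprMn [t ^+ 2]expr2 mulrA mulrC ler_wpM2l// ltW.
rewrite ger0_norm; first by apply: le_trans h5; lra.
lra.
Unshelve. all: by end_near. Qed.

Lemma generator_poly_rate p (e : R) : 0 < e -> \forall t \near 0^'+,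
  nrm2 (t^-1 *: (poly01 (TQ t p) - poly01 p) - poly01 (J p)) <= e.
Proof.
move=> e0; have FF : Filter (0:R)^'+ by exact: at_right_proper_filter.
have := eig_mult_cvg a th_inj p FF (fun k => cvg_expR_rate (th_ge0 k)) e0.
apply: filterS => t H.
rewrite -poly01B -poly01Z -poly01B; apply: nrm2_poly01; first exact: ltW.
have -> : J p = calc (fun k => - th k) p by rewrite eig_mult_shift_op.
have -> : t^-1 *: (TQ t p - p) = calc (fun k => t^-1 * (expR (- (th k * t)) - 1)) p.
  rewrite eig_multZ// (eig_multD _ th_inj (fun k => expR (- (th k * t))) (fun=> -1)).
  by congr (_ *: (_ + _)); rewrite (eig_multN _ th_inj (fun=> 1)) eig_mult_id.
by move=> x /H/ltW; rewrite hornerD hornerN.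
Qed.

Definition L2_domain : set (R -> R) :=
  [set f | L2 f /\ exists g, L2 g /\ generator_limit beta Q f g].

Definition L2_generator f : R -> R :=
  if pselect (exists g, L2 g /\ generator_limit beta Q f g) is left e
  then projT1 (cid e) else f.

Lemma L2_generatorP f : L2_domain f ->
  L2 (L2_generator f) /\ generator_limit beta Q f (L2_generator f).
Proof. by move=> [lf H]; rewrite /L2_generator; case: pselect => // e; case: cid. Qed.

Lemma L2_is_generator : is_generator beta Q L2_domain L2_generator.
Proof. by split=> [//|f]; exact: L2_generatorP. Qed.

Lemma L2_rate f g (t : R) : 0 <= t -> L2 f -> L2 g -> L2 (t^-1 *: (Q t f - f) - g).
Proof. by move=> t0 lf lg; apply: L2B => //; apply/L2Z/L2B => //; exact: L2_semigroup2. Qed.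

Lemma generator_limitP f g : L2 f -> L2 g -> generator_limit beta Q f g <->
  forall e : R, 0 < e -> \forall t \near 0^'+, nrm2 (t^-1 *: (Q t f - f) - g) <= e.
Proof.
move=> lf lg; have FF : Filter (0:R)^'+ by exact: at_right_proper_filter.
apply: iff_sym; apply: l2norm_cvg0.
by apply: filterS (nbhs_right_ge (0 : R)) => t t0; exact: L2_rate.
Qed.

Lemma generator_limit_unique f g1 g2 : L2 f -> L2 g1 -> L2 g2 ->
  generator_limit beta Q f g1 -> generator_limit beta Q f g2 -> g1 = g2 %[ae beta].
Proof.
move=> lf l1 l2 /(generator_limitP lf l1) H1 /(generator_limitP lf l2) H2.
apply: ae_eq_nrm2 => // e e0; have e20 : 0 < e / 2 by rewrite divr_gt0.
near (0:R)^'+ => t; have t0 : 0 <= t by near: t; exact: nbhs_right_ge.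
have lr : L2 (t^-1 *: (Q t f - f)) by apply/L2Z/L2B => //; exact: L2_semigroup2.
apply: (le_trans (nrm2_dist_le l1 lr l2)).
rewrite [leRHS]splitr lerD//; last by near: t; exact: H2.
by rewrite nrm2_distC; near: t; exact: H1.
Unshelve. all: by end_near. Qed.

Lemma generator_limit_poly p : generator_limit beta Q (poly01 p) (poly01 (J p)).
Proof.
have lp := L2_poly01 beta p; have lJ := L2_poly01 beta (J p).
apply/generator_limitP => // e e0.
have := generator_poly_rate p e0.
move=> /(filterI (nbhs_right_ge (0 : R))); apply: filterS => t [t0]; apply: le_trans.
rewrite le_eqVlt; apply/orP; left; apply/eqP; apply: nrm2_ae.
- exact: L2_rate.
- by apply: L2B => //; apply/L2Z/L2B => //; exact: L2_poly01.
- apply: (@filterS _ _ (ae_filter_ringOfSetsType beta)) (l2extend_poly beta01 p (semigroup_l2contraction t0)).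
  by move=> x H hT; rewrite !fctE /semigroup2 H.
Qed.

Lemma L2_domain_poly p : L2_domain (poly01 p).
Proof.
split; first exact: L2_poly01.
by exists (poly01 (J p)); split; [exact: L2_poly01|exact: generator_limit_poly].
Qed.

Lemma L2_generator_poly p : L2_generator (poly01 p) = poly01 (J p) %[ae beta].
Proof.
have [lg H] := L2_generatorP (L2_domain_poly p).
by apply: (generator_limit_unique _ _ _ H (generator_limit_poly p)) => //; exact: L2_poly01.
Qed.

(** Put w = f - p, and let v be the difference of the generators. As the semigroup is a
    contraction, (1 + 1 / t) |w| <= |w - v| + |w| / t + o(1) when t tends to 0. *)
Lemma generator_dissipative f g p : L2 f -> L2 g -> generator_limit beta Q f g ->
  nrm2 (f - poly01 p) <= nrm2 (f - g - poly01 (p - J p)).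
Proof.
move=> lf lg /(generator_limitP lf lg) Hf.
have lp := L2_poly01 beta p; have lJ := L2_poly01 beta (J p).
have Hp := generator_poly_rate p.
have lw := L2B lf lp.
have lwv : L2 (f - g - poly01 (p - J p)) by apply: L2B; [exact: L2B|exact: L2_poly01].
apply/ler_addgt0Pl => e e0; have e20 : 0 < e / 2 by rewrite divr_gt0.
near (0:R)^'+ => t; have t0 : 0 < t by near: t; exact: nbhs_right_gt.
have tV0 : 0 < t^-1 by rewrite invr_gt0.
have lTp := L2_poly01 beta (TQ t p).
have lQ := L2_semigroup2 (ltW t0) lf.
have lW := L2B lQ lTp.
have hf : nrm2 (t^-1 *: (Q t f - f) - g) <= e / 2 by near: t; exact: Hf.
have hp : nrm2 (t^-1 *: (poly01 (TQ t p) - poly01 p) - poly01 (J p)) <= e / 2.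
  by near: t; exact: Hp.
have hW : nrm2 (Q t f - poly01 (TQ t p)) <= nrm2 (f - poly01 p).
  exact: (semigroup2_dist p (ltW t0) lf).
set rf := t^-1 *: (Q t f - f) - g in hf; set rp := _ - poly01 (J p) in hp.
have lrf : L2 rf by exact: L2_rate (ltW t0) lf lg.
have lrp : L2 rp by apply: L2B => //; apply/L2Z/L2B.
have lr := L2B lrp lrf.
have E : (1 + t^-1) *: (f - poly01 p) = (f - g - poly01 (p - J p)) +
    t^-1 *: (Q t f - poly01 (TQ t p)) + (rp - rf).
  have E (c u v w k y z : R) : (1 + c) * (u - v) =
      (u - w - (v - k)) + c * (y - z) + (c * (z - v) - k - (c * (y - u) - w)) by ring.
  by rewrite poly01B /rf /rp; apply/funext => x; exact: E.
have t1 : 0 < 1 + t^-1 by rewrite addr_gt0.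
have := nrm2Z (1 + t^-1) lw; rewrite E gtr0_norm// => H.
have := nrm2D (L2D lwv (L2Z t^-1 lW)) lr; rewrite H => {}H.
have := le_trans H (lerD (nrm2D lwv (L2Z t^-1 lW)) (nrm2D lrp (L2N lrf))).
rewrite nrm2N nrm2Z// gtr0_norm// mulrDl mul1r => {}H.
have h4 : t^-1 * nrm2 (Q t f - poly01 (TQ t p)) <= t^-1 * nrm2 (f - poly01 p).
  by rewrite ler_wpM2l// ltW.
move: H h4 hf hp; move: (t^-1 * _) (t^-1 * _) => A B.
move: (nrm2 _) (nrm2 _) (nrm2 _) (nrm2 _) => C D G K; lra.
Unshelve. all: by end_near. Qed.

(** (1 - J)^-1 maps polynomials to polynomials: take q close to f - J f and p with
    p - J p = q; dissipativity brings p close to f. *)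
Lemma L2_core : is_core beta L2_domain L2_generator [set poly01 p | p in [set: {poly R}]].
Proof.
split; first by move=> _ [p _ <-]; exact: L2_domain_poly.
move=> f e Df e0; have [lg Hg] := L2_generatorP Df; have lf := Df.1.
set g := L2_generator f in lg Hg *.
have e30 : 0 < e / 3 by rewrite divr_gt0.
have [q fq] := polynomials_dense beta01 (L2B lf lg) e30.
pose p := calc (fun k => (1 + th k)^-1) q.
have pq : p - J p = q.
  have p1 k : 1 + th k != 0 by rewrite gt_eqF// ltr_wpDr.
  rewrite -(eig_mult_shift_op _ th_inj) -[p in p - _](@eig_mult_id _ a th th_inj (fun=> 1))//.
  rewrite -eig_multN// -eig_multD// /p eig_mult_comp// eig_mult_id// => k.
  by rewrite opprK mulfV.
have lp := L2_poly01 beta p; have lJ := L2_poly01 beta (J p).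
have hw : nrm2 (f - poly01 p) <= e / 3.
  by apply: le_trans fq; rewrite -pq; exact: generator_dissipative.
have [lgp _] := L2_generatorP (L2_domain_poly p).
exists (poly01 p); split; first by exists p.
split; first by rewrite l2normE ?lte_fin; [lra|exact: L2B].
rewrite l2normE ?lte_fin; last exact: L2B.
apply: (@le_lt_trans _ _ (nrm2 (g - poly01 (J p)))).
  rewrite (@nrm2_ae _ beta _ (g - poly01 (J p))); [by []|exact: L2B|exact: L2B|].
  apply: (@filterS _ _ (ae_filter_ringOfSetsType beta)) (L2_generator_poly p).
  by move=> x H hT; rewrite !fctE H.
have -> : g - poly01 (J p) = (f - poly01 p) - (f - g - poly01 q).
  by rewrite -pq poly01B; apply/funext => x; rewrite !fctE; ring.
apply: (le_lt_trans (nrm2D (L2B lf lp) (L2N (L2B (L2B lf lg) (L2_poly01 beta q))))).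
rewrite nrm2N; apply: (le_lt_trans (lerD hw fq)); lra.
Qed.

(** The eigenvalue of the time average of the semigroup over [0, T]. *)
Definition expR_mean (c T : R) : R := if c == 0 then 1 else (1 - expR (- (c * T))) / (c * T).

(** Both numbers lie between the extreme values of the integrand times the
    length of the cell. *)
Lemma expR_cell (c d s s' tau : R) : 0 <= c -> s <= tau <= s' -> s' - s < d ->
  `|(c * (s' - s)) * expR (- (c * tau)) - (expR (- (c * s)) - expR (- (c * s')))| <=
  c * d * (expR (- (c * s)) - expR (- (c * s'))).
Proof.
move=> c0 /andP[st ts'] sd; have ss' := le_trans st ts'.
have u0 : 0 <= c * (s' - s) by rewrite mulr_ge0// subr_ge0.
have mono x y : x <= y -> expR (- (c * y)) <= expR (- (c * x)).
  by move=> xy; rewrite ler_expR lerN2 ler_wpM2l.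
have m1 := mono _ _ st; have m2 := mono _ _ ts'.
have l1 : c * (s' - s) * expR (- (c * s')) <= expR (- (c * s)) - expR (- (c * s')).
  rewrite [X in _ <= expR X - _](_ : _ = c * (s' - s) + - (c * s')); last by ring.
  have := ler_wpM2r (expR_ge0 (- (c * s'))) (expR_ge1Dx (c * (s' - s))).
  by rewrite expRD mulrDl mul1r lerBrDl.
have l2 : expR (- (c * s)) - expR (- (c * s')) <= c * (s' - s) * expR (- (c * s)).
  rewrite [X in _ - expR X](_ : _ = - (c * (s' - s)) + - (c * s)); last by ring.
  have := ler_wpM2r (expR_ge0 (- (c * s))) (expR_ge1Dx (- (c * (s' - s)))).
  by rewrite expRD mulrDl mul1r mulNr lerBlDr lerBlDl addrC.
have l3 : c * (s' - s) * (expR (- (c * s)) - expR (- (c * s'))) <=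
    c * d * (expR (- (c * s)) - expR (- (c * s'))).
  by rewrite ler_wpM2r ?subr_ge0 ?mono// ler_wpM2l// ltW.
have l4 := ler_wpM2l u0 m1; have l5 := ler_wpM2l u0 m2.
move: l1 l2 l3 l4 l5; rewrite mulrBr ler_norml.
move: (c * (s' - s) * expR (- (c * s'))) (c * (s' - s) * expR (- (c * s)))
  (c * (s' - s) * expR (- (c * tau))) (expR (- (c * s))) (expR (- (c * s'))) => A B C D E.
by move: (c * d * (D - E)) => F *; apply/andP; split; lra.
Qed.

(** The errors on the cells telescope to at most d (1 - exp (- c T)). *)
Lemma riemann_expR (c T d : R) n (s tau : nat -> R) : 0 <= c -> 0 < T -> 0 < d ->
  s 0%N = 0 -> s n = T ->
  (forall i, (i < n)%N -> s i <= tau i <= s i.+1 /\ s i.+1 - s i < d) ->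
  `|\sum_(i < n) (s i.+1 - s i) * expR (- (c * tau i)) - T * expR_mean c T| <= d.
Proof.
move=> c0 T0 d0 s0 sn H.
have tele (u : nat -> R) : \sum_(i < n) (u i.+1 - u i) = u n - u 0%N.
  by rewrite -(big_mkord xpredT (fun i => u i.+1 - u i)) telescope_sumr.
rewrite /expR_mean; have [->|cn0] := eqVneq c 0.
  under eq_bigr do rewrite mul0r oppr0 expR0 mulr1.
  by rewrite tele s0 sn subr0 mulr1 subrr normr0 ltW.
have cp : 0 < c by rewrite lt_neqAle eq_sym cn0.
rewrite -(ler_pM2l cp) -{1}(gtr0_norm cp) -normrM mulrBr mulr_sumr.
have -> : c * (T * ((1 - expR (- (c * T))) / (c * T))) =
    \sum_(i < n) (expR (- (c * s i)) - expR (- (c * s i.+1))).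
  have := tele (fun i => - expR (- (c * s i))).
  rewrite s0 sn mulr0 oppr0 expR0 => E.
  rewrite (eq_bigr (fun i : 'I_n => - expR (- (c * s i.+1)) - - expR (- (c * s i)))).
    by rewrite E; field; rewrite !gt_eqF.
  by move=> i _; ring.
rewrite -sumrB; apply: (le_trans (ler_norm_sum _ _ _)).
apply: (@le_trans _ _ (\sum_(i < n) c * d * (expR (- (c * s i)) - expR (- (c * s i.+1))))).
  apply: ler_sum => i _; rewrite mulrA.
  by have [h1 h2] := H i (ltn_ord i); exact: expR_cell.
rewrite -mulr_sumr ler_piMr ?mulr_ge0 ?(ltW d0)//.
have := tele (fun i => - expR (- (c * s i))).
rewrite s0 sn mulr0 oppr0 expR0 => E.
rewrite (eq_bigr (fun i : 'I_n => - expR (- (c * s i.+1)) - - expR (- (c * s i)))).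
  by rewrite E; have := expR_ge0 (- (c * T)); lra.
by move=> i _; ring.
Qed.

Definition mean_poly (T : R) : {linear {poly R} -> {poly R}} :=
  eig_mult_linear a th_inj (fun k => expR_mean (th k) T).

(** The error of the Riemann sums of exp (- th k t) is at most the mesh, whatever k. *)
Lemma riemann_semigroup_poly p (T e : R) : 0 < T -> 0 < e -> exists2 d : R, 0 < d &
  forall n (s tau : nat -> R), s 0%N = 0 -> s n = T ->
  (forall i, (i < n)%N -> s i <= tau i <= s i.+1 /\ s i.+1 - s i < d) ->
  nrm2 (\sum_(i < n) (s i.+1 - s i) *: poly01 (TQ (tau i) p) - T *: poly01 (mean_poly T p)) <= e.
Proof.
move=> T0 e0; have [B HB] := eig_mult_dist a th_inj p.
pose b := \sum_(k < size p) `|B k|.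
have b0 : 0 <= b by apply: sumr_ge0.
exists (e / (b + 1)) => [|n s tau s0 sn H]; first by rewrite divr_gt0// ltr_wpDl.
pose F k := \sum_(i < n) (s i.+1 - s i) * expR (- (th k * tau i)).
have E1 : \sum_(i < n) (s i.+1 - s i) *: poly01 (TQ (tau i) p) = poly01 (calc F p).
  rewrite /F (@eig_mult_sum _ a th th_inj _ _ (fun (i : 'I_n) k => (s i.+1 - s i) * expR (- (th k * tau i)))).
  rewrite (big_morph _ poly01D poly01_0); apply: eq_bigr => i _.
  by rewrite eig_multZ// poly01Z.
have E2 : T *: poly01 (mean_poly T p) = poly01 (calc (fun k => T * expR_mean (th k) T) p).
  by rewrite eig_multZ// poly01Z.
rewrite E1 E2 -poly01B; apply: nrm2_poly01; first exact: ltW.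
move=> x xI; rewrite hornerD hornerN; apply: (le_trans (HB _ _ x xI)).
have d0 : 0 < e / (b + 1) by rewrite divr_gt0// ltr_wpDl.
apply: (@le_trans _ _ (\sum_(k < size p) e / (b + 1) * `|B k|)).
  apply: ler_sum => k _; apply: (@le_trans _ _ (`|F k - T * expR_mean (th k) T| * `|B k|)).
    by rewrite ler_wpM2l// ler_norm.
  by rewrite ler_wpM2r//; exact: riemann_expR.
rewrite -mulr_sumr -/b mulrAC ler_pdivrMr ?ltr_wpDl// ler_wpM2l ?(ltW e0)//.
by rewrite lerDl.
Qed.

Lemma riemann_nrm2 (n : nat) (s : nat -> R) (u : nat -> R -> R) (M : R) :
  (forall i, (i < n)%N -> [/\ s i <= s i.+1, L2 (u i) & nrm2 (u i) <= M]) ->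
  L2 (\sum_(i < n) (s i.+1 - s i) *: u i) /\
  nrm2 (\sum_(i < n) (s i.+1 - s i) *: u i) <= (s n - s 0%N) * M.
Proof.
elim: n => [|n ih] H.
  rewrite big_ord0 subrr mul0r; split; first exact: L2_cst.
  by have := nrm2_0 beta; rewrite (_ : cst 0 = 0)// => ->.
have [ih1 ih2] := ih (fun i i_n => H i (leqW i_n)).
have [s1 lu uM] := H n (ltnSn n).
rewrite big_ord_recr/=; split; first by apply: L2D => //; exact: L2Z.
apply: (le_trans (nrm2D ih1 (L2Z _ lu))).
rewrite nrm2Z// ger0_norm ?subr_ge0//.
rewrite (_ : s n.+1 - s 0%N = (s n - s 0%N) + (s n.+1 - s n)); last by ring.
by rewrite [leRHS]mulrDl; apply: lerD => //; rewrite ler_wpM2l// subr_ge0.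
Qed.

Lemma partition_ge0 (n : nat) (s : nat -> R) : s 0%N = 0 ->
  (forall i, (i < n)%N -> s i <= s i.+1) -> forall i, (i <= n)%N -> 0 <= s i.
Proof.
move=> s0 H; elim=> [|i ih] i_n; first by rewrite s0.
exact: le_trans (ih (ltnW i_n)) (H _ i_n).
Qed.

(** The time average is a limit of convex combinations of contractions. *)
Lemma mean_l2contraction (T : R) : 0 < T -> l2contraction beta (mean_poly T).
Proof.
move=> T0 p; rewrite -(ler_pM2l T0); apply/ler_addgt0Pl => e e0.
have [d d0 Hd] := riemann_semigroup_poly p T0 e0.
pose n := (Num.truncn (T / d)).+1; pose s (i : nat) := T / n%:R * i%:R.
have n0 : 0 < n%:R :> R by rewrite ltr0n.
have sS i : s i.+1 - s i = T / n%:R by rewrite /s -natr1; ring.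
have cell i : (i < n)%N -> s i <= s i <= s i.+1 /\ s i.+1 - s i < d.
  move=> _; rewrite lexx/= -subr_ge0 sS divr_ge0 ?(ltW T0)//; split => //.
  by rewrite ltr_pdivrMr// mulrC -ltr_pdivrMr// truncnS_gt.
have s0 : s 0%N = 0 by rewrite /s mulr0.
have sn : s n = T by rewrite /s divfK// gt_eqF.
have hd := Hd n s s s0 sn cell.
have mono i : (i < n)%N -> s i <= s i.+1 by move=> /cell[/andP[]].
have [lS hS] : L2 (\sum_(i < n) (s i.+1 - s i) *: poly01 (TQ (s i) p)) /\
    nrm2 (\sum_(i < n) (s i.+1 - s i) *: poly01 (TQ (s i) p)) <= (s n - s 0%N) * nrm2 (poly01 p).
  apply: (@riemann_nrm2 n s (fun i => poly01 (TQ (s i) p))) => i i_n; split; [exact: mono|exact: L2_poly01|].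
  by apply: semigroup_l2contraction; apply: (partition_ge0 s0 mono); exact: ltnW.
have lA := L2_poly01 beta (mean_poly T p).
rewrite -{1}(gtr0_norm T0) -nrm2Z//.
have := nrm2_dist_le (L2Z T lA) lS (L2_cst beta 0); rewrite (_ : cst 0 = 0)// !subr0.
move/le_trans; apply; rewrite lerD//; first by rewrite nrm2_distC.
by rewrite sn s0 subr0 in hS.
Qed.

Lemma mean_Riemann_integral f (T : R) : 0 < T -> L2 f ->
  L2_Riemann_integral beta (fun t => semigroup2 t f) T (T *: l2extend beta (mean_poly T) f).
Proof.
move=> T0 lf; have cA := mean_l2contraction T0; have lE := L2_l2extend beta01 cA lf.
split=> [|e e0]; first exact: L2Z.
have e40 : 0 < e / 4 by rewrite divr_gt0.
have [p fp] := polynomials_dense beta01 lf (divr_gt0 e40 T0).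
have [d d0 Hd] := riemann_semigroup_poly p T0 e40.
exists d => // n s tau s0 sn cell.
have mono i : (i < n)%N -> s i <= s i.+1 by move=> /cell[/andP[h1 h2] _]; exact: le_trans h1 h2.
have tau0 i : (i < n)%N -> 0 <= tau i.
  move=> i_n; have [/andP[+ _] _] := cell i i_n; apply: le_trans.
  by apply: (partition_ge0 s0 mono); exact: ltnW.
have lA := L2_poly01 beta (mean_poly T p).
have [l1 h1] : L2 (\sum_(i < n) (s i.+1 - s i) *: (semigroup2 (tau i) f - poly01 (TQ (tau i) p))) /\
    nrm2 (\sum_(i < n) (s i.+1 - s i) *: (semigroup2 (tau i) f - poly01 (TQ (tau i) p))) <=
    (s n - s 0%N) * (e / 4 / T).
  apply: (@riemann_nrm2 n s (fun i => semigroup2 (tau i) f - poly01 (TQ (tau i) p))) => i i_n.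
  split; first exact: mono.
    by apply: L2B; [apply: L2_semigroup2 => //; exact: tau0|exact: L2_poly01].
  by apply: le_trans fp; apply: semigroup2_dist => //; exact: tau0.
have [l2 _] : L2 (\sum_(i < n) (s i.+1 - s i) *: poly01 (TQ (tau i) p)) /\
    nrm2 (\sum_(i < n) (s i.+1 - s i) *: poly01 (TQ (tau i) p)) <= (s n - s 0%N) * nrm2 (poly01 p).
  apply: (@riemann_nrm2 n s (fun i => poly01 (TQ (tau i) p))) => i i_n; split; [exact: mono|exact: L2_poly01|].
  by apply: semigroup_l2contraction; exact: tau0.
have h2 := Hd n s tau s0 sn cell.
have h3 : nrm2 (T *: (poly01 (mean_poly T p) - l2extend beta (mean_poly T) f)) <= e / 4.
  rewrite nrm2Z; last exact: L2B.
  rewrite gtr0_norm// -ler_pdivlMl// mulrC nrm2_distC; apply: le_trans fp.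
  exact: l2extend_dist.
rewrite sn s0 subr0 mulrC divfK ?gt_eqF// in h1.
set S1 := \sum_(i < n) _ *: (_ - _) in l1 h1; set S2 := \sum_(i < n) _ *: poly01 _ in l2 h2.
have -> : \sum_(i < n) (s i.+1 - s i) *: semigroup2 (tau i) f - T *: l2extend beta (mean_poly T) f =
    S1 + (S2 - T *: poly01 (mean_poly T p)) + T *: (poly01 (mean_poly T p) - l2extend beta (mean_poly T) f).
  rewrite scalerBr addrA addrA subrK; congr (_ - _).
  by rewrite /S1 /S2 -big_split/=; apply: eq_bigr => i _; rewrite -scalerDr subrK.
have lB : L2 (S2 - T *: poly01 (mean_poly T p)) by apply: L2B => //; exact: L2Z.
have lC : L2 (T *: (poly01 (mean_poly T p) - l2extend beta (mean_poly T) f)) by apply/L2Z/L2B.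
have lAB := L2D l1 lB; have lABC := L2D lAB lC.
rewrite (l2normE lABC) lte_fin.
apply: (le_lt_trans (nrm2D lAB lC)); apply: (le_lt_trans (lerD (nrm2D l1 lB) h3)).
apply: (le_lt_trans (lerD (lerD h1 h2) (lexx _))); lra.
Qed.

Lemma expR_mean_infty k : expR_mean (th k) T @[T --> +oo] --> ((k == 0)%:R : R).
Proof.
case: k => [|k]; rewrite /expR_mean.
  by rewrite th0 eqxx; exact: cvg_cst.
have tk : 0 < th k.+1.
  by rewrite lt_neqAle th_ge0 andbT eq_sym -th0; apply/eqP => /th_inj.
rewrite gt_eqF//; apply/cvgrPdist_le => d d0.
near=> T; have T0 : 0 < T by near: T; apply: nbhs_pinfty_gt; rewrite num_real.
have HT : (th k.+1 * d)^-1 <= T by near: T; apply: nbhs_pinfty_ge; rewrite num_real.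
have tT : 0 < th k.+1 * T by rewrite mulr_gt0.
rewrite sub0r normrN ger0_norm; last first.
  by rewrite divr_ge0 ?(ltW tT)// subr_ge0 -expR0 ler_expR oppr_le0 ltW.
rewrite ler_pdivrMr//; apply: (@le_trans _ _ 1); first by have := expR_ge0 (- (th k.+1 * T)); lra.
by rewrite mulrA (mulrC d) -ler_pdivrMl ?mulr_gt0// mulr1.
Unshelve. all: by end_near. Qed.

Lemma semigroup2_ergodic : ergodic beta semigroup2.
Proof.
move=> f lf; exists (fun T => T *: l2extend beta (mean_poly T) f).
split; first by move=> T T0; exact: mean_Riemann_integral.
set m := \int[beta]_x f x.
have FF : Filter (pinfty_nbhs R) by exact: proper_pinfty_nbhs.
have simp (T : R) : 0 < T -> T^-1 *: (T *: l2extend beta (mean_poly T) f) = l2extend beta (mean_poly T) f.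
  by move=> T0; rewrite scalerA mulVf ?gt_eqF// scale1r.
have Tpos : \forall T \near +oo, 0 < (T : R) by apply: nbhs_pinfty_gt; rewrite num_real.
apply/(@l2norm_cvg0 _ beta _ _ FF) => [|e e0].
  apply: filterS Tpos => T T0; rewrite simp//; apply: L2B; last exact: L2_cst.
  by apply: L2_l2extend => //; exact: mean_l2contraction.
have e30 : 0 < e / 3 by rewrite divr_gt0.
have [p fp] := polynomials_dense beta01 lf e30.
set c := eig_coord a th 0 p.
have cm : `|c - m| <= e / 3.
  apply: le_trans fp; rewrite nrm2_distC; have lp := L2_poly01 beta p.
  rewrite /c -Rintegral_eig_coord -Rintegral_poly01 /m -RintegralB//; first last.
  - exact: L2_integrable.
  - exact: L2_integrable.
  exact: (Rintegral_le_nrm2 (L2B lp lf)).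
near=> T; have T0 : 0 < T by near: T.
have cA := mean_l2contraction T0; have lE := L2_l2extend beta01 cA lf.
have lA := L2_poly01 beta (mean_poly T p); have lc := L2_poly01 beta c%:P.
rewrite simp//.
apply: (le_trans (nrm2_dist_le lE lA (L2_cst beta m))).
apply: (le_trans (lerD (lexx _) (nrm2_dist_le lA lc (L2_cst beta m)))).
apply: (le_trans (lerD (lexx _) (lerD (lexx _) (nrm2_dist_le lc (L2_cst beta c) (L2_cst beta m))))).
have h1 := le_trans (l2extend_dist beta01 p cA lf) fp.
have h2 : nrm2 (poly01 (mean_poly T p) - poly01 c%:P) <= e / 3.
  rewrite -poly01B; apply: nrm2_poly01; first exact: ltW.
  have -> : c%:P = calc (fun k => (k == 0)%:R) p.
    rewrite -[c]mul1r -(eig_mult_at0 _ th_inj); apply: eq_eig_mult => // k.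
    by rewrite mul1r.
  move=> x xI; rewrite hornerD hornerN; apply: ltW; move: x xI; near: T.
  exact: (eig_mult_cvg a th_inj p FF expR_mean_infty e30).
have h3 : nrm2 (poly01 c%:P - cst c) = 0.
  apply: nrm2_dist_ae => //; first exact: L2_cst.
  apply: (@filterS _ _ (ae_filter_ringOfSetsType beta)) (ae_D01 beta01) => x xI _.
  by rewrite /poly01 on01E// hornerC.
have h4 : nrm2 (cst c - cst m) <= e / 3.
  apply: le_trans cm; apply: nrm2_bounded => //; exact: (@measurable_cst _ _ _ _ setT (c - m)).
rewrite h3 add0r; have -> : e = e / 3 + (e / 3 + e / 3) by field.
exact: lerD h1 (lerD h2 h4).
Unshelve. all: by end_near. Qed.

End L2Semigroup.

(** * The Gamma function *)

Section GammaFunction.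
Context {R : realType}.
Local Notation leb := (@lebesgue_measure R).
Implicit Types (a s t x : R).

(** The Gamma integral after the substitution x = exp (- t). *)
Definition log_Gamma_integral a : \bar R :=
  (\int[leb]_t (expR (- (a * t)) * expR (- expR (- t)))%:E)%E.
Local Notation G := log_Gamma_integral.

Let measurable_expR_lin c s : measurable_fun [set: R] (fun t => expR (- (c * (t + s)))).
Proof.
apply: continuous_measurable_fun => t; apply: continuous_comp; last exact: continuous_expR.
by apply: cvgN; apply: cvgMr; apply: cvgD; [exact: cvg_id|exact: cvg_cst].
Qed.

Let measurable_expR_lin0 c : measurable_fun [set: R] (fun t => expR (- (c * t))).
Proof. by have := measurable_expR_lin c 0; under eq_fun do rewrite addr0. Qed.

Let measurable_gumbel : measurable_fun [set: R] (fun t => expR (- expR (- t))).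
Proof.
apply: measurableT_comp => //; apply: measurable_funN.
by have := measurable_expR_lin0 1; under eq_fun do rewrite mul1r.
Qed.

Lemma GammaE a : Gamma a = fine (G a).
Proof.
rewrite /Gamma /Rintegral; congr fine.
rewrite (@ge0_integral_expRN _ (fun x => (x `^ (a - 1) * expR (- x))%:E)); last first.
- by move=> x; rewrite lee_fin mulr_ge0 ?powR_ge0 ?expR_ge0.
- apply/measurable_EFinP; apply: measurable_funM; first exact: measurable_powR.
  by have := measurable_expR_lin0 1; under eq_fun do rewrite mul1r.
apply: eq_integral => t _; rewrite -EFinM mulrA -expRM.
have E : - (a * t) = - t + - t * (a - 1) by ring.
by rewrite E expRD.
Qed.

Lemma integral_expR_halfline a s : 0 < a ->
  (\int[leb]_t ((expR (- (a * (t + s))))%:E * (\1_(`[0%R, +oo[%classic) t)%:E) =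
   (expR (- (a * s)) / a)%:E)%E.
Proof.
move=> a0; transitivity (\int[leb]_(t in `[0%R, +oo[) (expR (- (a * (t + s))))%:E)%E.
  by rewrite [RHS]integral_mkcond; apply: eq_integral => t _; rewrite epatch_indic.
have dF t : is_derive t (1 : R) (fun t => - expR (- (a * (t + s))) / a) (expR (- (a * (t + s)))).
  apply: is_derive_eq; rewrite /GRing.scale/=; field; exact: lt0r_neq0.
have cF : continuous (fun t => - expR (- (a * (t + s))) / a).
  move=> t; apply: differentiable_continuous; apply/derivable1_diffP.
  by case: (dF t).
rewrite (@ge0_continuous_FTC2y _ _ (fun t => - expR (- (a * (t + s))) / a) _ 0).
- by rewrite -EFinB sub0r add0r mulNr opprK.
- by move=> t _; exact: expR_ge0.
- apply: continuous_subspaceT => t; apply: continuous_comp; last exact: continuous_expR.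
  by apply: cvgN; apply: cvgMr; apply: cvgD; [exact: cvg_id|exact: cvg_cst].
- rewrite -[X in _ --> X](_ : - 0 / a = 0); last by rewrite oppr0 mul0r.
  apply: cvgMl; apply: cvgN.
  apply: (@cvg_comp _ _ _ (fun t => a * (t + s)) (fun x => expR (- x)) _ (+oo : set_system R)).
    apply/cvgryPge => A; near=> t; rewrite mulrC -ler_pdivrMr// -lerBlDr.
    by near: t; apply: nbhs_pinfty_ge; rewrite num_real.
  exact: cvgr_expR.
- by move=> t _; case: (dF t).
- by apply: cvg_at_right_filter; exact: cF.
- by move=> t _; rewrite derive1E; case: (dF t).
Unshelve. all: by end_near. Qed.

Lemma gumbel_integral t :
  (\int[leb]_s ((\1_(`[0%R, +oo[%classic) (t - s)%R)%:E * (expR (- s) * expR (- expR (- s)))%:E) =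
   (expR (- expR (- t)))%:E)%E.
Proof.
rewrite -integral_expRN; pose A : set (measurableTypeR R) := `[expR (- t), +oo[%classic.
have mA : measurable A by exact: measurable_itv.
transitivity (\int[leb]_(x in `]0%R, +oo[) ((expR (- x))%:E * (\1_A x)%:E))%E.
  rewrite ge0_integral_expRN; last first.
  - by move=> x; rewrite mule_ge0// lee_fin ?expR_ge0.
  - apply: emeasurable_funM; apply/measurable_EFinP; last exact: measurable_indic.
    by have := measurable_expR_lin0 1; under eq_fun do rewrite mul1r.
  apply: eq_integral => s _; rewrite EFinM muleCA; congr (_ * _)%E.
  rewrite muleC; congr (_ * _)%E; rewrite !indicE; congr (_%:R%:E); congr nat_of_bool.
  by apply/idP/idP; rewrite !inE /A /= !in_itv/= !andbT subr_ge0 ler_expR lerN2.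
rewrite [LHS]integral_mkcond [RHS]integral_mkcond; apply: eq_integral => x _.
rewrite !patchE indicE mem_setE in_itv/= andbT /A mem_setE in_itv/= andbT.
have [x0|x0] := ltP 0 x; first by case: ifP; rewrite ?mule1 ?mule0.
by rewrite leNgt (le_lt_trans x0 (expR_gt0 _)).
Qed.

(** Tonelli applied to the convolution that expresses exp (- e^-t) as the integral of its
    derivative e^-s exp (- e^-s) up to t. *)
Lemma log_Gamma_integralS a : 0 < a -> (G (a + 1) = a%:E * G a)%E.
Proof.
move=> a0.
have mg : measurable_fun [set: R] (fun t => (\1_(`[0%R, +oo[%classic : set R) t : R)%:E).
  by apply/measurable_EFinP; exact: measurable_indic.
have mu_ : measurable_fun [set: R] (fun s => (expR (- s) * expR (- expR (- s)))%:E).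
  apply/measurable_EFinP; apply: measurable_funM; last exact: measurable_gumbel.
  by have := measurable_expR_lin0 1; under eq_fun do rewrite mul1r.
have := @ge0_integral_conv R (fun t => (expR (- (a * t)))%:E)
  (fun t => (\1_(`[0%R, +oo[%classic) t)%:E) (fun s => (expR (- s) * expR (- expR (- s)))%:E)
  _ _ mg _ mu_ _.
under eq_integral do rewrite gumbel_integral -EFinM.
rewrite -/(G a) => ->.
- under eq_integral do rewrite integral_expR_halfline//.
  rewrite -ge0_integralZl//; first last.
  + by rewrite lee_fin ltW.
  + by move=> s _; rewrite mule_ge0// lee_fin ?mulr_ge0 ?expR_ge0// invr_ge0 ltW.
  + apply: emeasurable_funM => //; apply/measurable_EFinP.
    by apply: measurable_funM => //; exact: measurable_expR_lin0.
  apply: eq_integral => s _; rewrite -!EFinM; congr (_%:E).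
  rewrite mulrDl mul1r opprD expRD; field; exact: lt0r_neq0.
- by apply/measurable_EFinP; exact: measurable_expR_lin0.
- by move=> t; rewrite lee_fin expR_ge0.
- by move=> t; rewrite lee_fin.
- by move=> t; rewrite lee_fin mulr_ge0 ?expR_ge0.
Qed.

Lemma log_Gamma_integral_ge0 a : (0 <= G a)%E.
Proof. by apply: integral_ge0 => t _; rewrite lee_fin mulr_ge0 ?expR_ge0. Qed.

Lemma log_Gamma_integral_gt0 a : 0 < a -> (0 < G a)%E.
Proof.
move=> a0; pose I : set (measurableTypeR R) := `[0%R, 1%R]%classic.
have mG : measurable_fun [set: measurableTypeR R]
    (fun t => (expR (- (a * t)) * expR (- expR (- t)))%:E).
  by apply/measurable_EFinP; apply: measurable_funM; [exact: measurable_expR_lin0|exact: measurable_gumbel].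
apply: (@lt_le_trans _ _ (\int[leb]_(t in I) (cst (expR (- (a + 1)))%:E t))%E).
  rewrite integral_cst; last exact: measurable_D01.
  rewrite [X in (_ * X)%E](_ : _ = 1%E) ?mule1 ?lte_fin ?expR_gt0//.
  by apply: etrans (lebesgue_measure_itv _) _; rewrite /= lte_fin ltr01 -EFinB subr0.
apply: (@le_trans _ _ (\int[leb]_(t in I) (expR (- (a * t)) * expR (- expR (- t)))%:E)%E).
  apply: ge0_le_integral => //.
  - exact: measurable_D01.
  - by move=> t _; rewrite lee_fin expR_ge0.
  - by apply: measurable_funTS.
  - move=> t; rewrite /I /= in_itv/= => /andP[t0 t1]; rewrite lee_fin -expRD ler_expR.
    have : a * t <= a by rewrite ler_piMr// ltW.
    have : expR (- t) <= 1 by rewrite -expR0 ler_expR oppr_le0.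
    by move=> *; lra.
by apply: ge0_subset_integral => //; exact: measurable_D01.
Qed.

Lemma log_Gamma_integral1 : (G 1 <= 1)%E.
Proof.
have := @ge0_integral_expRN R (fun x => (expR (- x))%:E).
under [X in _ -> _ -> _ = X]eq_integral do rewrite -EFinM.
move=> H; rewrite /G; under eq_integral do rewrite mul1r.
have mE : measurable_fun [set: R] (fun x : R => expR (- x)).
  by have := measurable_expR_lin0 1; under eq_fun do rewrite mul1r.
rewrite -H; first last.
- by move=> x; rewrite lee_fin expR_ge0.
- exact/measurable_EFinP.
rewrite (_ : 1%E = (expR (- 0))%:E); last by rewrite oppr0 expR0.
rewrite -integral_expRN; apply: ge0_subset_integral => //.
- by apply: measurable_funTS; exact/measurable_EFinP.
- by move=> x /=; rewrite !in_itv/= !andbT; exact: ltW.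
Qed.

(** Finite at the integers by the functional equation; for b >= 1 the integrand at b lies
    below the sum of those at two integers around b, and the functional equation
    carries this to (0, 1). *)
Lemma log_Gamma_integral_lty a : 0 < a -> (G a < +oo)%E.
Proof.
have Gn n : (G n.+1%:R < +oo)%E.
  elim: n => [|n ih]; first exact: le_lt_trans log_Gamma_integral1 (ltry 1).
  by rewrite -natr1 log_Gamma_integralS// lte_mul_pinfty// lee_fin.
have mG b : measurable_fun [set: measurableTypeR R]
    (fun t => (expR (- (b * t)) * expR (- expR (- t)))%:E).
  by apply/measurable_EFinP; apply: measurable_funM; [exact: measurable_expR_lin0|exact: measurable_gumbel].
have g0 b (t : R) : [set: measurableTypeR R] t -> (0 <= (expR (- (b * t)) * expR (- expR (- t)))%:E)%E.
  by rewrite lee_fin mulr_ge0 ?expR_ge0.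
have ge1 b : 1 <= b -> (G b < +oo)%E.
  move=> b1; pose n := Num.truncn b.
  have bn : b <= n.+1%:R by exact/ltW/truncnS_gt.
  apply: (@le_lt_trans _ _ (G 1%:R + G n.+1%:R)%E); last by rewrite lte_add_pinfty.
  rewrite /G -ge0_integralD//; apply: ge0_le_integral => //.
  - exact: emeasurable_funD.
  - move=> t _; rewrite -EFinD lee_fin -mulrDl ler_wpM2r ?expR_ge0//.
    have [t0|t0] := leP 0 t.
      by rewrite (le_trans (_ : _ <= expR (- (1 * t)))) ?lerDl ?expR_ge0// ler_expR lerN2 ler_wpM2r.
    rewrite (le_trans (_ : _ <= expR (- (n.+1%:R * t)))) ?lerDr ?expR_ge0// ler_expR lerN2.
    by rewrite ler_wnM2r// ltW.
move=> a0; have : (G (a + 1) < +oo)%E by apply: ge1; rewrite lerDr ltW.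
rewrite log_Gamma_integralS// => H.
rewrite ltNge; apply/negP; rewrite leye_eq => /eqP E.
by move: H; rewrite E gt0_muley ?lte_fin.
Qed.

Lemma GammaS a : 0 < a -> Gamma (a + 1) = a * Gamma a.
Proof.
move=> a0; rewrite !GammaE log_Gamma_integralS// fineM//.
by rewrite ge0_fin_numE ?log_Gamma_integral_lty ?log_Gamma_integral_ge0.
Qed.

Lemma Gamma_gt0 a : 0 < a -> 0 < Gamma a.
Proof.
move=> a0; rewrite GammaE fine_gt0// log_Gamma_integral_gt0//.
exact: log_Gamma_integral_lty.
Qed.

Lemma pochhammer_prod a n : 0 < a -> pochhammer a n%:R = \prod_(k < n) (a + k%:R).
Proof.
move=> a0; rewrite /pochhammer; elim: n => [|n ih].
  by rewrite addr0 big_ord0 divff// gt_eqF// Gamma_gt0.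
rewrite big_ord_recr/= -ih -natr1 addrA GammaS; last by rewrite ltr_wpDr.
by rewrite [RHS]mulrC mulrA.
Qed.

End GammaFunction.

(** * The moment formula and the theorem *)

Section JacobiMoments.
Context {R : realType}.
Local Notation leb := (@lebesgue_measure R).
Variables (lambda1 mu : R) (h : R -> R).
Hypotheses (h_ge0 : forall r, 0 <= h r).
Hypothesis h_int : leb.-integrable `]1, +oo[ (EFin \o h).
Hypotheses (mu_l1 : mu < lambda1) (hbar_mu : hbar h < mu).
Local Notation a := (jacobi_lower mu h).
Local Notation th := (jacobi_eigenvalue lambda1).

Lemma Psi_gt0 (u : R) : 1 <= u -> 0 < Psi mu h u.
Proof.
move=> u1; have u0 : 0 < u by exact: lt_le_trans u1.
rewrite /Psi; set I := \int[_]_(r in _) _.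
have I0 : 0 <= I.
  apply: Rintegral_ge0 => r /=; rewrite in_itv/= andbT => r1.
  rewrite mulr_ge0// subr_ge0 -(powRr0 r).
  by rewrite ler_powR ?(ltW r1)// oppr_le0 ltW.
rewrite (_ : _ + _ = u * (u - 1 + (mu - hbar h) + I)); last by ring.
by rewrite mulr_gt0// ltr_wpDr// ltr_wpDl ?subr_ge0// subr_gt0.
Qed.

(** On [1, oo) the inequality hbar < mu makes [Psi] positive, so a positive root lies
    below 1. *)
Lemma r0_itv : 0 <= r0 mu h < 1.
Proof.
rewrite /r0; case: (mu < 1 + hbar h)%R; rewrite ?mulr0 ?lexx ?ltr01// mulr1.
rewrite /rroot; case: xgetP => [u -> [u0 Pu]|_]; last by rewrite lexx ltr01.
rewrite ltW//= ltNge; apply/negP => /Psi_gt0; by rewrite Pu ltxx.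
Qed.

Lemma r1_gt0 : 0 < r1 mu h.
Proof. by rewrite subr_gt0; case/andP: r0_itv. Qed.

Lemma phi_nat n : phi mu h n.+1%:R = a n.+1 / (r1 mu h + n%:R).
Proof.
have /andP[_ r01] := r0_itv.
rewrite /phi gt_eqF; last by rewrite (lt_le_trans r01)// ler1n.
by congr (_ / _); rewrite /r1 -natr1; ring.
Qed.

(** The Pochhammer symbol of [r1] cancels the denominators k - r0 of [phi]. *)
Lemma beta_momentE n : beta_moment lambda1 mu h n = eig_dual a th n 0.
Proof.
have r10 := r1_gt0; have l0 := lambda1_gt0_of_lt h_ge0 mu_l1 hbar_mu.
rewrite /beta_moment !pochhammer_prod// /eig_dual /W_phi big_add1/= big_mkord big_mkord.
have -> : \prod_(k < n) phi mu h k.+1%:R = \prod_(k < n) (a k.+1 / (r1 mu h + k%:R)).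
  by apply: eq_bigr => k _; exact: phi_nat.
elim: n => [|n ih]; first by rewrite !big_ord0 fact0 !divr1 mulr1.
rewrite !big_ord_recr/= -ih factS natrM jacobi_eigenvalue0 subr0 jacobi_eigenvalueS.
have p0 : \prod_(k < n) (lambda1 + k%:R) != 0.
  by apply/prodf_neq0 => k _; rewrite gt_eqF// ltr_wpDr.
have f0 : n`!%:R != 0 :> R by rewrite pnatr_eq0 -lt0n fact_gt0.
have r1n : r1 mu h + n%:R != 0 by rewrite gt_eqF// ltr_wpDr.
have l1n : lambda1 + n%:R != 0 by rewrite gt_eqF// ltr_wpDr.
have n1 : n.+1%:R != 0 :> R by rewrite pnatr_eq0.
move: (\prod_(k < n) (r1 mu h + k%:R)) (\prod_(k < n) (a k.+1 / (r1 mu h + k%:R))) (a n.+1) => A B D.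
move: (\prod_(k < n) (lambda1 + k%:R)) p0 (n`!%:R : R) f0 (n.+1%:R : R) n1 => E E0 F F0 N N0.
rewrite (addrC n%:R lambda1).
by field; rewrite N0 F0 r1n l1n E0.
Qed.

Lemma eig_dual_le1 n : eig_dual a th n 0 <= 1.
Proof.
rewrite /eig_dual big_mkord; apply: prodr_ile1 => i _.
have l0 := lambda1_gt0_of_lt h_ge0 mu_l1 hbar_mu.
have ti : 0 < th i.+1 by rewrite jacobi_eigenvalueS mulr_gt0// ltr_wpDl.
rewrite jacobi_eigenvalue0 subr0 divr_ge0 ?(ltW ti) ?(ltW (jacobi_lower_gt0 h_ge0 h_int hbar_mu i))//=.
rewrite ler_pdivrMr// mul1r jacobi_eigenvalueS jacobi_lowerE// ler_pM2l//.
by have := hmom_ge0 h_ge0 i; have := mu_l1; lra.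
Qed.

End JacobiMoments.

Theorem theorem2p1 (R : realType) (lambda1 mu : R) (h : R -> R)
  (Pi : {finite_measure set (measurableTypeR R) -> \bar R})
  (lambda1_gt0 : 0 < lambda1) (mu_gt0 : 0 < mu)
  (h_ge0 : forall r, 0 <= h r) (h_out : forall r, r <= 1 -> h r = 0)
  (h_int : (@lebesgue_measure R).-integrable `]1, +oo[ (EFin \o h))
  (h_Pi : minus_derivative_measure h Pi)
  (h_neq0 : (exists r, h r != 0) ->
     (mu < 1 + hbar h)%R%:R + mu < lambda1 /\ hbar h < mu)
  (h_eq0 : (forall r, h r = 0) -> mu < lambda1) :
  exists beta : probability (measurableTypeR R) R,
    [/\ Stieltjes_moments (beta_moment lambda1 mu h) beta,
        (forall nu : probability (measurableTypeR R) R,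
           Stieltjes_moments (beta_moment lambda1 mu h) nu ->
           forall A : set (measurableTypeR R), measurable A -> nu A = beta A),
        beta `<< @lebesgue_measure R,
        msupport beta = `[0, 1]%classic &
        exists f : R -> R,
          [/\ is_density beta f, {in `]0, 1[, continuous f},
              {in `]0, 1[, forall x, 0 < f x} &
              forall x, x \notin `]0, 1[ -> f x = 0]] /\
    exists (QC Q : R -> (R -> R) -> R -> R)
           (D : set (R -> R)) (J : (R -> R) -> R -> R),
      [/\ Markov_semigroup_C01 QC,
          invariant_measure QC beta,
          (forall nu : probability (measurableTypeR R) R, invariant_measure QC nu ->
             forall A : set (measurableTypeR R), measurable A -> nu A = beta A)
        & L2_extension beta QC Q] /\
      [/\ is_generator beta Q D J,
          (forall p : {poly R}, D (on01 (horner p)) /\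
             J (on01 (horner p)) = on01 (Jacobi_op lambda1 mu h (horner p))
               %[ae beta]),
          is_core beta D J [set on01 (horner p) | p in [set: {poly R}]]
        & ergodic beta Q].
Proof.
have [mu_l1 hbar_mu] : mu < lambda1 /\ hbar h < mu.
  have [hn0|h0] := pselect (exists r, h r != 0).
    have [H1 H2] := h_neq0 hn0; split => //; apply: le_lt_trans H1.
    by rewrite lerDr ler0n.
  have {}h0 r : h r = 0 by apply/eqP; apply: contra_notT h0 => hr; exists r.
  split; first exact: h_eq0.
  rewrite /hbar (_ : h = cst 0); last by apply/funext => r; rewrite h0.
  by rewrite Rintegral_cst// mul0r.
have [beta [f [df cf fpos f0 [mf mom]]]] :=
  exists_invariant_law h_ge0 h_out h_int h_Pi mu_l1 hbar_mu.
have [ac supp] := density_support df mf fpos f0.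
have mE n : beta_moment lambda1 mu h n = eig_dual (jacobi_lower mu h) (jacobi_eigenvalue lambda1) n 0.
  exact: beta_momentE.
have le1 n : beta_moment lambda1 mu h n <= 1 by rewrite mE; exact: eig_dual_le1.
have bS : Stieltjes_moments (beta_moment lambda1 mu h) beta.
  have mI : measurable (`[0%R, +oo[%classic : set (measurableTypeR R)) by exact: measurable_itv.
  have sub : `]0%R, 1%R[%classic `<=` (`[0%R, +oo[%classic : set (measurableTypeR R)).
    by move=> x /=; rewrite !in_itv/= andbT => /andP[/ltW].
  split; last by move=> n; rewrite mE; apply: mom.
  have := mom _ 0%N mI sub (@subset_refl _ _).
  rewrite /eig_dual big_geq// => <-; under eq_integral do rewrite expr0.
  by rewrite integral_cst// mul1e.
have [beta01 bmom] := Stieltjes_moments_supp bS le1.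
have mom01 n : \int[beta]_(x in (`[0%R, 1%R]%classic : set (measurableTypeR R))) (x ^+ n) =
    eig_dual (jacobi_lower mu h) (jacobi_eigenvalue lambda1) n 0 by rewrite bmom mE.
have ti := @jacobi_eigenvalue_inj _ _ _ _ h_ge0 mu_l1 hbar_mu.
have t0 := jacobi_eigenvalue0 lambda1; have tp := jacobi_eigenvalue_ge0 h_ge0 mu_l1 hbar_mu.
have minp := @jacobi_minimum_principle _ _ _ _ _ h_ge0 h_out h_int h_Pi mu_l1 hbar_mu.
exists beta; split.
  split => //; last by exists f.
  move=> nu /Stieltjes_moments_supp/(_ le1)[nu01 numom].
  apply: probability01_unique => //; apply: eq_moments_C01 => n.
  by rewrite numom bmom.
exists (semigroup01 (jacobi_lower mu h) ti), (semigroup2 beta (jacobi_lower mu h) ti),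
  (L2_domain beta (jacobi_lower mu h) ti), (L2_generator beta (jacobi_lower mu h) ti).
split; split.
- exact: semigroup01_markov.
- exact: semigroup01_invariant.
- by move=> nu; exact: semigroup01_invariant_unique.
- exact: semigroup2_extension.
- exact: L2_is_generator.
- move=> p; split; first exact: L2_domain_poly.
  have -> : on01 (Jacobi_op lambda1 mu h (horner p)) =
      poly01 (shift_op (jacobi_lower mu h) (jacobi_eigenvalue lambda1) p).
    by congr on01; apply/funext => x; exact: Jacobi_op_horner.
  exact: L2_generator_poly.
- exact: L2_core.
- exact: semigroup2_ergodic.
Qed.
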